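(* For every compact set $K\subset\Omega$, $$H^N(K)=c_\Omega(K),$$ where $$c_\Omega(K)=\inf\Big\{\iint_{Q_T}|\partial_t\psi+\Delta\psi|\,dx\,dt:\ \psi\in C^{2,1}_{\ell,0}(\overline{Q_T}),\ \psi(x,0)\ge1\text{ for all }x\text{ in a neighborhood of }K\Big\}.$$
   Context: $\Omega\subset\mathbb{R}^N$ ($N\ge1$) is a bounded domain, $T>0$, $Q_T=\Omega\times(0,T)$, and $H^N$ is $N$-dimensional Hausdorff measure on $\mathbb{R}^N$. $C^{2,1}_{\ell,0}(\overline{Q_T})$ is the space of functions in $C^{2,1}(\overline{Q_T})$ (twice continuously differentiable in $x$, once in $t$, up to the boundary) vanishing on $\partial\Omega\times[0,T]\cup\overline\Omega\times\{T\}$. *)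

(* Defs.v *)
From HB Require Import structures.
From mathcomp Require Import all_boot all_order all_algebra.
From mathcomp Require Import all_classical all_reals all_analysis.
Set Implicit Arguments. Unset Strict Implicit. Unset Printing Implicit Defensive.
Import Order.TTheory GRing.Theory Num.Theory.
Import numFieldNormedType.Exports.
Local Open Scope classical_set_scope.
Local Open Scope ring_scope.

Section Defs.
Variable R : realType.

(* Euclidean norm/distance on R^N = 'rV[R]_N (the library norm on matrices is the sup-norm) *)
Definition enorm (N : nat) (x : 'rV[R]_N) : R := Num.sqrt (\sum_(i < N) x ord0 i ^+ 2).
Definition edist (N : nat) (x y : 'rV[R]_N) : R := enorm (x - y).

(* iterated one-dimensional Lebesgue integrals over R^N (Tonelli form of the
   N-dimensional Lebesgue integral of a nonnegative function) *)
Fixpoint iter_int (n : nat) : ('rV[R]_n -> \bar R) -> \bar R :=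
  match n return ('rV[R]_n -> \bar R) -> \bar R with
  | 0 => fun f => f 0
  | n'.+1 => fun f =>
      (\int[@lebesgue_measure R]_(s in setT)
         iter_int (fun y : 'rV[R]_n' => f (row_mx (const_mx s : 'rV[R]_1) y)))%E
  end.

Definition alpha (N : nat) : \bar R :=
  iter_int (fun x : 'rV[R]_N => (\1_[set y | enorm y < 1] x)%:E).

Definition diamE (N : nat) (A : set 'rV[R]_N) : \bar R :=
  ereal_sup [set (edist x y)%:E | x in A & y in A].

Definition hausdorff_delta (N : nat) (A : set 'rV[R]_N) (d : R) : \bar R :=
  ereal_inf [set s | exists C : nat -> set 'rV[R]_N,
     A `<=` \bigcup_k C k /\
     (forall k, C k !=set0 /\ (diamE (C k) <= d%:E)%E) /\
     s = (\sum_(0 <= k <oo) (alpha N * ((fine (diamE (C k)) / 2) ^+ N)%:E))%E].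

Definition hausdorff_measure (N : nat) (A : set 'rV[R]_N) : \bar R :=
  ereal_sup [set hausdorff_delta A d | d in [set d : R | 0 < d]].

Definition bounded_domain (N : nat) (O : set 'rV[R]_N) : Prop :=
  open O /\ connected O /\ O !=set0 /\ bounded_set O.

Definition ex (N : nat) (i : 'I_N) : 'rV[R]_N * R := (delta_mx ord0 i, 0).
Definition et (N : nat) : 'rV[R]_N * R := (0, 1).

Definition QT (N : nat) (O : set 'rV[R]_N) (T : R) : set ('rV[R]_N * R) :=
  [set p | O p.1 /\ 0 < p.2 < T].
Definition QTbar (N : nat) (O : set 'rV[R]_N) (T : R) : set ('rV[R]_N * R) :=
  [set p | closure O p.1 /\ 0 <= p.2 <= T].

Definition dt (N : nat) (psi : 'rV[R]_N * R -> R) (p : 'rV[R]_N * R) : R :=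
  derive psi p (@et N).
Definition dx (N : nat) (i : 'I_N) (psi : 'rV[R]_N * R -> R) (p : 'rV[R]_N * R) : R :=
  derive psi p (ex i).
Definition lap (N : nat) (psi : 'rV[R]_N * R -> R) (p : 'rV[R]_N * R) : R :=
  \sum_(i < N) dx i (dx i psi) p.

Definition cont_ext (N : nat) (Q Qbar : set ('rV[R]_N * R)) (g : 'rV[R]_N * R -> R) :=
  exists G : 'rV[R]_N * R -> R, {within Qbar, continuous G} /\ {in Q, G =1 g}.

Definition C21 (N : nat) (O : set 'rV[R]_N) (T : R) (psi : 'rV[R]_N * R -> R) : Prop :=
  {within QTbar O T, continuous psi} /\
  (forall p, QT O T p -> derivable psi p (@et N)) /\
  cont_ext (QT O T) (QTbar O T) (dt psi) /\
  (forall i, forall p, QT O T p -> derivable psi p (ex i)) /\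
  (forall i, cont_ext (QT O T) (QTbar O T) (dx i psi)) /\
  (forall i j, forall p, QT O T p -> derivable (dx j psi) p (ex i)) /\
  (forall i j, cont_ext (QT O T) (QTbar O T) (dx i (dx j psi))).

Definition C21_l0 (N : nat) (O : set 'rV[R]_N) (T : R) (psi : 'rV[R]_N * R -> R) : Prop :=
  C21 O T psi /\
  (forall x t, closure O x -> ~ O x -> 0 <= t <= T -> psi (x, t) = 0) /\
  (forall x, closure O x -> psi (x, T) = 0).

Definition QT_itv (T : R) : set R := [set t | 0 < t < T].

Definition cap_energy (N : nat) (O : set 'rV[R]_N) (T : R) (psi : 'rV[R]_N * R -> R) : \bar R :=
  (\int[@lebesgue_measure R]_(t in QT_itv T)
     iter_int (fun x : 'rV[R]_N => (\1_O x * `|dt psi (x, t) + lap psi (x, t)|)%:E))%E.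

Definition admissible (N : nat) (O : set 'rV[R]_N) (T : R) (K : set 'rV[R]_N)
  (psi : 'rV[R]_N * R -> R) : Prop :=
  (C21_l0 O T psi /\ exists U : set 'rV[R]_N, open U /\ K `<=` U /\ (forall x, U x -> O x -> 1 <= psi (x, 0))).

Definition capacity (N : nat) (O : set 'rV[R]_N) (T : R) (K : set 'rV[R]_N) : \bar R :=
  ereal_inf [set cap_energy O T psi | psi in admissible O T K].

End Defs.

(* Main.v *)
(* Both sides equal the Lebesgue measure |K|, built here as iterated one-dimensional
   Lebesgue measure.

   Hausdorff = Lebesgue. Brunn-Minkowski (through Prekopa-Leindler) gives the
   isodiametric inequality, hence |K| <= H^N(K). Conversely, a unit cube is the union of
   its inscribed ball, whose Hausdorff cost is its measure, and of a compact remainder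
   coverable by small cubes; iterating, the cost of a cube tends to its measure, and a
   compact set is covered by finitely many small cubes of total measure close to |K|.

   Capacity <= |K|. Take psi(x, t) = Phi(x) (1 - t/d)_+^3 with a smooth cutoff Phi of K:
   the time derivative contributes at most the measure of the support of Phi, and the
   Laplacian O(d).

   Capacity >= |K|. Let m(t) be the integral of (psi(., t) - eta)^+, so that m(T) = 0 and
   m(0) >= (1 - eta) |K|. The function (psi - eta)^+ vanishes near the boundary of Omega,
   hence its discrete Laplacian integrates to 0, and a discrete Kato inequality bounds
   (m(t) - m(t + h)) / h by the integral of |dt psi + lap psi| up to a small error,
   uniformly in t away from 0 and T. Integrating in t yields m(0) <= energy of psi. *)

Require Import Defs.
From HB Require Import structures.
From mathcomp Require Import all_boot all_order all_algebra.
From mathcomp Require Import all_classical all_reals all_analysis.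
From mathcomp Require Import measurable_realfun.
From mathcomp Require Import ring lra.
Import Order.TTheory GRing.Theory Num.Theory.
Import numFieldNormedType.Exports.
Local Open Scope classical_set_scope.
Local Open Scope ring_scope.
Set Implicit Arguments. Unset Strict Implicit. Unset Printing Implicit Defensive.

(** * Lebesgue measure on row vectors *)

(** The boundary of Omega is arbitrary: no Green formula and no extension of psi across it can be
    used. Cutting psi at a height eta > 0 answers this, since psi vanishes on the lateral boundary
    and the set where psi >= eta stays at a positive distance from it. The price is a function that
    is continuous but not differentiable. Derivatives therefore give way to difference quotients
    with one step h for all points, which compactness provides, and integration by parts gives way
    to the translation invariance of Lebesgue measure. Likewise m is never differentiated: its
    increments are averaged over a time window.

    The energy is an iterated integral whose integrand is not shown to be measurable. Both bounds
    compare it with explicit measurable functions and use only that the integral of nonnegative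
    functions is monotone. *)

Definition rV_display : measure_display. Proof. exact default_measure_display. Qed.

Section measurable_rV.
Context {R : realType} (n : nat).
Definition rV_coord : 'I_n -> 'rV[R]_n -> measurableTypeR R := fun i x => x ord0 i.

Let rV_set0 : g_sigma_preimage rV_coord set0.
Proof. exact: sigma_algebra0. Qed.
Let rV_setC A : g_sigma_preimage rV_coord A -> g_sigma_preimage rV_coord (~` A).
Proof. exact: sigma_algebraC. Qed.
Let rV_bigcup (F : _^nat) : (forall i, g_sigma_preimage rV_coord (F i)) ->
  g_sigma_preimage rV_coord (\bigcup_i (F i)).
Proof. exact: sigma_algebra_bigcup. Qed.

(* The library puts no measurable structure on 'rV; the Borel one is generated by
   the coordinates. *)
HB.instance Definition _ := @isMeasurable.Build rV_display 'rV[R]_n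
  (g_sigma_preimage rV_coord) rV_set0 rV_setC rV_bigcup.

Lemma measurable_rV_coord (i : 'I_n) :
  measurable_fun [set: 'rV[R]_n] (rV_coord i).
Proof.
move=> _ Y mY; rewrite setTI; apply: sub_sigma_algebra => /=.
rewrite -bigcup_seq/=; exists i => /=; first by rewrite mem_index_enum.
by exists Y => //; rewrite setTI.
Qed.

Lemma measurable_fun_rVP d (X : measurableType d) (f : X -> 'rV[R]_n) :
  (forall i, measurable_fun [set: X] (fun x => f x ord0 i : measurableTypeR R)) ->
  measurable_fun [set: X] f.
Proof.
move=> mf.
have sub : g_sigma_preimage (fun i => rV_coord i \o f) `<=` measurable.
  apply: smallest_sub; first exact: sigma_algebra_measurable.
  rewrite -bigcup_seq; apply: bigcup_sub => i _ A [B mB <-].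
  exact: mf.
by rewrite g_sigma_preimage_comp in sub => _ A mA; apply: sub; exists A.
Qed.

End measurable_rV.

Section consr.
Context {R : realType}.

(** The concatenation that occurs in [iter_int], so that its successor case is recognised by
    conversion. *)
Definition consr n (s : R) (y : 'rV[R]_n) : 'rV[R]_n.+1 :=
  row_mx (const_mx s : 'rV[R]_1) y.
Definition tailr n (x : 'rV[R]_n.+1) : 'rV[R]_n := \row_i x ord0 (lift ord0 i).

Lemma consr0 n s (y : 'rV[R]_n) : consr s y ord0 ord0 = s.
Proof.
rewrite /consr mxE; case: splitP => [j _|j /= h]; first by rewrite mxE.
by [].
Qed.

Lemma consrS n s (y : 'rV[R]_n) i : consr s y ord0 (lift ord0 i) = y ord0 i.
Proof.
rewrite /consr mxE; case: splitP => [j /=|j /= h].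
  by rewrite /bump leq0n add1n => h; have := ltn_ord j; rewrite -h.
by congr (y _ _); apply: val_inj; move: h; rewrite /bump leq0n !add1n => -[].
Qed.

Lemma tailrK n (x : 'rV[R]_n.+1) : consr (x ord0 ord0) (tailr x) = x.
Proof.
apply/rowP => i; case: (unliftP ord0 i) => [j ->|->]; last by rewrite consr0.
by rewrite consrS mxE.
Qed.

Lemma consrK n s (y : 'rV[R]_n) : tailr (consr s y) = y.
Proof. by apply/rowP => i; rewrite mxE consrS. Qed.

Lemma rV_affineE n (a : R) (u v : 'rV[R]_n) i :
  (a *: u + v) ord0 i = a * u ord0 i + v ord0 i.
Proof. by rewrite !mxE. Qed.

Lemma consr_affine n (a s t : R) (y z : 'rV[R]_n) :
  a *: consr s y + consr t z = consr (a * s + t) (a *: y + z).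
Proof.
apply/rowP => i; rewrite rV_affineE; case: (unliftP ord0 i) => [j ->|->].
  by rewrite !consrS rV_affineE.
by rewrite !consr0.
Qed.

Lemma consr_mean n (s t : R) (y z : 'rV[R]_n) :
  2^-1 *: (consr s y + consr t z) = consr ((s + t) / 2) (2^-1 *: (y + z)).
Proof.
have E m (u v : 'rV[R]_m) i :
  (2^-1 *: (u + v)) ord0 i = (u ord0 i + v ord0 i) / 2.
  by rewrite !mxE mulrC.
apply/rowP => i; rewrite E; case: (unliftP ord0 i) => [j ->|->].
  by rewrite !consrS E.
by rewrite !consr0.
Qed.

Lemma measurable_consr n :
  measurable_fun [set: measurableTypeR R * 'rV[R]_n]
    (fun p : measurableTypeR R * 'rV[R]_n => consr p.1 p.2).
Proof.
apply: measurable_fun_rVP => i; case: (unliftP ord0 i) => [j ->|->].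
  under eq_fun do rewrite consrS.
  exact: (measurableT_comp (measurable_rV_coord j) measurable_snd).
by under eq_fun do rewrite consr0; exact: measurable_fst.
Qed.

Lemma measurable_headtail n :
  measurable_fun [set: 'rV[R]_n.+1]
    (fun x : 'rV[R]_n.+1 => ((x ord0 ord0 : measurableTypeR R), tailr x)).
Proof.
apply/measurable_fun_pairP; split => /=; first exact: measurable_rV_coord.
apply: measurable_fun_rVP => i /=; under eq_fun do rewrite mxE.
exact: (measurable_rV_coord (lift ord0 i)).
Qed.

End consr.

Section open_measurable.
Context {R : realType} (n : nat).

Lemma ball_rVP (x y : 'rV[R]_n) e : 0 < e ->
  ball x e y <-> forall i, `|x ord0 i - y ord0 i| < e.
Proof.
move=> e0; split=> [[_ h] i|h]; first exact: (h ord0 i).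
by split => // i j; rewrite ord1; exact: h.
Qed.

Lemma measurable_ball_rV (x : 'rV[R]_n) e : measurable (ball x e).
Proof.
have [e0|e0] := ltP 0 e; last first.
  rewrite (_ : ball x e = set0)//; apply/seteqP; split => // y [+ _].
  by rewrite ltNge e0.
rewrite (_ : ball x e = \bigcap_(i in [set: 'I_n])
    (rV_coord i @^-1` (ball (x ord0 i) e : set (measurableTypeR R)))).
  apply: fin_bigcap_measurable => [|i _]; first exact: finite_finset.
  rewrite -[X in measurable X]setTI; apply: measurable_rV_coord => //.
  by apply: open_measurable; exact: ball_open.
apply/seteqP; split => y.
  by move/(ball_rVP _ _ e0) => h i _; exact: h.
by move=> h; apply/(ball_rVP _ _ e0) => i; exact: h.
Qed.

(** An open set is the union of the balls with rational centre and radius 1/(m+1) that it contains.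
    There are countably many of them, and a sup-norm ball is a finite intersection of coordinate
    strips. *)
Lemma open_measurable_rV (U : set 'rV[R]_n) : open U -> measurable U.
Proof.
move=> oU.
pose q (v : 'rV[rat]_n) : 'rV[R]_n := map_mx (@ratr R) v.
pose F (p : 'rV[rat]_n * nat) : set 'rV[R]_n :=
  if `[< ball (q p.1) p.2.+1%:R^-1 `<=` U >] then ball (q p.1) p.2.+1%:R^-1
  else set0.
rewrite (_ : U = \bigcup_p F p).
  apply: countable_bigcupT_measurable => // p; rewrite /F; case: ifPn => // _.
  exact: measurable_ball_rV.
apply/seteqP; split => [x Ux|x [p _]]; last first.
  by rewrite /F; case: ifPn => // /asboolP; apply.
have /nbhs_ballP[e /= e0 eU] : nbhs x U by exact: open_nbhs_nbhs.
have [m me] : exists m, m.+1%:R^-1 < e / 2.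
  have [m _ /(_ m (leqnn _)) h] := near_infty_natSinv_lt (PosNum (divr_gt0 e0 (ltr0n _ 2))).
  by exists m.
have m0 : 0 < m.+1%:R^-1 :> R by rewrite invr_gt0.
have /choice[v vP] : forall i, exists r : rat, `|x ord0 i - ratr r| < m.+1%:R^-1.
  move=> i; have : x ord0 i < x ord0 i + m.+1%:R^-1 by rewrite ltrDl.
  case/rat_in_itvoo => r; rewrite in_itv/= => /andP[r1 r2].
  by exists r; rewrite ltr_distlC r2 andbT (lt_trans _ r1)// gtrDl oppr_lt0.
exists (\row_i v i, m) => //=; rewrite /F /=.
have qx : ball (q (\row_i v i)) m.+1%:R^-1 x.
  by apply/(ball_rVP _ _ m0) => i; rewrite !mxE distrC.
case: ifPn => // /asboolP; case => y qy; apply: eU.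
have : ball x (m.+1%:R^-1 + m.+1%:R^-1) y by apply: ball_triangle qy; exact: ball_sym.
by apply: le_ball; rewrite [leRHS]splitr ltW// ltrD.
Qed.

Lemma closed_measurable_rV (U : set 'rV[R]_n) : closed U -> measurable U.
Proof.
move=> cU; rewrite -[U]setCK; apply: measurableC; apply: open_measurable_rV.
exact: closed_openC.
Qed.

Lemma compact_measurable_rV (K : set 'rV[R]_n) : compact K -> measurable K.
Proof.
move=> cK; apply: closed_measurable_rV.
have hT : hausdorff_space 'rV[R]_n by exact: norm_hausdorff.
exact: (compact_closed hT cK).
Qed.

Lemma closed_norm_le (M : R) : closed [set y : 'rV[R]_n | `|y| <= M].
Proof.
apply: (@closed_comp _ _ (fun y : 'rV[R]_n => `|y|) [set r | r <= M]).
  by move=> y _; exact: norm_continuous.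
exact: closed_le.
Qed.

End open_measurable.

Lemma measurable_consrr {R : realType} n (s : R) :
  measurable_fun [set: 'rV[R]_n] (consr s).
Proof.
apply: measurable_fun_rVP => i; case: (unliftP ord0 i) => [j ->|->].
  by under eq_fun do rewrite consrS; exact: measurable_rV_coord.
by under eq_fun do rewrite consr0; exact: measurable_cst.
Qed.

Section lebesgue_affine.
Local Open Scope ereal_scope.
Context {R : realType}.
Variables (a b : R).
Hypothesis (a0 : (a != 0)%R).
Let phi (s : measurableTypeR R) : measurableTypeR R := (a * s + b)%R.
Lemma measurable_affine : measurable_fun [set: measurableTypeR R] phi.
Proof. by apply: measurable_funD => //; exact: measurable_funM. Qed.

Lemma lebesgue_measure_affine (A : set (measurableTypeR R)) : measurable A ->
  @lebesgue_measure R A = (`|a|)%:E * pushforward (@lebesgue_measure R) phi A.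
Proof.
move=> mA.
pose nu := mscale (NngNum (normr_ge0 a)) (pushforward (@lebesgue_measure R) phi).
rewrite -[RHS]/(nu measurable_affine A).
apply: lebesgue_measure_unique => // _ [[c d] _ <-].
rewrite -[RHS]/(`|a|%:E * lebesgue_measure (phi @^-1` `]c, d]%classic)).
have a'0 : (`|a| != 0)%R by rewrite normr_eq0.
have [ag0|al0] : (0 < a)%R \/ (a < 0)%R by apply/orP; rewrite -neq_lt eq_sym.
- rewrite (_ : phi @^-1` _ = `](c - b) / a, (d - b) / a]%classic)%R; last first.
    apply/seteqP; split => s /=; rewrite !in_itv/= ltr_pdivrMr// ler_pdivlMr//;
    by rewrite ltrBlDr lerBrDr mulrC.
  rewrite !lebesgue_measure_itv/= !lte_fin ltr_pM2r ?invr_gt0// ltrD2r.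
  case: ifPn => cd; rewrite -?EFinB ?mule0// -EFinM; congr EFin.
  by rewrite gtr0_norm//; field.
(* A negative slope reverses the interval, so the preimage is closed on the left instead; its length
   is the same. *)
- rewrite (_ : phi @^-1` _ = `[(d - b) / a, (c - b) / a[%classic)%R; last first.
    apply/seteqP; split => s /=; rewrite !in_itv/= ler_ndivrMr// ltr_ndivlMr//;
    by rewrite ltrBlDr lerBrDr mulrC andbC.
  rewrite !lebesgue_measure_itv/= !lte_fin ltr_nM2r ?invr_lt0// ltrD2r.
  case: ifPn => cd; rewrite -?EFinB ?mule0// -EFinM; congr EFin.
  by rewrite ltr0_norm//; field.
Qed.

Lemma integral_lebesgue_affine (f : R -> \bar R) :
  measurable_fun [set: R] f -> (forall x, 0 <= f x) ->
  \int[@lebesgue_measure R]_s f (a * s + b)%R =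
  (`|a|^-1)%:E * \int[@lebesgue_measure R]_s f s.
Proof.
move=> mf f0.
have a'0 : (`|a| != 0)%R by rewrite normr_eq0.
pose nu := mscale (NngNum (normr_ge0 a)) (pushforward (@lebesgue_measure R) phi).
rewrite [X in _ * X](@eq_measure_integral _ _ _ setT (nu measurable_affine)).
  rewrite ge0_integral_mscale// (ge0_integral_pushforward measurable_affine)//.
  by rewrite preimage_setT muleA -EFinM mulVf// mul1e.
by move=> A mA _; exact: lebesgue_measure_affine.
Qed.
End lebesgue_affine.


Section lebesgue_step.
Context {R : realType} (n : nat).
Variable mu : {sigma_finite_measure set 'rV[R]_n -> \bar R}.
Local Open Scope ereal_scope.

(** Tonelli's theorem for this image of the product measure is the recursion of [iter_int]. *)
Definition leb_step : set 'rV[R]_n.+1 -> \bar R :=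
  pushforward ((@lebesgue_measure R) \x mu) (fun p => consr p.1 p.2).

Let leb_step0 : leb_step set0 = 0.
Proof. by rewrite /leb_step /pushforward preimage_set0 measure0. Qed.

Let leb_step_ge0 A : 0 <= leb_step A.
Proof. by rewrite /leb_step /pushforward measure_ge0. Qed.

Let leb_step_sigma_additive : semi_sigma_additive leb_step.
Proof.
rewrite /leb_step; apply: measure_semi_sigma_additive.
exact: measurable_consr.
Qed.

HB.instance Definition _ := isMeasure.Build _ _ _ leb_step
  leb_step0 leb_step_ge0 leb_step_sigma_additive.

Lemma leb_step_sigma_finite : sigma_finite setT leb_step.
Proof.
(* Both exhaustions are nondecreasing, hence the boxes built from equal indices already cover the
   space. *)
have /sigma_finiteP[F [FT ndF Ffin]] := sigma_finiteT (@lebesgue_measure R).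
have /sigma_finiteP[G [GT ndG Gfin]] := sigma_finiteT mu.
exists (fun k => (fun x : 'rV[R]_n.+1 => (x ord0 ord0, tailr x)) @^-1`
                 (F k `*` G k)).
  apply/seteqP; split => // x _.
  have [i _ Fi] : (\bigcup_i F i) (x ord0 ord0) by rewrite -FT.
  have [j _ Gj] : (\bigcup_i G i) (tailr x) by rewrite -GT.
  exists (maxn i j) => //; split => /=.
    by move: Fi; apply/subsetPset/ndF/leq_maxl.
  by move: Gj; apply/subsetPset/ndG/leq_maxr.
move=> k; have [mF Fk] := Ffin k; have [mG Gk] := Gfin k; split.
  rewrite -[X in measurable X]setTI; apply: measurable_headtail => //.
  exact: measurableX.
rewrite /leb_step /pushforward -comp_preimage /=.
rewrite [X in preimage X](_ : _ = id) ?preimage_id; last first.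
  by apply/funext => -[s y] /=; rewrite consr0 consrK.
by rewrite product_measure1E// lte_mul_pinfty// ge0_fin_numE.
Qed.

HB.instance Definition _ := Measure_isSigmaFinite.Build _ _ _ leb_step
  leb_step_sigma_finite.

Lemma integral_leb_step (f : 'rV[R]_n.+1 -> \bar R) :
  measurable_fun [set: 'rV[R]_n.+1] f -> (forall x, 0 <= f x) ->
  \int[leb_step]_x f x =
  \int[@lebesgue_measure R]_s \int[mu]_y f (consr s y).
Proof.
move=> mf f0; rewrite /leb_step ge0_integral_pushforward//; last first.
  exact: measurable_consr.
rewrite preimage_setT fubini_tonelli1//=.
by apply: measurableT_comp => //; exact: measurable_consr.
Qed.

End lebesgue_step.

Fixpoint leb {R : realType} (n : nat) :
    {sigma_finite_measure set 'rV[R]_n -> \bar R} :=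
  match n with
  | 0 => dirac (0 : 'rV[R]_0)
  | n'.+1 => leb_step (leb n')
  end.

Section leb.
Context {R : realType}.
Local Open Scope ereal_scope.

Lemma iter_int_leb n (f : 'rV[R]_n -> \bar R) :
  measurable_fun [set: 'rV[R]_n] f -> (forall x, 0 <= f x) ->
  iter_int f = \int[leb n]_x f x.
Proof.
elim: n f => [|n ih] f mf f0 /=.
  by rewrite integral_dirac// diracT mul1e.
rewrite integral_leb_step//; apply: eq_integral => s _.
rewrite ih//; exact: (measurableT_comp mf (measurable_consrr s)).
Qed.

Lemma integral_lebS n (f : 'rV[R]_n.+1 -> \bar R) :
  measurable_fun [set: 'rV[R]_n.+1] f -> (forall x, 0 <= f x) ->
  \int[leb n.+1]_x f x =
  \int[@lebesgue_measure R]_s \int[leb n]_y f (consr s y).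
Proof. exact: integral_leb_step. Qed.

Lemma measurable_affine_rV n (a : R) (v : 'rV[R]_n) :
  measurable_fun [set: 'rV[R]_n] (fun x => a *: x + v)%R.
Proof.
apply: measurable_fun_rVP => i; under eq_fun do rewrite rV_affineE.
apply: measurable_funD; last exact: measurable_cst.
apply: measurable_funM; first exact: measurable_cst.
exact: measurable_rV_coord.
Qed.

Lemma integral_leb_affine n (a : R) (v : 'rV[R]_n) (f : 'rV[R]_n -> \bar R) :
  (a != 0)%R -> measurable_fun [set: 'rV[R]_n] f -> (forall x, 0 <= f x) ->
  \int[leb n]_x f (a *: x + v)%R = (`|a| ^- n)%:E * \int[leb n]_x f x.
Proof.
move=> a0; elim: n v f => [|n ih] v f mf f0.
  rewrite /= !integral_dirac// ?diracT ?expr0 ?invr1 ?mul1e//.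
    by congr f; apply/rowP => -[].
  exact: (measurableT_comp mf (measurable_affine_rV _ _)).
rewrite !integral_lebS//; last first.
  exact: (measurableT_comp mf (measurable_affine_rV _ _)).
pose F s := \int[leb n]_y f (consr s y).
have mF : measurable_fun [set: R] F.
  apply: (measurable_fun_fubini_tonelli_F (fun p => f (consr p.1 p.2))) => //.
  exact: (measurableT_comp mf (@measurable_consr R n)).
transitivity (\int[@lebesgue_measure R]_s
    ((`|a| ^- n)%:E * F (a * s + v ord0 ord0)%R)).
  apply: eq_integral => s _; rewrite -[v]tailrK.
  under eq_integral do rewrite consr_affine.
  rewrite (ih _ (fun y => f (consr _ y))) ?consr0//.
  exact: (measurableT_comp mf (measurable_consrr _)).
rewrite ge0_integralZl_EFin; first last.
- by rewrite invr_ge0 exprn_ge0.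
- apply: (measurableT_comp mF).
  by apply: measurable_funD => //; exact: measurable_funM.
- by move=> s _; exact: integral_ge0.
- exact: measurableT.
rewrite integral_lebesgue_affine//; last by move=> s; exact: integral_ge0.
by rewrite muleA -EFinM exprSr invfM.
Qed.

End leb.

Section rV_norm.
Context {R : realType} (n : nat).
Implicit Types x y : 'rV[R]_n.

Lemma rV_normP x r : 0 <= r ->
  (`|x| <= r <-> forall i, `|x ord0 i| <= r).
Proof.
move=> r0; rewrite [ `|x|]/Num.norm /= mx_normrE; split=> [/bigmax_leP[_ h] i|h].
  exact: (h (ord0, i)).
by apply/bigmax_leP; split => // -[i j] _; rewrite ord1; exact: h.
Qed.

Lemma rV_coord_le_norm x i : `|x ord0 i| <= `|x|.
Proof. exact: (rV_normP x (normr_ge0 x)).1. Qed.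

Lemma rV_bounded (A : set 'rV[R]_n) : bounded_set A ->
  exists2 M, 0 < M & forall x, A x -> `|x| <= M.
Proof.
move=> [M [_ h]]; exists (`|M| + 1); first by rewrite ltr_wpDl.
by move=> x Ax; apply: h => //; rewrite (le_lt_trans (ler_norm _))// ltrDl.
Qed.

Lemma enorm_ge0 x : 0 <= enorm x.
Proof. exact: sqrtr_ge0. Qed.

Lemma sqr_enorm x : enorm x ^+ 2 = \sum_(i < n) x ord0 i ^+ 2.
Proof. by rewrite sqr_sqrtr// sumr_ge0// => i _; exact: sqr_ge0. Qed.

Lemma enormZ a x : enorm (a *: x) = `|a| * enorm x.
Proof.
rewrite /enorm -sqrtr_sqr -sqrtrM ?sqr_ge0// mulr_sumr.
by congr Num.sqrt; apply: eq_bigr => i _; rewrite mxE exprMn.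
Qed.

Lemma enorm0 : enorm (0 : 'rV[R]_n) = 0.
Proof. by rewrite -(scale0r 0) enormZ normr0 mul0r. Qed.

Lemma enormN x : enorm (- x) = enorm x.
Proof. by rewrite -scaleN1r enormZ normrN1 mul1r. Qed.

(** A substitute for the triangle inequality that avoids Cauchy-Schwarz: |x - y|^2 <= 2|x|^2 +
    2|y|^2 coordinatewise. *)
Lemma enormB_le x y r : enorm x <= r -> enorm y <= r -> enorm (x - y) <= r *+ 2.
Proof.
move=> xr yr; have r0 : 0 <= r := le_trans (enorm_ge0 x) xr.
rewrite -(@ler_pXn2r _ 2) ?nnegrE ?enorm_ge0 ?mulrn_wge0//.
have x2 : enorm x ^+ 2 <= r ^+ 2 by rewrite lerXn2r ?nnegrE ?enorm_ge0.
have y2 : enorm y ^+ 2 <= r ^+ 2 by rewrite lerXn2r ?nnegrE ?enorm_ge0.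
have /le_trans : enorm (x - y) ^+ 2 <= 2 * enorm x ^+ 2 + 2 * enorm y ^+ 2.
  rewrite !sqr_enorm !mulr_sumr -big_split/= ler_sum// => i _.
  rewrite !mxE; have := sqr_ge0 (x ord0 i + y ord0 i); rewrite !expr2; lra.
by apply; rewrite mulr2n [leRHS]expr2 in x2 y2 *; lra.
Qed.

Lemma enorm_le_norm x : enorm x <= Num.sqrt n%:R * `|x|.
Proof.
rewrite -[ `|x|]normr_id -sqrtr_sqr -sqrtrM ?ler0n// ler_sqrt; last first.
  by rewrite mulr_ge0 ?sqr_ge0// ler0n.
rewrite mulr_natl -[X in _ *+ X]card_ord -sumr_const ler_sum// => i _.
rewrite -(@ger0_norm _ (x ord0 i ^+ 2)) ?sqr_ge0// normrX.
by rewrite lerXn2r ?nnegrE// rV_coord_le_norm.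
Qed.

Lemma coord_le_enorm x i : `|x ord0 i| <= enorm x.
Proof.
rewrite -(@ler_pXn2r _ 2) ?nnegrE ?enorm_ge0// sqr_enorm real_normK ?num_real//.
rewrite (bigD1 i)//= lerDl sumr_ge0// => j _; exact: sqr_ge0.
Qed.

Lemma continuous_enorm : continuous (@enorm R n).
Proof.
move=> x; apply: continuous_comp; last exact: sqrt_continuous.
have c2 (i : 'I_n) : continuous (fun y : 'rV[R]_n => y ord0 i ^+ 2).
  move=> y; apply: (@continuous_comp _ _ _ (fun y : 'rV[R]_n => y ord0 i)
    (fun t : R => t ^+ 2)); first exact: coord_continuous.
  exact: exprn_continuous.
by apply: continuous_big => //; exact: add_continuous.
Qed.

End rV_norm.

(** The interval is a parameter because two cubes occur: half-open ones tile the space without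
    overlap, the closed one is compact. *)
Definition icube {R : realType} (I : interval R) n : set 'rV[R]_n :=
  [set x | forall i, x ord0 i \in I].
Arguments icube {R} I n _.

Notation ucube := (icube `[0%R, 1%R[).

Section leb_sets.
Context {R : realType}.
Local Open Scope ereal_scope.

Lemma leb_indic n (A : set 'rV[R]_n) : measurable A ->
  \int[leb n]_x (\1_A x)%:E = leb n A.
Proof. by move=> mA; rewrite integral_indic// setIT. Qed.

Lemma lebS_set n (A : set 'rV[R]_n.+1) :
  leb n.+1 A = \int[@lebesgue_measure R]_s leb n (consr s @^-1` A).
Proof.
apply: eq_integral => s _ /=; congr (leb n _).
by apply/seteqP; split => y; rewrite /xsection /= ?inE.
Qed.

Lemma leb_affine n (a : R) (v : 'rV[R]_n) (A : set 'rV[R]_n) :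
  (a != 0)%R -> measurable A ->
  leb n ((fun x => a *: x + v)%R @^-1` A) = (`|a| ^- n)%:E * leb n A.
Proof.
move=> a0 mA; rewrite -leb_indic; last first.
  rewrite -[X in measurable X]setTI.
  exact: (@measurable_affine_rV _ _ a v).
rewrite -(leb_indic mA) -(integral_leb_affine v a0)//.
by apply/measurable_EFinP; exact: measurable_indic.
Qed.

Lemma measurable_icube (I : interval R) n : measurable (icube I n).
Proof.
rewrite (_ : icube I n = \bigcap_(i in [set: 'I_n])
    (rV_coord i @^-1` ([set` I] : set (measurableTypeR R)))).
  apply: fin_bigcap_measurable => [|i _]; first exact: finite_finset.
  by rewrite -[X in measurable X]setTI; apply: measurable_rV_coord.
by apply/seteqP; split => [y h i _|y h i]; [exact: h|exact: (h i)].
Qed.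

Lemma leb_icube (I : interval R) n : @lebesgue_measure R [set` I] = 1 ->
  leb n (icube I n) = 1.
Proof.
move=> I1; elim: n => [|n ih].
  rewrite /= diracE (_ : (_ \in _) = true)//.
  by apply/mem_set => -[].
rewrite lebS_set (_ : (fun s => _) =
    (fun s => (\1_([set` I] : set R) s)%:E)); last first.
  apply/funext => s; rewrite indicE; have [s01|s01] := boolP (s \in _).
    rewrite -ih; congr (leb n _); apply/seteqP; split => y h i.
      by have := h (lift ord0 i); rewrite consrS.
    case: (unliftP ord0 i) => [j ->|->]; first by rewrite consrS.
    by rewrite consr0; move: s01; rewrite inE.
  rewrite (_ : _ @^-1` _ = set0) ?measure0//; apply/seteqP; split => // y h.
  by move: s01; have := h ord0; rewrite consr0 notin_setE /=.
by rewrite integral_indic// setIT.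
Qed.

Lemma leb_ucube n : leb n (ucube n : set 'rV[R]_n) = 1.
Proof.
apply: leb_icube.
by rewrite lebesgue_measure_itv/= lte_fin ltr01 oppr0 addr0.
Qed.

Lemma leb_cube n (h : R) (v : 'rV[R]_n) : (0 < h)%R ->
  measurable [set x : 'rV[R]_n | ucube n (h^-1 *: (x - v))%R] /\
  leb n [set x | ucube n (h^-1 *: (x - v))%R] = (h ^+ n)%:E.
Proof.
move=> h0; have E : [set x : 'rV[R]_n | ucube n (h^-1 *: (x - v))%R] =
    (fun x => h^-1 *: x + (- (h^-1 *: v)))%R @^-1` ucube n.
  by apply/seteqP; split => x; rewrite /= scalerBr.
have mU := @measurable_icube (`[0%R, 1%R[ : interval R) n.
rewrite E leb_affine// ?leb_ucube ?mule1 ?invr_eq0 ?gt_eqF//; split.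
  by rewrite -[X in measurable X]setTI; exact: measurable_affine_rV.
by rewrite gtr0_norm ?invr_gt0// exprVn invrK.
Qed.

Lemma leb_bounded n (A : set 'rV[R]_n) : bounded_set A -> measurable A ->
  leb n A < +oo.
Proof.
move=> /rV_bounded[M M0 AM] mA.
(* A cube of side 4M with corner at -2M; side 2M would miss points on the open upper faces. *)
have h0 : (0 < M *+ 4)%R by rewrite mulrn_wgt0.
have [mC lC] := leb_cube (const_mx (- (M *+ 2))%R : 'rV[R]_n) h0.
apply: (@le_lt_trans _ _ ((M *+ 4) ^+ n)%:E); last by rewrite ltry.
rewrite -lC le_measure ?inE// => x /AM /(rV_normP x (ltW M0)) h i.
rewrite !mxE in_itv/=; have := h i; rewrite ler_norml => /andP[h1 h2].
rewrite mulrC ler_pdivlMr// ltr_pdivrMr// mul0r mul1r.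
by apply/andP; split; rewrite !mulr2n ?mulrS ?mulr0n; lra.
Qed.

Lemma leb_bounded_fin n (A : set 'rV[R]_n) : bounded_set A -> measurable A ->
  leb n A \is a fin_num.
Proof. by move=> bA mA; rewrite ge0_fin_numE// leb_bounded. Qed.

End leb_sets.

(** * Brunn-Minkowski inequality *)

Section brunn_minkowski1.
Context {R : realType}.
Local Notation mu := (@lebesgue_measure R).
Implicit Types A B C : set R.
Local Open Scope ereal_scope.

(** Choose a in A near sup A and b in B near inf B. The midpoints of b with the points of A below a
    lie to the left of m = (a + b) / 2, those of a with the points of B above b to the right, so C
    contains two disjoint half-size copies. Only the slivers of A above a and of B below b are
    lost. *)
Lemma brunn_minkowski1 A B C : measurable A -> measurable B -> measurable C ->
  A !=set0 -> B !=set0 -> has_ubound A -> has_lbound B ->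
  (forall x y, A x -> B y -> C ((x + y) / 2)%R) ->
  mu A + mu B <= 2%:E * mu C.
Proof.
move=> mA mB mC A0 B0 ubA lbB ABC.
apply/lee_addgt0Pr => e e0.
have e20 : (0 < e / 2)%R by rewrite divr_gt0.
have [a Aa ae] : exists2 a, A a & (sup A - e / 2 < a)%R.
  by apply: sup_adherent.
have [b Bb be] : exists2 b, B b & (b < inf B + e / 2)%R.
  by apply: inf_adherent.
pose m := ((a + b) / 2)%R.
have mIic : measurable (`]-oo, m] : set R) by [].
have mIoi : measurable (`]m, +oo[ : set R) by [].
pose A' := A `&` `]-oo, a]%classic; pose B' := B `&` `]b, +oo[%classic.
have mA' : measurable A' by exact: measurableI.
have mB' : measurable B' by exact: measurableI.
have n2 : (2 != 0 :> R)%R by [].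
(* The preimage of [A'] under x |-> 2x - b consists of the midpoints of b and points of [A']; it has
   half the measure. *)
have CA : mu A' <= 2%:E * mu (C `&` `]-oo, m]).
  rewrite (lebesgue_measure_affine (- b)%R n2 mA') ger0_norm// lee_pmul2l//.
  rewrite /pushforward; apply: le_measure; rewrite ?inE.
  - by rewrite -[X in measurable X]setTI; exact: measurable_affine.
  - exact: measurableI.
  - move=> x [/= Ax xa]; split; last by move: xa; rewrite /= !in_itv/= /m; lra.
    by have := ABC _ _ Ax Bb; rewrite (_ : (_ / 2 = x)%R)//; field.
have CB : mu B' <= 2%:E * mu (C `&` `]m, +oo[).
  rewrite (lebesgue_measure_affine (- a)%R n2 mB') ger0_norm// lee_pmul2l//.
  rewrite /pushforward; apply: le_measure; rewrite ?inE.
  - by rewrite -[X in measurable X]setTI; exact: measurable_affine.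
  - exact: measurableI.
  - move=> x [/= Bx xa]; split.
      by have := ABC _ _ Aa Bx; rewrite (_ : (_ / 2 = x)%R)//; field.
    by move: xa; rewrite /= !in_itv/= !andbT /m; lra.
have AA' : mu A <= mu A' + (e / 2)%:E.
  apply: (@le_trans _ _ (mu (A' `|` `[a, sup A]%classic))).
    apply: le_measure; rewrite ?inE//; first exact: measurableU.
    move=> x Ax; have [xa|ax] := leP x a; first by left; split.
    by right; rewrite /= in_itv/= ltW//=; apply: ub_le_sup.
  apply: le_trans; first by apply: measureU2.
  rewrite leeD2l//=.
  rewrite lebesgue_measure_itv/= lte_fin; case: ifPn => _.
    by rewrite -EFinB lee_fin; lra.
  by rewrite lee_fin ltW.
have BB' : mu B <= mu B' + (e / 2)%:E.
  apply: (@le_trans _ _ (mu (B' `|` `[inf B, b]%classic))).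
    apply: le_measure; rewrite ?inE//; first exact: measurableU.
    move=> x Bx; have [xb|bx] := leP x b; last first.
      by left; split => //=; rewrite in_itv/= andbT.
    by right; rewrite /= in_itv/= xb andbT; apply: ge_inf.
  apply: le_trans; first by apply: measureU2.
  rewrite leeD2l//=.
  rewrite lebesgue_measure_itv/= lte_fin; case: ifPn => _.
    by rewrite -EFinB lee_fin; lra.
  by rewrite lee_fin ltW.
apply: le_trans (leeD AA' BB') _.
rewrite addeACA -EFinD -splitr leeD2r//.
apply: le_trans (leeD CA CB) _.
rewrite -ge0_muleDr// lee_pmul2l// -measureU//; last 3 first.
  exact: measurableI.
  exact: measurableI.
  apply/seteqP; split => // x /= [[_]]; rewrite !in_itv/= andbT => xm [_].
  by rewrite ltNge xm.
apply: le_measure; rewrite ?inE//; last by rewrite -setIUr; exact: subIsetl.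
by apply: measurableU; exact: measurableI.
Qed.

End brunn_minkowski1.

(** * Layer-cake formula and the one-dimensional Prekopa-Leindler inequality *)

Section layer_cake.
Context {R : realType}.
Local Notation mu := (@lebesgue_measure R).
Local Open Scope ereal_scope.

Definition layer (f : R -> \bar R) (l : R) : set R := [set s | l%:E < f s].

Lemma measurable_layer (f : R -> \bar R) l : measurable_fun [set: R] f ->
  measurable (layer f l).
Proof.
move=> mf; rewrite -[X in measurable X]setTI.
exact: emeasurable_fun_o_infty.
Qed.

(** Levels stop at 1: nothing is lost for f <= 1, and at levels below 1 a function with supremum 1
    has a nonempty layer, as [brunn_minkowski1] demands. A function exceeding 1 has only [lcake f]
    at most its integral, which is the direction needed for h. *)
Definition lcake (f : R -> \bar R) : \bar R :=
  \int[mu]_l ((\1_(`[0%R, 1%R[%classic : set R) l)%:E * mu (layer f l)).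

Let S (f : R -> \bar R) : set (measurableTypeR R * measurableTypeR R) :=
  [set p | (0 <= p.2 < 1)%R /\ p.2%:E < f p.1].

Lemma measurable_undergraph (f : R -> \bar R) : measurable_fun [set: R] f ->
  measurable (S f).
Proof.
move=> mf.
rewrite (_ : S f = (setT `*` `[0%R, 1%R[%classic) `&`
  [set p : measurableTypeR R * measurableTypeR R | p.2%:E < f p.1]).
  apply: measurableI; first exact: measurableX.
  rewrite -[X in measurable X]setTI; apply: emeasurable_fun_lt => //.
    by apply/measurable_EFinP; exact: measurable_snd.
  exact: (measurableT_comp mf measurable_fst).
by apply/seteqP; split => p /=; rewrite in_itv/= => -[]; [split|case].
Qed.

Lemma layer_ysection (f : R -> \bar R) l :
  (\1_(`[0%R, 1%R[%classic : set R) l)%:E * mu (layer f l) = mu (ysection (S f) l).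
Proof.
rewrite indicE; have [l01|l01] := boolP (l \in _).
  rewrite mul1e; congr (mu _); move: l01; rewrite inE/= in_itv/= => l01.
  by apply/seteqP; split => s; rewrite /ysection/= inE /S/= => //; case.
rewrite mul0e (_ : ysection _ _ = set0) ?measure0//.
apply/seteqP; split => s //; rewrite /ysection/= inE /S/= => -[h].
by move: l01; rewrite notin_setE/= in_itv/= h.
Qed.

Lemma measurable_lcake (f : R -> \bar R) : measurable_fun [set: R] f ->
  measurable_fun [set: R]
    (fun l => (\1_(`[0%R, 1%R[%classic : set R) l)%:E * mu (layer f l)).
Proof.
move=> mf; under eq_fun do rewrite layer_ysection.
exact: (measurable_fun_ysection _ (measurable_undergraph mf)).
Qed.

Let xE (f : R -> \bar R) s :
  xsection (S f) s = [set l | (0 <= l < 1)%R /\ l%:E < f s].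
Proof. by apply/seteqP; split => l; rewrite /xsection/= inE. Qed.

Lemma lcakeE (f : R -> \bar R) : measurable_fun [set: R] f ->
  lcake f = \int[mu]_s mu (xsection (S f) s).
Proof.
move=> mf; have mS := measurable_undergraph mf.
rewrite /lcake; under eq_integral do rewrite layer_ysection.
have := indic_fubini_tonelli mu mu mS.
have -> := indic_fubini_tonelli_FE mu mS.
have -> := indic_fubini_tonelli_GE mu mS.
by move=> /esym.
Qed.

Lemma lcake_le (f : R -> \bar R) : measurable_fun [set: R] f ->
  (forall s, 0 <= f s) -> lcake f <= \int[mu]_s f s.
Proof.
move=> mf f0; have mS := measurable_undergraph mf; rewrite lcakeE//.
apply: ge0_le_integral => //; first exact: (measurable_fun_xsection mu mS).
move=> s _; have := f0 s; case fsE : (f s) => [r| |] // r0; last by rewrite leey.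
apply: (@le_trans _ _ (mu (`[0%R, r]%classic : set R))).
  apply: le_measure; rewrite ?inE//; first exact: measurable_xsection.
  by move=> l; rewrite xE /= fsE lte_fin in_itv/= => -[/andP[-> _] /ltW].
rewrite lebesgue_measure_itv/= lte_fin; case: ifPn => _ //.
by rewrite oppr0 adde0.
Qed.

Lemma lcake_ge (f : R -> R) : measurable_fun [set: R] f ->
  (forall s, 0 <= f s <= 1)%R -> \int[mu]_s (f s)%:E <= lcake (EFin \o f).
Proof.
move=> mf f01; have mEf : measurable_fun [set: R] (EFin \o f).
  exact/measurable_EFinP.
have mS := measurable_undergraph mEf; rewrite lcakeE//.
apply: ge0_le_integral => //.
- by move=> s _; rewrite lee_fin; have /andP[] := f01 s.
- exact: (measurable_fun_xsection mu mS).
move=> s _; have /andP[f0 f1] := f01 s.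
apply: (@le_trans _ _ (mu (`[0%R, f s[%classic : set R))).
  rewrite lebesgue_measure_itv/= lte_fin; case: ifPn => fs.
    by rewrite oppr0 adde0.
  by rewrite lee_fin leNgt.
apply: le_measure; rewrite ?inE//; first exact: measurable_xsection.
move=> l; rewrite xE /= in_itv/= lte_fin => /andP[-> lf]; split => //.
exact: lt_le_trans lf f1.
Qed.

(** At each level l the midpoints of the layers of f and g lie in the layer of h; the
    one-dimensional Brunn-Minkowski inequality is integrated over l. Equal suprema make both layers
    nonempty at the same levels. *)
Lemma prekopa_leindler_normalized (f g : R -> R) (h : R -> \bar R) (M : R) :
  measurable_fun [set: R] f -> measurable_fun [set: R] g ->
  measurable_fun [set: R] h ->
  (forall s, 0 <= f s <= 1)%R -> (forall s, 0 <= g s <= 1)%R ->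
  (forall s, 0 <= h s) ->
  (forall s, M < `|s| -> f s = 0)%R -> (forall s, M < `|s| -> g s = 0)%R ->
  (forall l, l < 1 -> exists s, l < f s)%R ->
  (forall l, l < 1 -> exists s, l < g s)%R ->
  (forall s t l, (0 <= l)%R -> (l < f s)%R -> (l < g t)%R ->
    l%:E < h ((s + t) / 2)%R) ->
  \int[mu]_s (f s)%:E + \int[mu]_s (g s)%:E <= 2%:E * \int[mu]_s h s.
Proof.
move=> mf mg mh f01 g01 h0 fM gM f1 g1 fgh.
have mEf : measurable_fun [set: R] (EFin \o f) by exact/measurable_EFinP.
have mEg : measurable_fun [set: R] (EFin \o g) by exact/measurable_EFinP.
apply: le_trans (leeD (lcake_ge mf f01) (lcake_ge mg g01)) _.
apply: (@le_trans _ _ (2%:E * lcake h)); last by rewrite lee_pmul2l// lcake_le.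
have i0 k l : 0 <= (\1_(`[0%R, 1%R[%classic : set R) l)%:E * mu (layer k l).
  by rewrite mule_ge0// lee_fin.
rewrite -ge0_integralZl_EFin//; last exact: measurable_lcake.
rewrite -ge0_integralD//; [|exact: measurable_lcake..].
apply: ge0_le_integral => //.
- by move=> l _; rewrite adde_ge0.
- by apply: emeasurable_funD; exact: measurable_lcake.
- by apply: emeasurable_funM => //; exact: measurable_lcake.
move=> l _; rewrite indicE; have [l01|l01] := boolP (l \in _); last first.
  by rewrite !mul0e adde0 mule0.
rewrite !mul1e; move: l01; rewrite inE/= in_itv/= => /andP[l0 l1].
have bd (k : R -> R) : (forall s, M < `|s| -> k s = 0)%R ->
    forall s, layer (EFin \o k) l s -> (`|s| <= M)%R.
  move=> kM s /= ; rewrite /layer/= lte_fin => lk; rewrite leNgt; apply/negP => /kM k0.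
  by move: lk; rewrite k0 ltNge l0.
apply: brunn_minkowski1; try exact: measurable_layer.
- by have [s] := f1 _ l1; exists s; rewrite /layer/= lte_fin.
- by have [s] := g1 _ l1; exists s; rewrite /layer/= lte_fin.
- by exists M => s /(bd f fM); rewrite ler_norml => /andP[].
- by exists (- M)%R => s /(bd g gM); rewrite ler_norml => /andP[].
- by move=> s t; rewrite /layer/= !lte_fin; exact: fgh.
Qed.

End layer_cake.

Section prekopa_leindler.
Context {R : realType}.
Local Notation mu := (@lebesgue_measure R).
Local Open Scope ereal_scope.

(** Dividing F and G by their suprema a and b, and H by tau = sqrt(ab), leads to the normalized
    case. Its conclusion is additive; since pq <= ((p + q) / 2)^2, it implies the product form, in
    which the scales cancel. If a or b is 0, the left side is 0. *)
Lemma prekopa_leindler1 (F G : R -> R) (H : R -> \bar R) (M K : R) :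
  measurable_fun [set: R] F -> measurable_fun [set: R] G ->
  measurable_fun [set: R] H ->
  (forall s, 0 <= F s <= K)%R -> (forall s, 0 <= G s <= K)%R ->
  (forall s, 0 <= H s) ->
  (forall s, M < `|s| -> F s = 0)%R -> (forall s, M < `|s| -> G s = 0)%R ->
  (forall s t, (F s * G t)%:E <= H ((s + t) / 2)%R * H ((s + t) / 2)%R) ->
  \int[mu]_s (F s)%:E * \int[mu]_s (G s)%:E <=
  \int[mu]_s H s * \int[mu]_s H s.
Proof.
move=> mF mG mH F0 G0 H0 FM GM FGH.
have supP (f : R -> R) : (forall s, 0 <= f s <= K)%R ->
    [/\ has_sup (range f), forall s, (f s <= sup (range f))%R
      & (0 <= sup (range f))%R].
  move=> f0; have hs : has_sup (range f).
    split; first by exists (f 0%R), 0%R.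
    by exists K => _ [s _ <-]; have /andP[] := f0 s.
  have fs s : (f s <= sup (range f))%R.
    by apply: ub_le_sup; [case: hs|exists s].
  by split=> //; rewrite (le_trans _ (fs 0%R))//; have /andP[] := f0 0%R.
have [hF Fa a0] := supP _ F0; have [hG Gb b0] := supP _ G0.
set a := sup (range F) in hF Fa a0; set b := sup (range G) in hG Gb b0.
have int0 (f : R -> R) : (forall s, 0 <= f s <= K)%R -> sup (range f) = 0%R ->
    \int[mu]_s (f s)%:E = 0.
  move=> f0 s0; have [_ fle _] := supP _ f0; apply: integral0_eq => s _.
  by congr EFin; apply/eqP; rewrite eq_le -[X in (_ <= X)%R]s0 fle; have /andP[] := f0 s.
have [a_0|/eqP an0] := eqVneq a 0%R.
  by rewrite (int0 F)// mul0e mule_ge0 ?integral_ge0.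
have [b_0|/eqP bn0] := eqVneq b 0%R.
  by rewrite (int0 G)// mule0 mule_ge0 ?integral_ge0.
have {an0}a0 : (0 < a)%R by rewrite lt_neqAle a0 andbT; apply/eqP/nesym.
have {bn0}b0 : (0 < b)%R by rewrite lt_neqAle b0 andbT; apply/eqP/nesym.
pose tau := Num.sqrt (a * b).
have tau0 : (0 < tau)%R by rewrite sqrtr_gt0 mulr_gt0.
have tau2 : (tau * tau = a * b)%R by rewrite -expr2 sqr_sqrtr// mulr_ge0// ltW.
have norm01 (f : R -> R) c : (0 < c)%R -> (forall s, 0 <= f s <= K)%R ->
    (forall s, f s <= c)%R -> (forall s, 0 <= c^-1 * f s <= 1)%R.
  move=> c0 f0 fc s; have /andP[fs0 _] := f0 s.
  by rewrite mulr_ge0 ?invr_ge0 ?(ltW c0)//= mulrC ler_pdivrMr// mul1r.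
have adh (f : R -> R) : has_sup (range f) -> (0 < sup (range f))%R ->
    (forall l, l < 1 -> exists s, l < (sup (range f))^-1 * f s)%R.
  move=> hs s0 l l1; have e0 : (0 < sup (range f) * (1 - l))%R.
    by rewrite mulr_gt0// subr_gt0.
  have [_ [s _ <-] sl] := sup_adherent e0 hs; exists s.
  by rewrite mulrC ltr_pdivlMr//; move: sl; rewrite mulrBr mulr1 subKr mulrC.
have := @prekopa_leindler_normalized R (fun s => a^-1 * F s)%R
  (fun s => b^-1 * G s)%R (fun s => (tau^-1)%:E * H s) M.
have Z0 : 0 <= \int[mu]_s H s by exact: integral_ge0.
have mcf (c : R) (f : R -> R) : measurable_fun [set: R] f ->
    measurable_fun [set: R] (fun s => c * f s)%R.
  by move=> mf; exact: measurable_funM.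
have mcH : measurable_fun [set: R] (fun s => (tau^-1)%:E * H s).
  by apply: emeasurable_funM => //; exact: measurable_cst.
move=> /(_ (mcf _ _ mF) (mcf _ _ mG) mcH (norm01 _ _ a0 F0 Fa)).
move=> /(_ (norm01 _ _ b0 G0 Gb)).
have tH0 s : 0 <= (tau^-1)%:E * H s by rewrite mule_ge0// lee_fin invr_ge0 ltW.
move=> /(_ tH0).
have zero (f : R -> R) c : (forall s, M < `|s| -> f s = 0)%R ->
  (forall s, M < `|s| -> c * f s = 0)%R by move=> h s /h ->; rewrite mulr0.
move=> /(_ (zero _ _ FM) (zero _ _ GM) (adh _ hF a0) (adh _ hG b0)).
(* From l a < F(s) and l b < G(t) follows (l tau)^2 = (l a)(l b) < H((s + t) / 2)^2. *)
have main s t l : (0 <= l)%R -> (l < a^-1 * F s)%R -> (l < b^-1 * G t)%R ->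
    l%:E < (tau^-1)%:E * H ((s + t) / 2)%R.
  move=> l0; rewrite mulrC ltr_pdivlMr// => lF.
  rewrite mulrC ltr_pdivlMr// => lG; have := FGH s t; have := H0 ((s + t) / 2)%R.
  case: (H _) => [r| |]//; last by move=> _ _; rewrite gt0_muley ?ltry// lte_fin invr_gt0.
  rewrite -!EFinM !lee_fin lte_fin => r0 FGr.
  rewrite mulrC ltr_pdivlMr// -(@ltr_pXn2r _ 2) ?nnegrE ?mulr_ge0// ?(ltW tau0)//.
  rewrite exprMn !expr2 tau2; apply: lt_le_trans FGr.
  have : (l * a * (l * b) < F s * G t)%R by rewrite ltr_pM// mulr_ge0// ltW.
  by congr (_ < _)%R; ring.
move=> /(_ main){main}.
have X0 : 0 <= \int[mu]_s (F s)%:E.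
  by apply: integral_ge0 => s _; rewrite lee_fin; have /andP[] := F0 s.
have Y0 : 0 <= \int[mu]_s (G s)%:E.
  by apply: integral_ge0 => s _; rewrite lee_fin; have /andP[] := G0 s.
have intZ (f : R -> R) c : (0 < c)%R -> measurable_fun [set: R] f ->
    (forall s, 0 <= f s <= K)%R ->
    \int[mu]_s (c^-1 * f s)%:E = (c^-1)%:E * \int[mu]_s (f s)%:E.
  move=> c0 mf f0; under eq_integral do rewrite EFinM.
  rewrite ge0_integralZl_EFin//; first by move=> s _; rewrite lee_fin; have /andP[] := f0 s.
    exact/measurable_EFinP.
  by rewrite invr_ge0 ltW.
rewrite (intZ F)// (intZ G)// ge0_integralZl_EFin//; last by rewrite invr_ge0 ltW.
move: X0 Y0 Z0; move: (\int[mu]_s (F s)%:E) (\int[mu]_s (G s)%:E) (\int[mu]_s H s).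
move=> X Y Z; case: Z => [z| |] X0 Y0 Z0; last 2 first.
- by rewrite mulyy leey.
- by [].
case: X X0 => [x| |] //; last first.
  rewrite gt0_muley ?lte_fin ?invr_gt0// => _; rewrite addye ?leye_eq//.
  by rewrite gt_eqF// (lt_le_trans (ltNyr 0))// mule_ge0// lee_fin invr_ge0 ltW.
case: Y Y0 => [y| |] //; last first.
  by rewrite gt0_muley ?lte_fin ?invr_gt0.
rewrite !lee_fin => y0 x0 xyz.
have xa0 : (0 <= a^-1 * x)%R by rewrite mulr_ge0// invr_ge0 ltW.
have yb0 : (0 <= b^-1 * y)%R by rewrite mulr_ge0// invr_ge0 ltW.
have : ((a^-1 * x) * (b^-1 * y) <= (tau^-1 * z) * (tau^-1 * z))%R.
  move: xa0 yb0 xyz; move: (a^-1 * x)%R (b^-1 * y)%R (tau^-1 * z)%R => p q w p0 q0 pqw.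
  have := sqr_ge0 (p - q); rewrite expr2; nra.
rewrite mulrACA [leRHS]mulrACA -!invfM tau2 ler_pM2l//.
by rewrite invr_gt0 mulr_gt0.
Qed.

End prekopa_leindler.

Section brunn_minkowski.
Context {R : realType}.
Local Open Scope ereal_scope.

Lemma measurable_sectionr n (A : set 'rV[R]_n.+1) s : measurable A ->
  measurable (consr s @^-1` A).
Proof. by move=> mA; rewrite -[X in measurable X]setTI; exact: measurable_consrr. Qed.

Lemma measurable_leb_sectionr n (A : set 'rV[R]_n.+1) : measurable A ->
  measurable_fun [set: R] (fun s => leb n (consr s @^-1` A)).
Proof.
move=> mA; have mA' : measurable
    ((fun p : measurableTypeR R * 'rV[R]_n => consr p.1 p.2) @^-1` A).
  by rewrite -[X in measurable X]setTI; exact: measurable_consr.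
rewrite (_ : (fun s => _) = leb n \o xsection
    ((fun p : measurableTypeR R * 'rV[R]_n => consr p.1 p.2) @^-1` A)).
  exact: (measurable_fun_xsection _ mA').
apply/funext => s /=; congr (leb n _).
by apply/seteqP; split => y; rewrite /xsection/= ?inE.
Qed.

(** The multiplicative form does not involve the dimension, so it can be proved by induction: the
    section of C at (s + t) / 2 contains the midpoints of the sections of A at s and of B at t, and
    Prekopa-Leindler integrates the inequality between sections. *)
Lemma brunn_minkowski n (A B C : set 'rV[R]_n) :
  measurable A -> measurable B -> measurable C ->
  bounded_set A -> bounded_set B ->
  (forall x y, A x -> B y -> C (2^-1 *: (x + y))%R) ->
  leb n A * leb n B <= leb n C * leb n C.
Proof.
elim: n A B C => [|n ih] A B C mA mB mC bA bB ABC.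
  rewrite /= !diracE; have [|] := boolP (_ \in A); last by rewrite mul0e mule_ge0.
  rewrite inE => A0; have [|] := boolP (_ \in B); last by rewrite mule0 mule_ge0.
  rewrite inE => B0; have := ABC _ _ A0 B0; rewrite addr0 scaler0 => C0.
  by rewrite (mem_set C0).
have /rV_bounded[MA MA0 hA] := bA; have /rV_bounded[MB MB0 hB] := bB.
pose M := Num.max MA MB.
have M0 : (0 <= M)%R by rewrite le_max (ltW MA0).
(* Contains every section of A and of B; its finite measure is the common bound K of
   [prekopa_leindler1]. *)
pose D := [set y : 'rV[R]_n | `|y| <= M]%R.
have mD : measurable D.
  by apply: closed_measurable_rV; exact: closed_norm_le.
have bD : bounded_set D.
  by exists M; split; rewrite ?num_real// => r Mr y /= Dy; rewrite (le_trans Dy)// ltW.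
have sec (E : set 'rV[R]_n.+1) s : (forall x, E x -> `|x| <= M)%R ->
    (consr s @^-1` E `<=` D) /\ (M < `|s| -> consr s @^-1` E = set0)%R.
  move=> hE; split=> [y /hE/(rV_normP _ M0) h|Ms].
    apply/(rV_normP _ M0) => i; have := h (lift ord0 i).
    by rewrite consrS.
  apply/seteqP; split => // y /hE/(rV_normP _ M0) /(_ ord0).
  by rewrite consr0 leNgt Ms.
have hAM x : A x -> (`|x| <= M)%R by move=> /hA h; rewrite le_max h.
have hBM x : B x -> (`|x| <= M)%R by move=> /hB h; rewrite le_max h orbT.
have Dfin : leb n D \is a fin_num by exact: leb_bounded_fin.
have bsec (E : set 'rV[R]_n.+1) s : (forall x, E x -> `|x| <= M)%R ->
    bounded_set (consr s @^-1` E).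
  move=> hE; have [ED _] := sec E s hE; exists M; split; rewrite ?num_real// => r Mr y /ED Dy.
  by rewrite /= (le_trans Dy)// ltW.
have fsec (E : set 'rV[R]_n.+1) s : measurable E ->
    (forall x, E x -> `|x| <= M)%R ->
    leb n (consr s @^-1` E) \is a fin_num.
  move=> mE hE; apply: leb_bounded_fin; first exact: bsec.
  exact: measurable_sectionr.
have intE (E : set 'rV[R]_n.+1) : measurable E -> (forall x, E x -> `|x| <= M)%R ->
    leb n.+1 E = \int[@lebesgue_measure R]_s
      (fine (leb n (consr s @^-1` E)))%:E.
  move=> mE hE; rewrite lebS_set; apply: eq_integral => s _.
  by rewrite fineK// fsec.
have bnd (E : set 'rV[R]_n.+1) : measurable E -> (forall x, E x -> `|x| <= M)%R ->
    forall s, (0 <= fine (leb n (consr s @^-1` E)) <= fine (leb n D))%R.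
  move=> mE hE s; rewrite fine_ge0//= fine_le// ?fsec// le_measure ?inE//.
    exact: measurable_sectionr.
  by have [] := sec E s hE.
have mfine (E : set 'rV[R]_n.+1) : measurable E ->
    measurable_fun [set: R] (fun s => fine (leb n (consr s @^-1` E))).
  by move=> mE; apply: measurableT_comp => //; exact: measurable_leb_sectionr.
have zero (E : set 'rV[R]_n.+1) : (forall x, E x -> `|x| <= M)%R ->
    forall s, (M < `|s| -> fine (leb n (consr s @^-1` E)) = 0)%R.
  by move=> hE s /((sec E s hE).2) ->; rewrite measure0.
rewrite (intE A)// (intE B)// [in leRHS]lebS_set.
have C0 s : 0 <= leb n (consr s @^-1` C) by [].
apply: (prekopa_leindler1 (mfine _ mA) (mfine _ mB) (measurable_leb_sectionr mC)
  (bnd _ mA hAM) (bnd _ mB hBM) C0 (zero _ hAM) (zero _ hBM)) => // s t.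
rewrite EFinM !fineK ?fsec//; apply: ih.
- exact: measurable_sectionr.
- exact: measurable_sectionr.
- exact: measurable_sectionr.
- exact: bsec.
- exact: bsec.
- move=> x y /= Ax By; have := ABC _ _ Ax By.
  by rewrite consr_mean.
Qed.

End brunn_minkowski.

(** * Hausdorff and Lebesgue measures coincide on compact sets *)

Section isodiametric.
Context {R : realType}.
Local Open Scope ereal_scope.
Implicit Types (N : nat).

Definition oball N (r : R) : set 'rV[R]_N := [set x | (enorm x < r)%R].

Lemma open_oball N r : open (@oball N r).
Proof.
apply: (@open_comp _ _ (@enorm R N) [set s | (s < r)%R]).
  by move=> x _; exact: continuous_enorm.
exact: open_lt.
Qed.

Lemma measurable_oball N r : measurable (@oball N r).
Proof. by apply: open_measurable_rV; exact: open_oball. Qed.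

Lemma bounded_oball N r : bounded_set (@oball N r).
Proof.
exists `|r|%R; split; rewrite ?num_real// => M rM x xr /=.
apply/rV_normP; first by rewrite ltW// (le_lt_trans _ rM).
move=> i; rewrite (le_trans (coord_le_enorm x i))// ltW// (lt_trans xr)//.
by rewrite (le_lt_trans _ rM)// ler_norm.
Qed.

Lemma leb_oball N (r : R) : (0 < r)%R ->
  leb N (@oball N r) = leb N (@oball N 1) * (r ^+ N)%:E.
Proof.
move=> r0; rewrite (_ : oball r =
    (fun x => r^-1 *: x + 0)%R @^-1` (@oball N 1)); last first.
  apply/seteqP; split => x; rewrite /oball/= addr0 enormZ gtr0_norm ?invr_gt0//;
  by rewrite mulrC ltr_pdivrMr// mul1r.
rewrite leb_affine ?invr_eq0 ?gt_eqF//; last exact: measurable_oball.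
by rewrite gtr0_norm ?invr_gt0// exprVn invrK muleC.
Qed.

Lemma alpha_leb N : alpha R N = leb N (@oball N 1).
Proof.
have mB := @measurable_oball N 1.
rewrite /alpha iter_int_leb; first exact: leb_indic.
  by apply/measurable_EFinP; exact: measurable_indic.
by move=> x; rewrite lee_fin.
Qed.

Lemma alpha_fin N : alpha R N \is a fin_num.
Proof.
rewrite alpha_leb leb_bounded_fin//; first exact: bounded_oball.
exact: measurable_oball.
Qed.

Lemma leb_opp N (A : set 'rV[R]_N) : measurable A ->
  measurable (-%R @^-1` A) /\ leb N (-%R @^-1` A) = leb N A.
Proof.
move=> mA; rewrite (_ : -%R @^-1` A = (fun x => (-1) *: x + 0)%R @^-1` A).
  rewrite leb_affine ?oppr_eq0 ?oner_eq0// normrN1 expr1n invr1 mul1e; split => //.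
  by rewrite -[X in measurable X]setTI; exact: measurable_affine_rV.
by apply/seteqP; split => x /=; rewrite addr0 scaleN1r.
Qed.

(* Brunn-Minkowski for A and -A: their midpoint set lies in the ball of radius d/2. *)
Lemma isodiametric N (A : set 'rV[R]_N) (d : R) : measurable A ->
  bounded_set A -> (forall x y : 'rV[R]_N, A x -> A y -> (enorm (x - y) <= d)%R) -> (0 <= d)%R ->
  leb N A <= alpha R N * ((d / 2) ^+ N)%:E.
Proof.
move=> mA bA Ad d0.
have [mA' lA'] := leb_opp mA.
have Afin := leb_bounded_fin bA mA.
(* [oball] is open, so the midpoints are placed in the ball of radius d/2 + e, and e tends to 0
   afterwards. *)
have step e : (0 < e)%R -> leb N A <= alpha R N * ((d / 2 + e) ^+ N)%:E.
  move=> e0; have r0 : (0 < d / 2 + e)%R by rewrite ltr_wpDl// divr_ge0.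
  rewrite alpha_leb -leb_oball//.
  have : leb N A * leb N A <= leb N (oball (d / 2 + e)) * leb N (oball (d / 2 + e)).
    rewrite -{2}lA'; apply: brunn_minkowski => //; first exact: measurable_oball.
      have [M [Mr h]] := bA; exists M; split => // s /h k x /= /k /=.
      by rewrite normrN.
    move=> x y Ax Ay; rewrite /oball/= enormZ ger0_norm ?invr_ge0//.
    have := Ad _ _ Ax Ay; rewrite opprK; lra.
  have Bfin : leb N (oball (d / 2 + e)) \is a fin_num.
    by rewrite leb_bounded_fin//; [exact: bounded_oball|exact: measurable_oball].
  rewrite -(fineK Afin) -(fineK Bfin) -!EFinM !lee_fin.
  by rewrite -!expr2 ler_pXn2r// nnegrE fine_ge0.
rewrite -(fineK Afin) -(fineK (alpha_fin N)) -EFinM lee_fin.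
set a := fine (alpha R N).
have h1 : (d / 2 + e)%R @[e --> (0%R : R)] --> (d / 2 + 0)%R.
  by apply: cvgD; [exact: cvg_cst|exact: cvg_id].
have h2 : ((d / 2 + e) ^+ N)%R @[e --> (0%R : R)] --> ((d / 2 + 0) ^+ N)%R.
  exact: (cvg_comp _ _ h1 (@exprn_continuous _ N _)).
have h : (a * (d / 2 + e) ^+ N)%R @[e --> (0%R : R)^'+] --> (a * (d / 2) ^+ N)%R.
  apply: cvg_at_right_filter; rewrite -[X in (X ^+ N)%R]addr0.
  exact: (cvgM (cvg_cst a) h2).
 rewrite -(cvg_lim _ h)//; apply: limr_ge.
  by apply/cvg_ex; eexists; exact: h.
near=> e; rewrite -lee_fin EFinM !fineK ?alpha_fin//.
by apply: step; near: e; exact: nbhs_right_gt.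
Unshelve. all: by end_near. Qed.

Lemma closed_enormB N (y : 'rV[R]_N) d :
  closed [set x : 'rV[R]_N | (enorm (x - y) <= d)%R].
Proof.
apply: (@preimage_closed _ _ (fun x : 'rV[R]_N => enorm (x - y)) [set r : R | (r <= d)%R]).
  move=> x _; apply: (@continuous_comp _ _ _ (fun x : 'rV[R]_N => x - y)%R (@enorm R N)).
    exact: (cvgB (@cvg_id _ (nbhs x)) (cvg_cst y)).
  exact: continuous_enorm.
exact: closed_le.
Qed.

(** The premeasure at scale 1 already dominates. The sets of a cover are arbitrary, so they are
    first replaced by their closures, which are measurable and no larger in diameter. *)
Lemma leb_le_hausdorff N (K : set 'rV[R]_N) : compact K ->
  leb N K <= hausdorff_measure K.
Proof.
move=> cK; apply: (@le_trans _ _ (hausdorff_delta K 1)); last first.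
  by apply: ereal_sup_ubound; exists 1%R => //=; exact: ltr01.
apply: le_ereal_inf_tmp => _ [C [KC [HC ->]]].
have mK := compact_measurable_rV cK.
have mcl k : measurable (closure (C k)).
  by apply: closed_measurable_rV; exact: closed_closure.
apply: (@le_trans _ _ (\sum_(0 <= k <oo) leb N (closure (C k)))).
  apply: measure_sigma_subadditive => //; apply: subset_trans KC _.
  by apply: subset_bigcup => k _; exact: subset_closure.
apply: lee_nneseries => // k _; have [[x0 Cx0] diam1] := HC k.
have diam0 : 0 <= diamE (C k).
  apply: (@le_trans _ _ (Defs.edist x0 x0)%:E); first exact: enorm_ge0.
  by apply: ereal_sup_ubound; exists x0 => //; exists x0.
have dfin : diamE (C k) \is a fin_num.
  by rewrite ge0_fin_numE// (le_lt_trans diam1)// ltry.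
set d := fine (diamE (C k)).
have d0 : (0 <= d)%R by exact: fine_ge0.
have Cd x y : C k x -> C k y -> (enorm (x - y) <= d)%R.
  move=> Cx Cy; rewrite -lee_fin fineK//; apply: ereal_sup_ubound.
  by exists x => //; exists y.
(* One argument at a time: closed balls around points of [C k] contain the closure, then so do
   closed balls around points of the closure. *)
have cld x y : closure (C k) x -> closure (C k) y -> (enorm (x - y) <= d)%R.
  move=> clx cly; rewrite -enormN opprB.
  have sub z : C k z -> closure (C k) `<=` [set w | (enorm (w - z) <= d)%R].
    move=> Cz; have cl := @closed_enormB N z d.
    rewrite ((closure_id _).1 cl); apply: closureS => w Cw; exact: Cd.
  have : C k `<=` [set w | (enorm (w - x) <= d)%R].
    by move=> w Cw /=; rewrite -enormN opprB; exact: (sub w Cw x clx).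
  have cl := @closed_enormB N x d.
  by move=> /closureS; rewrite -((closure_id _).1 cl); apply.
apply: isodiametric => //.
exists (`|x0| + d)%R; split; rewrite ?num_real// => M hM x clx /=.
rewrite (le_trans _ (ltW hM))// -[x](subrK x0) addrC (le_trans (ler_normD _ _))//.
rewrite lerD2l; apply/rV_normP => // i; apply: le_trans (coord_le_enorm _ _) _.
by apply: cld => //; exact: subset_closure.
Qed.

End isodiametric.

Section compact_nbhd.
Context {R : realType} (N : nat).
Implicit Types (K : set 'rV[R]_N).

Definition thicken K (r : R) : set 'rV[R]_N := \bigcup_(x in K) ball x r.

Lemma open_thicken K r : open (thicken K r).
Proof. by apply: bigcup_open => x _; exact: ball_open. Qed.

Lemma bounded_thicken K r : bounded_set K -> bounded_set (thicken K r).
Proof.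
move=> /rV_bounded[M M0 KM]; exists (M + `|r|); split; rewrite ?num_real// => s sM.
move=> y [x Kx]; rewrite mx_norm_ball /ball_ /= => xy.
rewrite (le_trans _ (ltW sM))// -[y](subKr x) (le_trans (ler_normB _ _))//.
by rewrite lerD ?KM// ltW// (lt_le_trans xy)// ler_norm.
Qed.

(** Continuity from above: the thickenings of radius 1/(n+1) have finite measure and decrease to K,
    which is closed. *)
Lemma leb_thicken_le K (e : R) : compact K -> 0 < e ->
  exists2 r, 0 < r & (leb N (thicken K r) <= leb N K + e%:E)%E.
Proof.
move=> cK e0; have bK : bounded_set K by exact: compact_bounded.
have mK := compact_measurable_rV cK.
have mT r : measurable (thicken K r).
  by apply: open_measurable_rV; exact: open_thicken.
pose F n := thicken K n.+1%:R^-1.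
have FK : \bigcap_n F n = K.
  apply/seteqP; split => [x Fx|x Kx n _]; last first.
    by exists x => //; apply: ballxx; rewrite invr_gt0.
  have hT : hausdorff_space 'rV[R]_N by exact: norm_hausdorff.
  rewrite ((closure_id _).1 (compact_closed hT cK)) => B /nbhs_ballP[d /= d0 dB].
  have [n _ /(_ n (leqnn _)) nd] := near_infty_natSinv_lt (PosNum d0).
  have [y Ky xy] := Fx n I; exists y; split => //; apply: dB.
  by apply: ball_sym; apply: le_ball xy; exact: ltW.
have FS : nonincreasing_seq F.
  move=> m n mn; apply/subsetPset => x [y Ky xy]; exists y => //.
  by apply: le_ball xy; rewrite lef_pV2 ?posrE// ler_nat ltnS.
have : leb N \o F @ \oo --> leb N (\bigcap_n F n).
  have F0 : (leb N (F 0%N) < +oo)%E.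
    exact: leb_bounded (bounded_thicken _ bK) (mT _).
  apply: nonincreasing_cvg_mu F0 _ _ FS => //; last by rewrite FK.
  by move=> n; exact: mT.
rewrite FK => cv; have Kfin : leb N K \is a fin_num by exact: leb_bounded_fin.
have : (leb N K < leb N K + e%:E)%E by rewrite lteDl// lte_fin.
move=> Klt; have : nbhs (leb N K) [set y | (y < leb N K + e%:E)%E].
  by apply: open_nbhs_nbhs; split => //; exact: open_ereal_lt_ereal.
move=> /cv [n _ /(_ n (leqnn _)) /= Fn].
by exists n.+1%:R^-1; [rewrite invr_gt0|exact: ltW].
Qed.

End compact_nbhd.

(** * Finite covers and their Hausdorff cost *)

Section covering_cost.
Context {R : realType} (N : nat).
Implicit Types (A B K : set 'rV[R]_N) (d c r h : R).
Let a : R := fine (alpha R N).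

(* [covcost d A c]: A has a finite cover by sets of diameter at most d and Hausdorff
   cost at most c; here a = alpha N. *)
Inductive covcost d : set 'rV[R]_N -> R -> Prop :=
| covcost0 : covcost d set0 0
| covcost_cons A B c r : covcost d A c -> 0 <= r <= d ->
    (forall x y, B x -> B y -> enorm (x - y) <= r) ->
    covcost d (A `|` B) (c + a * (r / 2) ^+ N)
| covcostS A B c c' : A `<=` B -> c <= c' -> covcost d B c -> covcost d A c'.

Lemma a_ge0 : 0 <= a.
Proof. by rewrite fine_ge0// alpha_leb. Qed.

Lemma covcost_ge0 d A c : covcost d A c -> 0 <= c.
Proof.
elim=> //; last by move=> ? ? ? ? _ + _ => /[swap]; exact: le_trans.
move=> _ _ {}c r _ c0 /andP[r0 _] _.
by rewrite addr_ge0// mulr_ge0 ?a_ge0// exprn_ge0// divr_ge0.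
Qed.

Lemma covcostU d A B c c' : covcost d A c -> covcost d B c' ->
  covcost d (A `|` B) (c + c').
Proof.
move=> Ac; elim=> [|{}B C {}c' r _ ih rd hC|{}B C c1 c2 BC c12 _ ih].
- by apply: covcostS Ac; [rewrite setU0|rewrite addr0].
- by rewrite setUA addrA; exact: covcost_cons.
- by apply: covcostS ih; [exact: setUS|rewrite lerD2l].
Qed.

Lemma covcost_bigcup d (I : eqType) (s : seq I) (F : I -> set 'rV[R]_N) c :
  (forall i, covcost d (F i) c) ->
  covcost d [set x | exists2 i, i \in s & F i x] (c *+ size s).
Proof.
move=> Fc; elim: s => [|i s ih]; first by apply: covcostS (covcost0 _) => // x [].
apply: covcostS (covcostU (Fc i) ih); last by rewrite /= mulrS.
by move=> x [j]; rewrite inE => /predU1P[->|js]; [left|right; exists j].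
Qed.

Lemma covcost_scale d A c h (v : 'rV[R]_N) : 0 < h -> covcost d A c ->
  covcost (h * d) [set x | A (h^-1 *: (x - v))] (h ^+ N * c).
Proof.
move=> h0; elim=> [|{}A B {}c r _ ih /andP[r0 rd] hB|{}A B c1 c2 AB c12 _ ih].
- by rewrite mulr0; apply: covcostS (covcost0 _).
- rewrite mulrDr (_ : _ * (_ * _) = a * ((h * r) / 2) ^+ N); last first.
    by rewrite mulrCA -exprMn mulrA.
  apply: covcost_cons => //; first by rewrite mulr_ge0 ?(ltW h0)//= ler_pM2l.
  move=> x y /hB /[apply]; rewrite -scalerBr opprB addrA subrK enormZ.
  by rewrite gtr0_norm ?invr_gt0// mulrC ler_pdivrMr// mulrC.
- apply: covcostS ih; first by move=> x; exact: AB.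
  by rewrite ler_pM2l// exprn_gt0.
Qed.

Lemma covcost_mono d d' A c : d <= d' -> covcost d A c -> covcost d' A c.
Proof.
move=> dd; elim=> [|{}A B {}c r _ ih /andP[r0 rd] hB|{}A B c1 c2 AB c12 _ ih].
- exact: covcost0.
- by apply: covcost_cons => //; rewrite r0 (le_trans rd).
- exact: covcostS ih.
Qed.

Lemma diamE_ge0 B : B !=set0 -> (0 <= diamE B)%E.
Proof.
move=> [x0 Bx0]; apply: (@le_trans _ _ (Defs.edist x0 x0)%:E).
  exact: enorm_ge0.
by apply: ereal_sup_ubound; exists x0 => //; exists x0.
Qed.

Lemma diamE_fin B r : B !=set0 -> (forall x y, B x -> B y -> enorm (x - y) <= r) ->
  diamE B \is a fin_num /\ 0 <= fine (diamE B) <= r.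
Proof.
move=> B0 hB; have ge0 := diamE_ge0 B0.
have ler : (diamE B <= r%:E)%E.
  by apply: ge_ereal_sup => _ [x Bx [y By <-]]; exact: hB.
have fin : diamE B \is a fin_num by rewrite ge0_fin_numE// (le_lt_trans ler)// ltry.
by split => //; rewrite fine_ge0//= -lee_fin fineK.
Qed.

(** The Hausdorff premeasure asks for a sequence of nonempty sets. A finite cover is padded with the
    singleton {0}, whose cost alpha(N) 0^N vanishes because N > 0. *)
Lemma hausdorff_delta_le d A c : (0 < N)%N -> 0 <= d -> covcost d A c ->
  (hausdorff_delta A d <= c%:E)%E.
Proof.
move=> N0 d0 Ac.
suff [C AC [hC Cc]] : exists2 C : nat -> set 'rV[R]_N, A `<=` \bigcup_k C k &
    (forall k, C k !=set0 /\ (diamE (C k) <= d%:E)%E) /\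
    (\sum_(0 <= k <oo) (alpha R N * ((fine (diamE (C k)) / 2) ^+ N)%:E) <= c%:E)%E.
  by apply: le_trans Cc; apply: ereal_inf_lbound; exists C.
have al0 : (0 <= alpha R N)%E by rewrite alpha_leb.
have cost0 B : B !=set0 -> (0 <= alpha R N * ((fine (diamE B) / 2) ^+ N)%:E)%E.
  move=> /diamE_ge0 B0.
  by rewrite mule_ge0// lee_fin exprn_ge0// divr_ge0// fine_ge0.
elim: Ac => [|{}A B {}c r Ac [C AC [hC Cc]] /andP[r0 rd] hB
           |{}A B c1 c2 AB c12 Bc1 [C BC [hC Cc]]].
- have h0 x y : [set (0 : 'rV[R]_N)] x -> [set (0 : 'rV[R]_N)] y -> enorm (x - y) <= 0.
    by move=> -> ->; rewrite subrr enorm0.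
  have [dfin /andP[dg dl]] := diamE_fin (ex_intro _ 0 erefl) h0.
  exists (fun=> [set 0]); first by move=> x.
  have E : fine (diamE [set (0 : 'rV[R]_N)]) = 0 by apply/eqP; rewrite eq_le dl.
  split=> [k|]; first by split; [by exists 0|rewrite -(fineK dfin) E lee_fin].
  rewrite E mul0r expr0n gtn_eqF// mule0 eseries0//.
(* An empty piece may not enter the sequence; it is dropped, and its nominal cost is nonnegative. *)
- have [B0|/set0P B0] := eqVneq B set0.
    exists C; first by rewrite B0 setU0.
    split => //; rewrite (le_trans Cc)// lee_fin lerDl.
    by rewrite mulr_ge0 ?a_ge0// exprn_ge0// divr_ge0.
  exists (fun k => if k is k'.+1 then C k' else B).
    move=> x [/AC[k _ Ckx]|Bx]; first by exists k.+1.
    by exists 0%N.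
  have [dfin /andP[dg dl]] := diamE_fin B0 hB.
  split=> [[|k]|]; [|exact: hC|].
    by split => //; rewrite -(fineK dfin) lee_fin (le_trans dl).
  rewrite nneseries_recl//; last first.
    by case=> [|k] _; apply: cost0 => //; have [] := hC k.
  rewrite -nneseries_addn//; last first.
    by case=> [|k]; apply: cost0 => //; have [] := hC k.
  under eq_eseriesr do rewrite addn1.
  rewrite addeC EFinD leeD// -(fineK (@alpha_fin R N)) -EFinM lee_fin.
  rewrite ler_wpM2l ?a_ge0// lerXn2r ?nnegrE ?divr_ge0// ler_pM2r//.
- exists C; first exact: subset_trans BC.
  by split => //; rewrite (le_trans Cc)// lee_fin.
Qed.

End covering_cost.

(** * Economical covers of a compact set by grid cubes *)

Section cube_grid.
Context {R : realType} (N : nat).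
Implicit Types (K : set 'rV[R]_N) (h : R).

(** The shift by m/2 centres the grid: its cubes of side h tile [-hm/2, hm/2)^N. *)
Definition grid_corner m h (k : {ffun 'I_N -> 'I_m}) : 'rV[R]_N :=
  \row_i (h * ((k i)%:R - m%:R / 2)).
Definition grid_cube m h (k : {ffun 'I_N -> 'I_m}) : set 'rV[R]_N :=
  [set x | ucube N (h^-1 *: (x - grid_corner h k))].

Lemma grid_cubeP m h (k : {ffun 'I_N -> 'I_m}) x : 0 < h ->
  grid_cube h k x <->
  forall i, (k i)%:R <= x ord0 i / h + m%:R / 2 < (k i).+1%:R.
Proof.
move=> h0; rewrite /grid_cube /=.
have E i : (h^-1 *: (x - grid_corner h k)) ord0 i =
    x ord0 i / h + m%:R / 2 - (k i)%:R.
  by rewrite !mxE; field; rewrite gt_eqF.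
split=> H i; have := H i.
  by rewrite in_itv/= E subr_ge0 ltrBlDr [1 + _]addrC natr1.
by rewrite in_itv/= E subr_ge0 ltrBlDr [1 + _]addrC natr1.
Qed.

Lemma trivIset_grid_cube m h : 0 < h ->
  trivIset [set: {ffun 'I_N -> 'I_m}] (grid_cube h).
Proof.
move=> h0 k l _ _ [x [/(grid_cubeP _ _ h0) kx /(grid_cubeP _ _ h0) lx]].
apply/ffunP => i; apply: val_inj; apply/eqP.
have /andP[k1 k2] := kx i; have /andP[l1 l2] := lx i.
have kl : (k i < (l i).+1)%N by rewrite -(ltr_nat R) (le_lt_trans k1 l2).
have lk : (l i < (k i).+1)%N by rewrite -(ltr_nat R) (le_lt_trans l1 k2).
by rewrite eqn_leq -ltnS kl -ltnS lk.
Qed.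

(** Keep the cubes that meet K. Their side t is at most the radius r of a thickening of measure at
    most |K| + e, so they all lie in it; being disjoint, they have total measure at most |K| + e. *)
Lemma cover_grid K h (e : R) : compact K -> 0 < h -> 0 < e ->
  exists t m, [/\ 0 < t, t <= h & exists s : seq {ffun 'I_N -> 'I_m},
     K `<=` [set x | exists2 k, k \in s & grid_cube t k x] /\
     ((t ^+ N *+ size s)%R%:E <= leb N K + e%:E)%E].
Proof.
move=> cK h0 e0; have [r r0 Kr] := leb_thicken_le cK e0.
have [M M0 KM] := rV_bounded (compact_bounded cK).
pose t := Num.min h r.
have t0 : 0 < t by rewrite lt_min h0.
(* Large enough that mt/2 > M, so that the grid contains K. *)
pose m := (Num.truncn (M / t * 2)).+3.
exists t, m; split => //; first by rewrite ge_min lexx.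
pose s := [seq k <- enum {: {ffun 'I_N -> 'I_m}} | `[< exists2 x, K x & grid_cube t k x >]].
exists s; split.
  move=> x Kx.
  have bd i : 0 <= x ord0 i / t + m%:R / 2 < m%:R.
    have := rV_coord_le_norm x i; move: (KM _ Kx) => /[swap] /le_trans /[apply].
    rewrite ler_norml => /andP[x1 x2].
    have x1' : - (M / t) <= x ord0 i / t by rewrite -mulNr ler_pM2r ?invr_gt0.
    have x2' : x ord0 i / t <= M / t by rewrite ler_pM2r ?invr_gt0.
    have : M / t * 2 < m%:R.
      apply: (@lt_le_trans _ _ (Num.truncn (M / t * 2)).+1%:R).
        have : 0 <= M / t * 2 by rewrite mulr_ge0// divr_ge0// ltW.
        by move=> /truncn_itv/andP[].
      by rewrite ler_nat; apply: leqW; exact: leqnSn.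
    lra.
  have kP i : (Num.truncn (x ord0 i / t + m%:R / 2) < m)%N.
    have /andP[b1 b2] := bd i.
    by rewrite -(ltr_nat R) (le_lt_trans _ b2)// truncn_le.
  pose k : {ffun 'I_N -> 'I_m} := [ffun i => Ordinal (kP i)].
  have kx : grid_cube t k x.
    apply/(grid_cubeP _ _ t0) => i; rewrite ffunE /=.
    by apply: truncn_itv; have /andP[] := bd i.
  exists k => //; rewrite mem_filter mem_enum andbT; apply/asboolP.
  by exists x.
apply: le_trans Kr.
have us : uniq s by rewrite filter_uniq// enum_uniq.
have mc (k : {ffun 'I_N -> 'I_m}) : 
    measurable (grid_cube t k) /\ leb N (grid_cube t k) = (t ^+ N)%:E.
  by have := leb_cube (grid_corner t k) t0.
have -> : (t ^+ N *+ size s)%:E = leb N (\bigcup_(k in [set` s]) grid_cube t k).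
  rewrite measure_fin_bigcup//.
  - rewrite -fsbig_seq// (eq_bigr (fun=> (t ^+ N)%:E)) => [|k _]; last exact: (mc k).2.
    by rewrite sumEFin big_const_seq count_predT iter_addr addr0.
  - by apply: sub_trivIset (trivIset_grid_cube t0).
  - by move=> k _; exact: (mc k).1.
apply: le_measure; rewrite ?inE.
- by apply: fin_bigcup_measurable => // k _; exact: (mc k).1.
- by apply: open_measurable_rV; exact: open_thicken.
move=> y [k /=]; rewrite mem_filter => /andP[/asboolP[x Kx kx] _] ky.
exists x => //; apply/(ball_rVP _ _ r0) => i.
move: kx ky => /(grid_cubeP _ _ t0)/(_ i)/andP[x1 x2] /(grid_cubeP _ _ t0)/(_ i)/andP[y1 y2].
apply: (@lt_le_trans _ _ t); last by rewrite ge_min lexx orbT.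
rewrite -[ltRHS]mul1r -ltr_pdivrMr// -[X in _ / X](gtr0_norm t0) -normf_div mulrBl.
have kE : (k i).+1%:R = (k i)%:R + 1 :> R by rewrite natr1.
by rewrite kE in x2 y2; rewrite ltr_norml; apply/andP; split; lra.
Qed.

End cube_grid.

Section hausdorff_le_leb.
Context {R : realType} (N : nat).
Hypothesis N0 : (0 < N)%N.
Implicit Types (K : set 'rV[R]_N) (c d e : R).
Local Notation Q := (icube `[0%R : R, 1%R] N).
Let a : R := fine (alpha R N).
(** The Euclidean diameter of the unit cube. *)
Let D : R := Num.sqrt N%:R.

Let D1 : 1 <= D.
Proof. by rewrite -[leLHS]sqrtr1 ler_sqrt ?ltr0n// ler1n. Qed.

(** Copying a cover of the unit cube into every cube of a fine grid covers K at the rate c per unit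
    of measure. Grid side at most d / D brings the diameters from D down to d. *)
Lemma covcost_compact d c K e : covcost D Q c -> compact K -> 0 < d -> 0 < e ->
  covcost d K (c * (fine (leb N K) + e)).
Proof.
move=> Qc cK d0 e0; have D0 : 0 < D := lt_le_trans ltr01 D1.
have c0 := covcost_ge0 Qc.
have [t [m [t0 td [s [Ks hs]]]]] := cover_grid cK (divr_gt0 d0 D0) e0.
have Kfin : leb N K \is a fin_num.
  exact: leb_bounded_fin (compact_bounded cK) (compact_measurable_rV cK).
have cube k : covcost d (@grid_cube R N m t k) (t ^+ N * c).
  have tD : t * D <= d by rewrite -ler_pdivlMr.
  apply: covcost_mono tD _; apply: covcostS (covcost_scale (grid_corner t k) t0 Qc) => //.
  move=> x kx i; have := kx i; rewrite !in_itv/= => /andP[-> /ltW ->].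
  by [].
apply: covcostS (covcost_bigcup s cube) => //.
rewrite -mulrnAl mulrC ler_wpM2l// -lee_fin EFinD fineK//.
Qed.

Lemma unit_cube_compact : compact Q.
Proof.
apply: (@rV_compact R N (fun=> `[0%R, 1%R]%classic)) => _.
exact: segment_compact.
Qed.

Lemma leb_unit_cube : leb N Q = 1%E.
Proof.
apply: leb_icube.
by rewrite lebesgue_measure_itv/= lte_fin ltr01 oppr0 adde0.
Qed.

Let ctr : 'rV[R]_N := const_mx 2^-1.
Let B : set 'rV[R]_N := [set x | enorm (x - ctr) < 2^-1].

Lemma open_inball : open B.
Proof.
rewrite (_ : B = (fun x => x - ctr) @^-1` (@oball R N 2^-1))//.
apply: open_comp; last exact: open_oball.
move=> x _; exact: (cvgB (@cvg_id _ (nbhs x)) (cvg_cst ctr)).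
Qed.

Lemma leb_inball : leb N B = (a * (1 / 2) ^+ N)%:E.
Proof.
rewrite (_ : B = (fun x => 1 *: x + (- ctr)) @^-1` (@oball R N 2^-1)); last first.
  by apply/seteqP; split => x; rewrite /= scale1r.
rewrite leb_affine ?oner_eq0//; last exact: measurable_oball.
rewrite normr1 expr1n invr1 mul1e leb_oball ?invr_gt0//.
by rewrite -alpha_leb -(fineK (@alpha_fin R N)) -EFinM div1r.
Qed.

Lemma inball_sub : B `<=` Q.
Proof.
move=> x Bx i; have := le_lt_trans (coord_le_enorm (x - ctr) i) Bx.
rewrite !mxE ltr_norml in_itv/= => /andP[h1 h2].
by apply/andP; split; lra.
Qed.

Lemma leb_cube_inball : leb N (Q `\` B) = (1 - a * (1 / 2) ^+ N)%:E.
Proof.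
have mQ := compact_measurable_rV unit_cube_compact.
have mB := open_measurable_rV open_inball.
rewrite measureD//=; last by rewrite leb_unit_cube ltry.
by rewrite (setIidr inball_sub) leb_unit_cube leb_inball.
Qed.

(* The inscribed ball B costs exactly its measure; what it leaves uncovered is paid at
   rate c by small copies of the cover of Q. *)
Lemma covcost_cube_step c e : covcost D Q c -> 0 < e ->
  covcost D Q (c * (1 - a * (1 / 2) ^+ N + e) + a * (1 / 2) ^+ N).
Proof.
move=> Qc e0.
have cQB : compact (Q `\` B).
  apply: subclosed_compact unit_cube_compact _ => //.
  rewrite setDE; apply: closedI; last exact: open_closedC open_inball.
  have hT : hausdorff_space 'rV[R]_N by exact: norm_hausdorff.
  exact: compact_closed hT unit_cube_compact.
have := covcost_compact Qc cQB (lt_le_trans ltr01 D1) e0.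
rewrite leb_cube_inball /= => QBc.
apply: (covcostS _ (lexx _) (covcost_cons (B := B) QBc (_ : 0 <= 1 <= D) _)).
- by move=> x Qx; have [Bx|nBx] := pselect (B x); [right|left].
- by rewrite ler01 D1.
- move=> x y Bx By; rewrite -[x](subrK ctr) -[y](subrK ctr).
  rewrite opprD addrACA subrr addr0.
  by apply: le_trans (enormB_le (ltW Bx) (ltW By)) _; rewrite mulr2n; lra.
Qed.

(** A cube of side 1 / (sqrt N + 1) with corner at 0 fits into the open unit ball. *)
Lemma alpha_gt0 : 0 < a.
Proof.
have h0 : 0 < (D + 1)^-1 by rewrite invr_gt0 ltr_wpDl// sqrtr_ge0.
have [mC lC] := leb_cube (0 : 'rV[R]_N) h0.
rewrite -lte_fin fineK ?alpha_fin// alpha_leb.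
apply: (@lt_le_trans _ _ ((D + 1)^-1 ^+ N)%:E); first by rewrite lte_fin exprn_gt0.
rewrite -lC; apply: le_measure; rewrite ?inE//; first exact: measurable_oball.
move=> x Cx; apply: (le_lt_trans (enorm_le_norm x)).
have xh : `|x| <= (D + 1)^-1.
  apply/rV_normP => [|i]; first exact: ltW.
  have := Cx i; rewrite subr0 mxE in_itv/= mulrC.
  rewrite ler_pdivlMr ?ltr_pdivrMr// mul0r mul1r => /andP[x0 x1].
  by rewrite ger0_norm// ltW.
apply: (@le_lt_trans _ _ (D * (D + 1)^-1)); first by rewrite ler_wpM2l// sqrtr_ge0.
by rewrite ltr_pdivrMr ?mul1r ?ltrDl// ltr_wpDl// sqrtr_ge0.
Qed.

(* The infimum q of the costs of Q satisfies q <= b + q (1 - b), hence q <= 1, where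
   b > 0 is the measure of the inscribed ball. *)
Lemma covcost_cube c : 1 < c -> covcost D Q c.
Proof.
move=> c1; pose b := a * (1 / 2) ^+ N.
have b0 : 0 < b by rewrite mulr_gt0 ?alpha_gt0// exprn_gt0// divr_gt0.
have b1 : b <= 1.
  by rewrite -subr_ge0 -lee_fin -leb_cube_inball.
pose S := [set c | covcost D Q c].
have S0 : S !=set0.
  exists (0 + a * (D / 2) ^+ N); rewrite /S/=.
  apply: (covcostS _ (lexx _) (covcost_cons (B := Q) (covcost0 _ _) (_ : 0 <= D <= D) _)).
  - by move=> x; right.
  - by rewrite lexx sqrtr_ge0.
  - move=> x y Qx Qy; apply: le_trans (enorm_le_norm _) _.
    rewrite -[leRHS]mulr1 ler_wpM2l ?sqrtr_ge0//.
    apply/rV_normP => // i; have := Qx i; have := Qy i.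
    by rewrite !mxE !in_itv/= ler_norml => /andP[? ?] /andP[? ?]; apply/andP; split; lra.
have lS : has_lbound S by exists 0 => s /covcost_ge0.
have q1 : inf S <= 1.
  rewrite leNgt; apply/negP => q1; set q := inf S in q1.
  (* Chosen to make (q + e)(1 - b + e) + b < q, against the infimum: the left side is q - b(q - 1) +
     e(q + 1 - b + e), and e < 1 puts the last term below e(q + 3) = b(q - 1). *)
  pose e := b * (q - 1) / (q + 3).
  have q3 : 0 < q + 3 by lra.
  have e0 : 0 < e by rewrite divr_gt0// mulr_gt0// subr_gt0.
  have eE : e * (q + 3) = b * (q - 1) by rewrite /e divfK// gt_eqF.
  have [s Ss sq] := inf_adherent e0 (conj S0 lS).
  have := ge_inf lS (covcost_cube_step Ss e0); rewrite -/b -/q.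
  rewrite -/q in sq.
  have e1 : e < 1 by rewrite /e ltr_pdivrMr// mul1r; nra.
  have : s * (1 - b + e) <= (q + e) * (1 - b + e).
    by rewrite ler_wpM2r ?(ltW sq)//; lra.
  nra.
have [s Ss sc] := inf_lt S0 (le_lt_trans q1 c1).
exact: covcostS (ltW sc) Ss.
Qed.

Lemma hausdorff_le_leb K : compact K -> (hausdorff_measure K <= leb N K)%E.
Proof.
move=> cK; apply: ge_ereal_sup => _ [d /= d0 <-].
have Kfin : leb N K \is a fin_num.
  exact: leb_bounded_fin (compact_bounded cK) (compact_measurable_rV cK).
set k := fine (leb N K).
have k0 : 0 <= k by exact: fine_ge0.
apply/lee_addgt0Pr => e e0; rewrite -(fineK Kfin) -EFinD -/k.
(* With t <= 1, (1 + t)(k + t) <= k + t(k + 2) <= k + e. *)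
pose t := Num.min 1 (e / (k + 2)).
have t0 : 0 < t by rewrite lt_min ltr01 divr_gt0// ltr_wpDl.
have t1 : 1 < 1 + t by rewrite ltrDl.
have := hausdorff_delta_le N0 (ltW d0) (covcost_compact (covcost_cube t1) cK d0 t0).
move=> /le_trans; apply; rewrite lee_fin -/k.
have tk : t * (k + 2) <= e.
  by rewrite -ler_pdivlMr ?ge_min ?lexx ?orbT// ltr_wpDl.
have t1' : t <= 1 by rewrite ge_min lexx.
nra.
Qed.

End hausdorff_le_leb.

Lemma hausdorff_leb (R : realType) N (K : set 'rV[R]_N) : (0 < N)%N ->
  compact K -> hausdorff_measure K = leb N K.
Proof.
move=> N0 cK; apply/eqP; rewrite eq_le hausdorff_le_leb//.
exact: leb_le_hausdorff.
Qed.

(** * Upper bound for the capacity *)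

Section smooth.
Context {R : realType} {V : normedModType R}.
Implicit Types (f g : V -> R).

(** A quadratic remainder covers all building blocks: it is 0 for affine maps and at most h^2 for
    the square of a positive part. *)
Lemma is_derive_quad f (p v : V) d C :
  (forall h, `|f (h *: v + p) - f p - h * d| <= C * h ^+ 2) -> is_derive p v f d.
Proof.
move=> H; have C0 : 0 <= C.
  by have := le_trans (normr_ge0 _) (H 1); rewrite expr1n mulr1.
have cv : h^-1 *: ((f \o shift p) (h *: v) - f p) @[h --> 0^'] --> d.
  apply/cvgrPdist_le => e e0; near=> h.
  have h0 : h != 0 by near: h; exact: nbhs_dnbhs_neq.
  have he : `|h| <= e / (C + 1).
    by near: h; apply: dnbhs0_le; rewrite divr_gt0// ltr_wpDl.
  rewrite /= distrC -[X in _ - X](mulKf h0) -mulrBr normrM normfV.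
  rewrite ler_pdivrMl ?normr_gt0//; apply: le_trans (H h) _.
  rewrite -real_normK ?num_real// expr2 mulrCA ler_wpM2l//.
  have : (C + 1) * `|h| <= e by rewrite mulrC -ler_pdivlMr// ltr_wpDl.
  by apply: le_trans; rewrite ler_wpM2r// lerDl.
by apply: DeriveDef; [apply/cvg_ex; exists d|exact: cvg_lim cv].
Unshelve. all: by end_near. Qed.

(** Directional derivatives along every vector, iterated: stable under sums, products and truncated
    powers by plain recursion, and at k = 2 stronger than [C21]. *)
Fixpoint Ck k f : Prop :=
  continuous f /\
  if k is k'.+1 then
    forall v, (forall p, derivable f p v) /\ Ck k' (fun p => derive f p v)
  else True.

Lemma Ck_continuous k f : Ck k f -> continuous f.
Proof. by case: k => [|k] []. Qed.

Lemma CkW k f : Ck k.+1 f -> Ck k f.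
Proof.
elim: k f => [|k ih] f [cf df]; split => // v.
by have [df1 df2] := df v; split => //; exact: ih.
Qed.

Lemma eq_Ck k f g : f =1 g -> Ck k f -> Ck k g.
Proof. by move=> /funext ->. Qed.

Lemma Ck_cst k (c : R) : Ck k (cst c).
Proof.
elim: k c => [|k ih] c; split; try exact: cst_continuous; move=> // v; split.
  by move=> p; exact: derivable_cst.
by apply: eq_Ck (ih 0) => p; rewrite derive_val.
Qed.

Lemma Ck_add k f g : Ck k f -> Ck k g -> Ck k (fun p => f p + g p).
Proof.
elim: k f g => [|k ih] f g [cf df] [cg dg].
  by split => // p; apply: cvgD; [exact: cf|exact: cg].
split=> [p|v]; first by apply: cvgD; [exact: cf|exact: cg].
have [df1 df2] := df v; have [dg1 dg2] := dg v; split=> [p|].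
  exact: derivableD.
by apply: eq_Ck (ih _ _ df2 dg2) => p; rewrite -deriveD.
Qed.

Lemma Ck_mul k f g : Ck k f -> Ck k g -> Ck k (fun p => f p * g p).
Proof.
elim: k f g => [|k ih] f g Cf Cg; have [cf df] := Cf; have [cg dg] := Cg.
  by split => // p; apply: cvgM; [exact: cf|exact: cg].
split=> [p|v]; first by apply: cvgM; [exact: cf|exact: cg].
have [df1 df2] := df v; have [dg1 dg2] := dg v; split=> [p|].
  exact: derivableM.
apply: eq_Ck (Ck_add (ih _ _ (CkW Cf) dg2) (ih _ _ (CkW Cg) df2)) => p.
by rewrite deriveM.
Qed.

Lemma Ck_sum k (I : Type) (s : seq I) (F : I -> V -> R) :
  (forall i, Ck k (F i)) -> Ck k (fun p => \sum_(i <- s) F i p).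
Proof.
move=> CF; elim: s => [|i s ih].
  by apply: eq_Ck (Ck_cst k 0) => p; rewrite big_nil.
by apply: eq_Ck (Ck_add (CF i) ih) => p; rewrite big_cons.
Qed.

Lemma Ck_prod k (I : Type) (s : seq I) (F : I -> V -> R) :
  (forall i, Ck k (F i)) -> Ck k (fun p => \prod_(i <- s) F i p).
Proof.
move=> CF; elim: s => [|i s ih].
  by apply: eq_Ck (Ck_cst k 1) => p; rewrite big_nil.
by apply: eq_Ck (Ck_mul (CF i) ih) => p; rewrite big_cons.
Qed.

Lemma Ck_linear k f : continuous f ->
  (forall h p v, f (h *: v + p) = h * f v + f p) -> Ck k f.
Proof.
move=> cf lf; case: k => [|k]; split => // v.
have df p : is_derive p v f (f v).
  apply: (@is_derive_quad _ _ _ _ 0) => h.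
  by rewrite lf addrK subrr normr0 mul0r.
split=> [p|]; first by have [] := df p.
by apply: eq_Ck (Ck_cst k (f v)) => p; rewrite derive_val.
Qed.

Lemma derive_dir0 f (p v : V) : (forall h, f (h *: v + p) = f p) -> 'D_v f p = 0.
Proof.
move=> fE; have : is_derive p v f 0.
  by apply: (@is_derive_quad _ _ _ _ 0) => h; rewrite fE mulr0 !subrr normr0 mul0r.
by case.
Qed.

End smooth.

Section truncated_power.
Context {R : realType}.

Definition tpow m (s : R) : R := Num.max s 0 ^+ m.

Lemma tpow_ge0 m s : 0 <= tpow m s.
Proof. by rewrite exprn_ge0// le_max lexx orbT. Qed.

Lemma tpowSS m s : tpow m.+2 s = s * tpow m.+1 s.
Proof.
rewrite /tpow; have [s0|s0] := leP s 0; last by rewrite exprS.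
by rewrite !expr0n mulr0.
Qed.

Lemma tpow0 m s : s <= 0 -> tpow m.+1 s = 0.
Proof. by move=> s0; rewrite /tpow max_r// expr0n. Qed.

(** Only the square needs a look at the kink in 0; higher powers follow from the product rule, as
    [tpow m.+3] is s times [tpow m.+2]. *)
Lemma is_derive_tpow m (s : R) : is_derive s 1 (tpow m.+2) (m.+2%:R * tpow m.+1 s).
Proof.
elim: m => [|m ih].
  apply: (@is_derive_quad _ _ _ _ _ _ 1) => h; rewrite mul1r /tpow expr1.
  rewrite [h *: _]mulr1; have [s0|s0] := leP s 0; have [hs|hs] := leP (h + s) 0;
  by rewrite ler_norml; apply/andP; split; nra.
have -> : tpow m.+3 = (id * tpow m.+2 : R -> R).
  by apply/funext => x; rewrite tpowSS.
apply: is_derive_eq (is_deriveM (is_derive_id s 1) ih) _.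
rewrite /= /GRing.scale/= mulr1 mulrCA -tpowSS -[m.+3%:R]natr1.
by ring.
Qed.

Lemma continuous_tpow m : continuous (tpow m).
Proof.
move=> s; apply: (@continuous_comp _ _ _ (fun t : R => Num.max t 0)
  (fun t : R => t ^+ m)); last exact: exprn_continuous.
by apply: max_fun_continuous => x; [exact: cvg_id|exact: cvg_cst].
Qed.

End truncated_power.

Section smooth_tpow.
Context {R : realType} {V : normedModType R}.
Implicit Types (f : V -> R).

(** Restriction to the line through p along v reduces this to the chain rule on R. *)
Lemma is_derive_comp1 (G : R -> R) f (p v : V) df dG :
  is_derive p v f df -> is_derive (f p) 1 G dG ->
  is_derive p v (G \o f) (dG * df).
Proof.
have lineE (k : V -> R) : 'D_v k p = 'D_1 (fun h : R => k (h *: v + p)) 0.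
  rewrite /derive; set u := fun h => _; set w := fun h => _.
  suff -> : u = w by [].
  apply/funext => h; rewrite /u /w /= [h *: 1]mulr1 addr0 scale0r add0r.
  by [].
move=> [fd fE] dG'; pose g (h : R) := f (h *: v + p).
have dg : is_derive (0 : R) (1 : R) g df.
  by split; [exact: (derivable1P f p v).1|rewrite -fE lineE].
have dG0 : is_derive (g 0) 1 G dG by rewrite /g scale0r add0r.
have [d1 d2] := is_derive1_comp dG0 dg.
by split; [exact: (derivable1P (G \o f) p v).2|rewrite lineE].
Qed.

(** Each derivative lowers the exponent by one, and the last exponent must still be at least 1. For
    k = 2 this is the origin of the cubes in the test functions. *)
Lemma Ck_tpow k m f : (k < m)%N -> Ck k f -> Ck k (tpow m \o f).
Proof.
elim: k m => [|k ih] m km Cf; have cf := Ck_continuous Cf.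
  split => // p; apply: continuous_comp; first exact: cf.
  exact: continuous_tpow.
case: m km => [|[|m]]// km; split => [p|v].
  by apply: continuous_comp; [exact: cf|exact: continuous_tpow].
have [_ /(_ v)[df Cdf]] := Cf.
have dE p : is_derive p v (tpow m.+2 \o f) (m.+2%:R * tpow m.+1 (f p) * 'D_v f p).
  apply: is_derive_comp1; first exact: derivableP.
  exact: is_derive_tpow.
split=> [p|]; first by have [] := dE p.
have Ctp := ih m.+1 km (CkW Cf).
apply: eq_Ck (Ck_mul (Ck_mul (Ck_cst k m.+2%:R) Ctp) Cdf) => p.
by rewrite derive_val.
Qed.

End smooth_tpow.

Section cutoff.
Context {R : realType} (N : nat).
Local Notation V := ('rV[R]_N * R)%type.
Implicit Types (K : set 'rV[R]_N) (p : V).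

Lemma Ck_space k (i : 'I_N) : Ck k (fun p : V => p.1 ord0 i).
Proof.
apply: Ck_linear => [p|h p v]; last by rewrite /= !mxE.
apply: (@continuous_comp _ _ _ fst (fun x : 'rV[R]_N => x ord0 i)).
  exact: cvg_fst.
exact: coord_continuous.
Qed.

Lemma Ck_time k : Ck k (fun p : V => p.2).
Proof. by apply: Ck_linear => [p|h p v] //; exact: cvg_snd. Qed.

(** A product over coordinates, to match sup-norm balls. On the half-size ball each base is at least
    2(1 - 1/4) > 1; beyond distance r in some coordinate a factor vanishes. *)
Definition box_bump (y : 'rV[R]_N) (r : R) (p : V) : R :=
  \prod_(i < N) tpow 3 (2 * (1 - ((p.1 ord0 i - y ord0 i) / r) ^+ 2)).

Lemma Ck_box_bump y r : Ck 2 (box_bump y r).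
Proof.
apply: Ck_prod => i; apply: (@Ck_tpow _ _ 2 3) => //.
apply: Ck_mul; first exact: Ck_cst.
apply: Ck_add; first exact: Ck_cst.
have Cq : Ck 2 (fun p : V => (p.1 ord0 i - y ord0 i) / r).
  apply: Ck_mul; last exact: Ck_cst.
  by apply: Ck_add; [exact: Ck_space|exact: Ck_cst].
apply: eq_Ck (Ck_mul (Ck_cst 2 (-1)) (Ck_mul Cq Cq)) => p.
by rewrite /= mulN1r -expr2.
Qed.

Lemma box_bump_ge0 y r p : 0 <= box_bump y r p.
Proof. by apply: prodr_ge0 => i _; exact: tpow_ge0. Qed.

Lemma box_bump_ge1 y r p : 0 < r -> ball y (r / 2) p.1 -> 1 <= box_bump y r p.
Proof.
move=> r0 /ball_rVP yp; have r20 : 0 < r / 2 by rewrite divr_gt0.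
rewrite /box_bump; apply: (big_ind (fun z => 1 <= z)) => // [|i _].
  by move=> a b a1 b1; rewrite mulr_ege1.
rewrite /tpow exprn_ege1// le_max; apply/orP; left.
have : `|(p.1 ord0 i - y ord0 i) / r| < 1 / 2.
  by rewrite normf_div (gtr0_norm r0) ltr_pdivrMr// mulrC mulrA mulr1 distrC yp.
rewrite ltr_norml => /andP[]; move: (_ / r) => w w1 w2.
by rewrite expr2; nra.
Qed.

Lemma box_bump_eq0 y r p : 0 < r -> ~ ball y r p.1 -> box_bump y r p = 0.
Proof.
move=> r0 nyp; have [i hi] : exists i, r <= `|y ord0 i - p.1 ord0 i|.
  apply/not_existsP => h; apply: nyp; apply/(ball_rVP _ _ r0) => i.
  by rewrite ltNge; apply/negP.
rewrite /box_bump (bigD1 i)//= tpow0 ?mul0r//.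
rewrite pmulr_rle0// subr_le0 exprMn exprVn ler_pdivlMr ?exprn_gt0// mul1r.
by rewrite -[leRHS]real_normK ?num_real// distrC ler_pXn2r// nnegrE ltW.
Qed.

(** The sum S of finitely many bumps is at least 1 near K and 0 off the thickening. The profile 1 -
    (1 - S)_+^3 maps 0 to 0, every S >= 1 to 1, and keeps the function of class C^2. *)
Lemma exists_cutoff K r : compact K -> 0 < r ->
  exists2 Phi : V -> R, Ck 2 Phi &
    [/\ forall p, 0 <= Phi p <= 1,
        forall p, ~ thicken K r p.1 -> Phi p = 0,
        forall p q, p.1 = q.1 -> Phi p = Phi q
      & exists2 U : set 'rV[R]_N, open U /\ K `<=` U &
          forall p, U p.1 -> Phi p = 1].
Proof.
move=> cK r0; have r20 : 0 < r / 2 by rewrite divr_gt0.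
have := cK; rewrite compact_cover => /(_ _ K (fun y => ball y (r / 2))).
case=> [y _|x Kx|/= D0 DK KD]; first exact: ball_open.
  by exists x => //; exact: ballxx.
pose D : seq 'rV[R]_N := finmap.enum_fset D0.
pose S p := \sum_(y <- D) box_bump y r p.
have S0 p : 0 <= S p by apply: sumr_ge0 => y _; exact: box_bump_ge0.
exists (fun p => 1 - tpow 3 (1 - S p)).
  have CS : Ck 2 S by apply: Ck_sum => y; exact: Ck_box_bump.
  have neg f : Ck 2 f -> Ck 2 (fun p : V => 1 - f p).
    move=> Cf; apply: Ck_add; first exact: Ck_cst.
    by apply: eq_Ck (Ck_mul (Ck_cst 2 (-1)) Cf) => p; rewrite /= mulN1r.
  have C1S := neg _ CS.
  exact: (neg _ (@Ck_tpow _ _ 2 3 _ isT C1S)).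
split.
- move=> p; rewrite subr_ge0 gerBl tpow_ge0 andbT /tpow.
  by rewrite exprn_ile1 ?le_max ?lexx ?orbT// ge_max ler01 gerBl S0.
- move=> p np; rewrite (_ : S p = 0) ?subr0 ?/tpow ?max_l ?expr1n ?subrr//.
  rewrite /S big_seq big1// => y yD; apply: box_bump_eq0 => // yp; apply: np.
  by exists y => //; exact: set_mem (DK _ yD).
- move=> p q pq; rewrite /S; congr (1 - tpow 3 (1 - _)).
  by apply: eq_bigr => y _; rewrite /box_bump pq.
exists (\bigcup_(y in [set` D]) ball y (r / 2)).
  by split => //; apply: bigcup_open => y _; exact: ball_open.
move=> p [y /= yD yp]; rewrite tpow0 ?subr0// subr_le0.
rewrite /S (big_rem y)//=; apply: le_trans (box_bump_ge1 r0 yp) _.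
by rewrite lerDl sumr_ge0// => z _; exact: box_bump_ge0.
Qed.

End cutoff.

Section monotone.
Local Open Scope ereal_scope.

(* No measurability is assumed: [cap_energy] and [iter_int] integrate functions
   whose measurability is never established. *)
Lemma le_integral_nonmeas d (X : measurableType d) (R : realType)
    (mu : {measure set X -> \bar R}) (D : set X) (f g : X -> \bar R) :
  (forall x, D x -> 0 <= f x) -> (forall x, D x -> f x <= g x) ->
  \int[mu]_(x in D) f x <= \int[mu]_(x in D) g x.
Proof.
move=> f0 fg; rewrite integral_mkcond [leRHS]integral_mkcond.
have g0 x : D x -> 0 <= g x by move=> Dx; exact: le_trans (f0 _ Dx) (fg _ Dx).
rewrite !ge0_integralTE; [|by move=> x; exact: erestrict_ge0..].
apply: le_ereal_sup => _ [h /= hf <-]; exists h => // x.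
by apply: le_trans (hf x) _; exact: lee_restrict.
Qed.

Lemma iter_int_ge0 (R : realType) n (f : 'rV[R]_n -> \bar R) :
  (forall x, 0 <= f x) -> 0 <= iter_int f.
Proof.
elim: n f => [|n ih] f f0 /=; first exact: f0.
by apply: integral_ge0 => s _; apply: ih => y; exact: f0.
Qed.

Lemma le_iter_int (R : realType) n (f g : 'rV[R]_n -> \bar R) :
  (forall x, 0 <= f x) -> (forall x, f x <= g x) -> iter_int f <= iter_int g.
Proof.
elim: n f g => [|n ih] f g f0 fg /=; first exact: fg.
apply: le_integral_nonmeas => s _; first by apply: iter_int_ge0 => y; exact: f0.
by apply: ih => y; [exact: f0|exact: fg].
Qed.

End monotone.

(** * The product test function and its energy *)

Section time_cutoff.
Context {R : realType}.

Lemma is_derive_time_cutoff (d t : R) :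
  is_derive t 1 (fun t => - tpow 3 (1 - t / d)) (3 / d * tpow 2 (1 - t / d)).
Proof.
have D1 : is_derive t 1 (fun t : R => 1 - t / d) (- d^-1).
  apply: (@is_derive_quad _ _ _ _ _ _ 0) => h.
  rewrite mul0r normr_le0 [h *: _]mulr1; apply/eqP; ring.
have D2 := @is_derive1_comp R (tpow 3) (fun t : R => 1 - t / d) t _ _
    (is_derive_tpow 1 _) D1.
have D3 := is_deriveN D2.
apply: is_derive_eq D3 _; ring.
Qed.

(** The cutoff falls from 1 to 0 before time T, so its slope integrates to 1 for every d, and d
    stays free to make the Laplacian term small. *)
Lemma integral_time_cutoff (d T : R) : 0 < d -> d <= T ->
  (\int[@lebesgue_measure R]_(t in `[0%R, T]) (3 / d * tpow 2 (1 - t / d))%:E = 1)%E.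
Proof.
move=> d0 dT; have T0 : 0 < T := lt_le_trans d0 dT.
pose F (t : R) := - tpow 3 (1 - t / d).
have cF : continuous F.
  move=> t; have [dF _] := is_derive_time_cutoff d t.
  exact/differentiable_continuous/derivable1_diffP.
rewrite (@continuous_FTC2 _ (fun t => 3 / d * tpow 2 (1 - t / d)) F)//.
- have -> : F 0 = -1 by rewrite /F mul0r subr0 /tpow max_l ?ler01// expr1n.
  have -> : F T = 0 by rewrite /F tpow0 ?oppr0// subr_le0 ler_pdivlMr// mul1r.
  by rewrite -EFinB opprK add0r.
- have c1 : continuous (fun t : R => 1 - t / d).
    move=> t; apply/differentiable_continuous/derivable1_diffP.
    apply: derivableB; first exact: derivable_cst.
    by apply: derivableM; [exact: derivable_id|exact: derivable_cst].
  have c2 : continuous (fun t : R => tpow 2 (1 - t / d)).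
    by move=> t; exact: (continuous_comp (c1 t) (@continuous_tpow _ 2 _)).
  apply: continuous_subspaceT => t.
  exact: (cvgM (cvg_cst (3 / d)) (c2 t)).
- split.
  + by move=> t _; have [] := is_derive_time_cutoff d t.
  + by apply: cvg_at_right_filter; exact: cF.
  + by apply: cvg_at_left_filter; exact: cF.
- move=> t _; rewrite derive1E; by have [] := is_derive_time_cutoff d t.
Qed.

End time_cutoff.

Section regular_functions.
Context {R : realType} (N : nat).
Local Notation V := ('rV[R]_N * R)%type.
Implicit Types (O K : set 'rV[R]_N) (T : R).

Lemma Ck_C21 O T (psi : V -> R) : Ck 2 psi -> C21 O T psi.
Proof.
move=> [c0 d0].
have ext (g : V -> R) : continuous g -> cont_ext (QT O T) (QTbar O T) g.
  by move=> cg; exists g; split => //; exact: continuous_subspaceT.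
split; first exact: continuous_subspaceT.
split; first by move=> p _; have [] := d0 (@et R N).
split; first by apply: ext; have [_ []] := d0 (@et R N).
split; first by move=> i p _; have [] := d0 (@ex R N i).
split; first by move=> i; apply: ext; have [_ []] := d0 (@ex R N i).
split=> i j; first by move=> p _; have [_ [_ /(_ (ex R i))[]]] := d0 (@ex R N j).
by apply: ext; have [_ [_ /(_ (ex R i))[_ []]]] := d0 (@ex R N j).
Qed.

Lemma thicken_sub K O : compact K -> open O -> K `<=` O ->
  exists2 r, 0 < r & thicken K r `<=` O.
Proof.
move=> cK oO KO.
have : \forall r \near (0 : R)^'+, K `<=` [set x | ball x r `<=` O].
  apply: ((compact_near_coveringP K).1 cK) => x Kx.
  have /nbhs_ballP[e /= e0 eO] : nbhs x O by apply: open_nbhs_nbhs; split => //; exact: KO.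
  have e20 : 0 < e / 2 by rewrite divr_gt0.
  exists (ball x (e / 2), [set r | r < e / 2]); first split => /=.
  - exact: nbhsx_ballx.
  - exact: nbhs_right_lt.
  - move=> [y r] [/= xy re] z yz; apply: eO; rewrite [e]splitr.
    by apply: ball_triangle xy _; apply: le_ball yz; exact: ltW.
move=> h; have [r [r0 hr]] : exists r, 0 < r /\ K `<=` [set x | ball x r `<=` O].
  apply: (@filter_ex _ ((0 : R)^'+)); apply: filterI h.
  exact: nbhs_right_gt.
by exists r => // z [x Kx]; exact: hr.
Qed.

Lemma compact_closure_rV O : bounded_set O -> compact (closure O).
Proof.
move=> /rV_bounded[M M0 OM]; apply: bounded_closed_compact; last exact: closed_closure.
exists M; split; rewrite ?num_real// => s Ms x clx /=; apply: le_trans (ltW Ms).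
have : closure O `<=` [set y : 'rV[R]_N | `|y| <= M].
  by rewrite ((closure_id _).1 (@closed_norm_le R N M)); exact: closureS.
exact.
Qed.

Lemma lap_bounded O T (Phi : V -> R) : bounded_set O -> Ck 2 Phi ->
  exists2 M, 0 <= M & forall x t, O x -> 0 <= t <= T -> `|lap Phi (x, t)| <= M.
Proof.
move=> bO [_ d0]; have cl : continuous (lap Phi).
  have cd i : continuous (dx i (dx i Phi)).
    by have [_ [_ /(_ (ex R i))[_ []]]] := d0 (@ex R N i).
  by apply: continuous_big => //; exact: add_continuous.
have cQ : compact (closure O `*` `[0, T]%classic).
  by apply: compact_setX; [exact: compact_closure_rV|exact: segment_compact].
have [M [_ hM]] := compact_bounded (continuous_compact (continuous_subspaceT cl) cQ).
exists (`|M| + 1); first by rewrite addr_ge0.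
move=> x t Ox t0; apply: hM; first by rewrite (le_lt_trans (ler_norm _))// ltrDl.
exists (x, t) => //; split => /=; first exact: subset_closure.
by rewrite in_itv.
Qed.

(** The energy integrand is dominated by functions of this form, for which the iterated integral is
    explicit. *)
Lemma iter_int_indic2 (U O : set 'rV[R]_N) (a b : R) : measurable U ->
  measurable O -> 0 <= a -> 0 <= b ->
  iter_int (fun x => (a * \1_U x + b * \1_O x)%:E) =
  (a%:E * leb N U + b%:E * leb N O)%E.
Proof.
move=> mU mO a0 b0.
have mI (A : set 'rV[R]_N) (c : R) : measurable A ->
    measurable_fun [set: 'rV[R]_N] (fun x => (c * \1_A x)%:E).
  move=> mA; apply/measurable_EFinP; apply: measurable_funM; first exact: measurable_cst.
  exact: measurable_indic.
have iI (A : set 'rV[R]_N) (c : R) : measurable A -> 0 <= c ->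
    (\int[leb N]_x (c * \1_A x)%:E = c%:E * leb N A)%E.
  move=> mA c0; under eq_integral do rewrite EFinM.
  rewrite ge0_integralZl_EFin// ?leb_indic//.
  by apply/measurable_EFinP; exact: measurable_indic.
rewrite iter_int_leb.
- under eq_integral do rewrite EFinD.
  rewrite ge0_integralD//; first by rewrite !iI.
  + by move=> x _; rewrite lee_fin mulr_ge0.
  + exact: mI.
  + by move=> x _; rewrite lee_fin mulr_ge0.
  + exact: mI.
- under eq_fun do rewrite EFinD.
  by apply: emeasurable_funD; exact: mI.
- by move=> x; rewrite lee_fin addr_ge0// mulr_ge0.
Qed.

Definition time_cutoff (d : R) (p : V) : R := tpow 3 (1 - p.2 / d).

Lemma time_cutoff_dt d p : is_derive p (@et R N) (time_cutoff d)
  (- (3 / d * tpow 2 (1 - p.2 / d))).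
Proof.
have D1 : is_derive p (@et R N) (fun q : V => q.2) 1.
  apply: (@is_derive_quad _ _ _ _ _ _ 0) => h.
  by rewrite mul0r normr_le0 /= [h *: 1]mulr1 mulr1 addrK subrr.
have D2 := is_derive_comp1 D1 (is_derive_time_cutoff d p.2).
have := is_deriveN D2; rewrite mulr1.
by congr is_derive; apply/funext => q; rewrite /= fctE opprK.
Qed.

Lemma Ck_time_cutoff d : Ck 2 (time_cutoff d).
Proof.
apply: (@Ck_tpow _ _ 2 3 (fun p : V => 1 - p.2 / d)) => //.
apply: Ck_add; first exact: Ck_cst.
apply: eq_Ck (Ck_mul (Ck_time N 2) (Ck_cst 2 (- d^-1))) => p.
by rewrite /= mulrN.
Qed.

Lemma dx_time_cutoff d i p : dx i (time_cutoff d) p = 0.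
Proof.
by apply: derive_dir0 => h; rewrite /time_cutoff /= [h *: 0]mulr0 add0r.
Qed.

Section separated.
Variables (Phi : V -> R) (d : R).
Hypothesis CPhi : Ck 2 Phi.
Hypothesis Phi_space : forall p q, p.1 = q.1 -> Phi p = Phi q.
Let psi (p : V) := Phi p * time_cutoff d p.

Lemma dt_separated p : dt psi p = - (3 / d * tpow 2 (1 - p.2 / d)) * Phi p.
Proof.
have [_ dP] := CPhi; have [dPt _] := dP (@et R N).
have [dT dTE] := time_cutoff_dt d p.
have := deriveM (dPt p) dT; rewrite dTE => h.
rewrite [LHS]h (_ : 'D_(et R N) Phi p = 0).
  by rewrite scaler0 addr0 /GRing.scale/= mulrC.
by apply: derive_dir0 => k; apply: Phi_space; rewrite /= scaler0 add0r.
Qed.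

Lemma dx_separated (F : V -> R) i : (forall p, derivable F p (ex R i)) ->
  dx i (fun p => F p * time_cutoff d p) = (fun p => dx i F p * time_cutoff d p).
Proof.
move=> dF; apply/funext => p.
have [_ dT] := Ck_time_cutoff d; have [dTi _] := dT (ex R i).
have h := deriveM (dF p) (dTi p).
rewrite [LHS]h -/(dx i (time_cutoff d) p) dx_time_cutoff scaler0 add0r.
by rewrite /GRing.scale/= mulrC.
Qed.

Lemma lap_separated p : lap psi p = lap Phi p * time_cutoff d p.
Proof.
rewrite /lap mulr_suml; apply: eq_bigr => i _.
have [_ dP] := CPhi; have [dP1 [_ dP2]] := dP (ex R i).
have [dP3 _] := dP2 (ex R i).
by rewrite /psi dx_separated// dx_separated.
Qed.

End separated.

End regular_functions.

Section capacity_upper_bound.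
Context {R : realType} (N : nat).
Local Notation V := ('rV[R]_N * R)%type.
Implicit Types (O K : set 'rV[R]_N) (T : R).

(** Here u stands for the measure of the support of the cutoff and m for the bound on the integrated
    Laplacian, which acts only while t <= d. *)
Lemma energy_time_bound (T d u m : R) : 0 < d -> d <= T -> 0 <= u -> 0 <= m ->
  (\int[@lebesgue_measure R]_(t in QT_itv T)
     (3 / d * tpow 2 (1 - t / d) * u + \1_(`[0, d]%classic : set R) t * m)%:E
   <= (u + d * m)%:E)%E.
Proof.
move=> d0 dT u0 m0.
have h0 t : 0 <= 3 / d * tpow 2 (1 - t / d).
  by rewrite mulr_ge0 ?tpow_ge0// divr_ge0// ltW.
have mtp : measurable_fun [set: R] (fun t : R => 3 / d * tpow 2 (1 - t / d)).
  apply: measurable_funM => //; apply: (measurableT_comp (f := tpow 2)).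
    by apply: continuous_measurable_fun; exact: continuous_tpow.
  by apply: measurable_funB => //; exact: measurable_funM.
have m1 : measurable_fun [set: R] (fun t : R => (3 / d * tpow 2 (1 - t / d) * u)%:E).
  by apply/measurable_EFinP; exact: measurable_funM.
have m2 : measurable_fun [set: R] (fun t : R => (\1_(`[0, d]%classic : set R) t * m)%:E).
  apply/measurable_EFinP; apply: measurable_funM => //; exact: measurable_indic.
have g1 t : (0 <= (3 / d * tpow 2 (1 - t / d) * u)%:E)%E by rewrite lee_fin mulr_ge0.
have g2 t : (0 <= (\1_(`[0, d]%classic : set R) t * m)%:E)%E by rewrite lee_fin mulr_ge0.
have mTi : measurable (`[0, T]%classic : set R) by exact: measurable_itv.
apply: (@le_trans _ _ (\int[@lebesgue_measure R]_(t in `[0%R, T])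
   ((3 / d * tpow 2 (1 - t / d) * u)%:E + (\1_(`[0%R, d]%classic : set R) t * m)%:E)))%E.
  rewrite integral_mkcond [leRHS]integral_mkcond.
  apply: le_integral_nonmeas => t _.
    by apply: erestrict_ge0 => s _; rewrite EFinD adde_ge0.
  rewrite !patchE; case: ifPn => [|_]; last by case: ifPn => // _; rewrite adde_ge0.
  rewrite inE /QT_itv/= => /andP[t0 tT]; rewrite mem_set ?EFinD//=.
  by rewrite in_itv/= (ltW t0) ltW.
rewrite ge0_integralD//; [|exact: measurable_funTS..].
rewrite EFinD leeD//.
  under eq_integral do rewrite mulrC EFinM.
  rewrite ge0_integralZl_EFin//; last 2 first.
  - by move=> t _; rewrite lee_fin.
  - by apply: measurable_funTS; exact/measurable_EFinP.
  by rewrite integral_time_cutoff// mule1.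
under eq_integral do rewrite mulrC EFinM.
rewrite ge0_integralZl_EFin//; last first.
  by apply: measurable_funTS; apply/measurable_EFinP; exact: measurable_indic.
rewrite integral_indic// muleC EFinM lee_wpmul2r ?lee_fin//.
apply: (@le_trans _ _ (@lebesgue_measure R `[0, d]%classic)).
  by apply: le_measure; rewrite ?inE//; exact: measurableI.
by rewrite lebesgue_measure_itv/= lte_fin d0 oppr0 adde0.
Qed.

Lemma capacity_le O T K (e : R) : bounded_domain O -> 0 < T ->
  compact K -> K `<=` O -> 0 < e -> (capacity O T K <= leb N K + e%:E)%E.
Proof.
move=> [oO [_ [_ bO]]] T0 cK KO e0.
have e20 : 0 < e / 2 by rewrite divr_gt0.
have [r1 r10 r1O] := thicken_sub cK oO KO.
have [r2 r20 r2K] := leb_thicken_le cK e20.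
(* [r1] keeps the support of the cutoff inside Omega, which gives the lateral boundary values; [r2]
   keeps its measure within e/2 of that of K. *)
pose r := Num.min r1 r2.
have r0 : 0 < r by rewrite lt_min r10.
have thS s : r <= s -> thicken K r `<=` thicken K s.
  by move=> rs x [y Ky xy]; exists y => //; exact: le_ball xy.
have rO : thicken K r `<=` O.
  by apply: subset_trans r1O; apply: thS; rewrite ge_min lexx.
pose U := thicken K r.
have mth s : measurable (thicken K s).
  by apply: open_measurable_rV; exact: open_thicken.
have mO := open_measurable_rV oO.
have bU : bounded_set U by exact: bounded_thicken (compact_bounded cK).
have UK : (leb N U <= leb N K + (e / 2)%:E)%E.
  apply: le_trans r2K; apply: le_measure; rewrite ?inE; [exact: mth|exact: mth|].
  by apply: thS; rewrite ge_min lexx orbT.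
have [Phi CPhi [Phi01 PhiU Phi_space [W [oW KW] W1]]] := exists_cutoff cK r0.
have [M M0 hM] := lap_bounded T bO CPhi.
have Ufin := leb_bounded_fin bU (mth _); have Ofin := leb_bounded_fin bO mO.
pose u := fine (leb N U); pose o := fine (leb N O).
have u0 : 0 <= u by exact: fine_ge0.
have o0 : 0 <= o by exact: fine_ge0.
(* The Laplacian then costs d M |Omega| <= e/2; the 1 guards against a zero denominator. *)
pose d := Num.min T (e / 2 / (M * o + 1)).
have Mo0 : 0 <= M * o by exact: mulr_ge0.
have d0 : 0 < d by rewrite lt_min T0 divr_gt0// ltr_wpDl.
have dT : d <= T by rewrite ge_min lexx.
have dM : d * (M * o) <= e / 2.
  have : d * (M * o + 1) <= e / 2.
    by rewrite -ler_pdivlMr ?ge_min ?lexx ?orbT// ltr_wpDl.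
  by apply: le_trans; rewrite ler_wpM2l ?(ltW d0)// lerDl.
pose psi (p : V) := Phi p * time_cutoff d p.
have adm : admissible O T K psi.
  split; last first.
    exists W; split => //; split => // x Wx _.
    by rewrite /psi W1//= mul1r /time_cutoff/= mul0r subr0 /tpow max_l ?ler01// expr1n.
  split; first exact: (Ck_C21 O T (Ck_mul CPhi (@Ck_time_cutoff R N d))).
  split=> [x t _ nOx _|x _].
    by rewrite /psi PhiU ?mul0r//= => /rO.
  by rewrite /psi /time_cutoff/= tpow0 ?mulr0// subr_le0 ler_pdivlMr// mul1r.
apply: (@le_trans _ _ (cap_energy O T psi)).
  by apply: ereal_inf_lbound; exists psi.
have UKe : ((u + d * (M * o))%:E <= leb N K + e%:E)%E.
  apply: (@le_trans _ _ (leb N K + (e / 2)%:E + (e / 2)%:E))%E.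
    by rewrite EFinD leeD ?lee_fin// fineK.
  by rewrite -addeA -EFinD -splitr.
apply: le_trans UKe; apply: le_trans (energy_time_bound d0 dT u0 (mulr_ge0 M0 o0)).
apply: le_integral_nonmeas => t /= t0T.
  by apply: iter_int_ge0 => x; rewrite lee_fin mulr_ge0.
have /andP[t0 tT] := t0T.
set a := 3 / d * tpow 2 (1 - t / d); set b := \1_(`[0, d]%classic : set R) t.
have a0 : 0 <= a by rewrite mulr_ge0 ?tpow_ge0// divr_ge0// ltW.
have b0 : 0 <= b by [].
have -> : (a * u + b * (M * o))%:E =
    iter_int (fun x : 'rV[R]_N => (a * \1_U x + (b * M) * \1_O x)%:E).
  rewrite iter_int_indic2// ?mulr_ge0//; last exact: mth.
  by rewrite -(fineK Ufin) -(fineK Ofin) -!EFinM -EFinD mulrA.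
apply: le_iter_int => x; first by rewrite lee_fin mulr_ge0.
rewrite lee_fin; rewrite [X in X * `|_|]indicE; have [Ox|nOx] := boolP (x \in O); last first.
  rewrite mul0r; apply: addr_ge0; first by apply: mulr_ge0 a0 _.
  by apply: mulr_ge0 => //; exact: mulr_ge0 b0 M0.
rewrite mul1r dt_separated// lap_separated// indicE [\1_O x]indicE Ox mulr1.
apply: le_trans (ler_normD _ _) _; apply: lerD.
  rewrite normrM normrN (ger0_norm a0) ler_wpM2l//.
  have /andP[P0 P1] := Phi01 (x, t); rewrite ger0_norm//.
  have [xU|nxU] := boolP (x \in U); first by rewrite P1.
  by rewrite PhiU//=; move: nxU; rewrite notin_setE.
rewrite normrM mulrC; apply: ler_pM => //; last first.
  by apply: hM; [rewrite inE in Ox|rewrite (ltW t0) ltW].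
rewrite ger0_norm ?tpow_ge0// /b indicE /time_cutoff /=.
have [td|td] := leP t d; last first.
  rewrite tpow0; last by rewrite subr_le0 ler_pdivlMr// mul1r ltW.
  by [].
rewrite mem_set/=; last by rewrite in_itv/= td ltW.
rewrite exprn_ile1 ?le_max ?lexx ?orbT// ge_max ler01 andbT gerBl.
by rewrite divr_ge0// ltW.
Qed.

End capacity_upper_bound.

(** * Lower bound for the capacity *)

Section difference_quotients.
Context {R : realType}.

Lemma derivable1_continuous_itv (u du : R -> R) (a b : R) :
  (forall s, a <= s <= b -> is_derive s 1 u (du s)) ->
  {within `[a, b], continuous u}.
Proof.
move=> h; apply: derivable_within_continuous => s; rewrite in_itv/= => /h.
by case.
Qed.

(** The mean value theorem is applied to v(s) = u(s) + u(-s) - c s^2 on [0, h], then to u' on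
    [-z, z]: v'(z) = 2z (u''(y) - c) >= 0. No continuity of u'' is involved. *)
Lemma second_difference_ge (u du ddu : R -> R) (h c : R) : 0 < h ->
  (forall s, - h <= s <= h -> is_derive s 1 u (du s)) ->
  (forall s, - h <= s <= h -> is_derive s 1 du (ddu s)) ->
  (forall s, - h <= s <= h -> c <= ddu s) ->
  c * h ^+ 2 <= u h - 2 * u 0 + u (- h).
Proof.
move=> h0 d1 d2 cdd.
pose v (s : R) := u s + u (- s) - c * s ^+ 2.
pose dv (s : R) := du s - du (- s) - 2 * c * s.
have dvP s : 0 <= s <= h -> is_derive s 1 v (dv s).
  move=> /andP[s0 sh].
  have D1 : is_derive s 1 u (du s) by apply: d1; rewrite sh andbT; lra.
  have D2 : is_derive (- s) 1 u (du (- s)) by apply: d1; apply/andP; split; lra.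
  have D3 : is_derive s 1 (fun t => u (- t)) (du (- s) * -1).
    exact: is_derive1_comp D2 (is_deriveNid s 1).
  have D4 : is_derive s 1 (fun t : R => c * t ^+ 2) (2 * c * s).
    apply: (@is_derive_quad _ _ _ _ _ _ `|c|) => k.
    rewrite [k *: _]mulr1 (_ : _ - _ = c * k ^+ 2); last by ring.
    by rewrite normrM (ger0_norm (sqr_ge0 k)).
  have D5 := is_deriveB (is_deriveD D1 D3) D4.
  by apply: is_derive_eq D5 _; rewrite /dv; ring.
have dvo x : x \in `]0, h[ -> is_derive x 1 v (dv x).
  by rewrite in_itv/= => /andP[x0 xh]; apply: dvP; rewrite !ltW.
have [z] := MVT h0 dvo (derivable1_continuous_itv dvP).
rewrite in_itv/= => /andP[z0 zh] vE.
have duo x : x \in `]- z, z[ -> is_derive x 1 du (ddu x).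
  by rewrite in_itv/= => /andP[x0 xh]; apply: d2; apply/andP; split; lra.
have duc : {within `[- z, z], continuous du}.
  apply: (@derivable1_continuous_itv _ ddu) => x /andP[x0 xh].
  by apply: d2; apply/andP; split; lra.
have zz : - z < z by lra.
have [y] := MVT zz duo duc.
rewrite in_itv/= => /andP[y0 yz] duE.
have cy : c <= ddu y by apply: cdd; apply/andP; split; lra.
have dvz : 0 <= dv z.
  have -> : dv z = (ddu y - c) * (2 * z) by rewrite /dv duE; ring.
  by rewrite mulr_ge0 ?subr_ge0//; lra.
have : 0 <= v h - v 0 by rewrite vE mulr_ge0// subr0 ltW.
rewrite /v oppr0 expr0n/= mulr0 subr0; lra.
Qed.

Lemma first_difference_ge (u du : R -> R) (h c : R) : 0 < h ->
  (forall s, 0 <= s <= h -> is_derive s 1 u (du s)) ->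
  (forall s, 0 <= s <= h -> c <= du s) ->
  c * h <= u h - u 0.
Proof.
move=> h0 d1 cd.
have duo x : x \in `]0, h[ -> is_derive x 1 u (du x).
  by rewrite in_itv/= => /andP[x0 xh]; apply: d1; rewrite !ltW.
have [z] := MVT h0 duo (derivable1_continuous_itv d1).
rewrite in_itv/= => /andP[z0 zh] ->.
by rewrite subr0 ler_wpM2r ?(ltW h0)// cd// !ltW.
Qed.

End difference_quotients.

Section local_estimate.
Context {R : realType} (N : nat).
Local Notation V := ('rV[R]_N * R)%type.
Implicit Types (O K : set 'rV[R]_N) (T : R) (p : V).

Lemma open_QT O T : open O -> open (QT O T).
Proof.
move=> oO; have -> : QT O T = O `*` `]0, T[%classic.
  by apply/seteqP; split => p /=; rewrite in_itv.
rewrite openE => -[x t] [/= Ox tT]; exists (O, `]0, T[%classic) => //=.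
by split; apply: open_nbhs_nbhs; split.
Qed.

(** On the open cylinder a derivative coincides with its continuous extension, hence is itself
    continuous there. *)
Lemma cont_ext_near O T (g : V -> R) p (e : R) : open O ->
  cont_ext (QT O T) (QTbar O T) g -> QT O T p -> 0 < e ->
  \forall q \near p, `|g q - g p| < e.
Proof.
move=> oO [G [cG Gg]] Qp e0.
have oQ := @open_QT O T oO.
have nQ : nbhs p (QT O T) by exact: open_nbhs_nbhs.
have QQ : QT O T `<=` QTbar O T.
  move=> q [Oq /andP[q0 qT]]; split; first exact: subset_closure.
  by rewrite !ltW.
have Gp : {for p, continuous G}.
  have : {within QT O T, continuous G} by exact: continuous_subspaceW cG.
  by rewrite continuous_open_subspace// => h; apply: h; exact: mem_set.
have Gn : \forall q \near p, `|G p - G q| < e.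
  by move/cvgrPdist_lt : Gp => /(_ e e0).
apply: filterS (filterI Gn nQ) => q [Gq Qq].
by rewrite distrC -(Gg p (mem_set Qp)) -(Gg q (mem_set Qq)).
Qed.

Lemma is_derive_line (f : V -> R) p (v : V) (s d : R) :
  is_derive (s *: v + p) v f d -> is_derive s 1 (fun s : R => f (s *: v + p)) d.
Proof.
have E : (fun h : R => h^-1 *: ((f \o shift (s *: v + p)) (h *: v) - f (s *: v + p))) =
  (fun h : R => h^-1 *: (((fun s : R => f (s *: v + p)) \o shift s) (h *: (1 : R)) -
     f (s *: v + p))).
  by apply/funext => h; rewrite /= [h *: 1]mulr1 scalerDl addrA.
move=> [df dE]; split; first by rewrite /derivable -E.
by rewrite -dE /derive E.
Qed.

Definition heatop (psi : V -> R) p : R := dt psi p + lap psi p.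

(** Forward in time, so that it produces increments of the mass; centred in space, so that it
    cancels under translation. *)
Definition dquot (psi : V -> R) (h : R) p : R :=
  (psi (h *: et R N + p) - psi p) / h +
  \sum_(i < N) (psi (h *: ex R i + p) - 2 * psi p + psi (- h *: ex R i + p)) / h ^+ 2.

Lemma dist_lt_le (x y e : R) : `|x - y| < e -> y - e <= x /\ x <= y + e.
Proof. by rewrite ltr_norml => /andP[? ?]; split; lra. Qed.

Lemma ball_exet p0 p (r s : R) : ball p0 (r / 2) p -> `|s| < r / 2 ->
  ball p0 r (s *: et R N + p) /\ forall i, ball p0 r (s *: ex R i + p).
Proof.
move=> [b1 b2] sr; have r0 : 0 < r / 2 := le_lt_trans (normr_ge0 _) sr.
have rE : r = r / 2 + r / 2 by exact: splitr.
split=> [|i]; split => /=.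
- rewrite scaler0 add0r; apply: le_ball b1; lra.
- rewrite rE; apply: ball_triangle b2 _; rewrite /ball/= [s *: 1]mulr1.
  by rewrite opprD addrCA subrr addr0 normrN.
- rewrite rE; apply: ball_triangle b1 _; apply/(ball_rVP _ _ r0) => j.
  rewrite !mxE opprD addrCA subrr addr0 normrN; apply: le_lt_trans sr.
  by rewrite normrM; case: (_ && _); rewrite ?normr1 ?mulr1// normr0 mulr0.
- rewrite [s *: 0]mulr0 add0r; apply: le_ball b2; lra.
Qed.

(* Uniform in p near p0, which is what compactness will turn into a single h. *)
Lemma dquot_ge O T (psi : V -> R) p0 (e : R) : open O -> C21 O T psi ->
  QT O T p0 -> 0 < e ->
  \forall p \near p0 & h \near (0 : R)^'+,
    [/\ QT O T (h *: et R N + p),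
       forall i, QT O T (h *: ex R i + p) /\ QT O T (- h *: ex R i + p)
     & heatop psi p - e <= dquot psi h p].
Proof.
move=> oO [_ [dpt [ct [dpx [_ [dpxx cxx]]]]]] Q0 e0.
(* One time derivative and N second derivatives each err twice, in passing from p to p0 and from p0
   to the quotient: 2(N + 1) e' = e. *)
pose e' := e / 2 / N.+1%:R.
have e'0 : 0 < e' by rewrite !divr_gt0.
have nQ : nbhs p0 (QT O T) by apply: open_nbhs_nbhs; split => //; exact: open_QT.
have nt := cont_ext_near oO ct Q0 e'0.
have nx : \forall q \near p0, forall i, `|dx i (dx i psi) q - dx i (dx i psi) p0| < e'.
  have nxi i := cont_ext_near oO (cxx i i) Q0 e'0.
  exact: filter_forall nxi.
have /nbhs_ballP[r /= r0 rP] : nbhs p0 (QT O T `&`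
    ([set q | `|dt psi q - dt psi p0| < e'] `&`
     [set q | forall i, `|dx i (dx i psi) q - dx i (dx i psi) p0| < e'])).
  exact: filterI nQ (filterI nt nx).
have r20 : 0 < r / 2 by rewrite divr_gt0.
exists (ball p0 (r / 2), [set h : R | 0 < h < r / 2]) => /=.
  split; first exact: nbhsx_ballx.
  near=> h; apply/andP; split; near: h; [exact: nbhs_right_gt|exact: nbhs_right_lt].
move=> [p h] [/= pr /andP[h0 hr]].
have absh s : - h <= s <= h -> `|s| < r / 2.
  by move=> /andP[s0 sh]; rewrite ltr_norml; apply/andP; split; lra.
have hh : - h <= h <= h by apply/andP; split; lra.
have nhh : - h <= - h <= h by apply/andP; split; lra.
have Bt s : - h <= s <= h -> ball p0 r (s *: et R N + p).
  by move=> /absh sr; have [] := ball_exet pr sr.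
have Bx i s : - h <= s <= h -> ball p0 r (s *: ex R i + p).
  by move=> /absh sr; have [_] := ball_exet pr sr.
have Pp : ball p0 r p by apply: le_ball pr; lra.
split.
- by have [] := rP _ (Bt _ hh).
- by move=> i; split; [have [] := rP _ (Bx i _ hh)|have [] := rP _ (Bx i _ nhh)].
have tge : dt psi p0 - e' <= (psi (h *: et R N + p) - psi p) / h.
  rewrite ler_pdivlMr//.
  have := @first_difference_ge R (fun s => psi (s *: et R N + p))
    (fun s => dt psi (s *: et R N + p)) h (dt psi p0 - e') h0.
  have sP s : 0 <= s <= h -> - h <= s <= h.
    by move=> /andP[s0 sh]; apply/andP; split; lra.
  rewrite scale0r add0r; apply => s /sP sh.
    apply: is_derive_line; apply: derivableP; apply: dpt.
    by have [] := rP _ (Bt s sh).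
  have [_ [/= hs _]] := rP _ (Bt s sh).
  by have [] := dist_lt_le hs.
have xge i : dx i (dx i psi) p0 - e' <=
    (psi (h *: ex R i + p) - 2 * psi p + psi (- h *: ex R i + p)) / h ^+ 2.
  rewrite ler_pdivlMr ?exprn_gt0//.
  have := @second_difference_ge R (fun s => psi (s *: ex R i + p))
    (fun s => dx i psi (s *: ex R i + p))
    (fun s => dx i (dx i psi) (s *: ex R i + p)) h (dx i (dx i psi) p0 - e') h0.
  rewrite scale0r add0r; apply => s sh.
  - apply: is_derive_line; apply: derivableP; apply: dpx.
    by have [] := rP _ (Bx i s sh).
  - apply: is_derive_line; apply: derivableP; apply: dpxx.
    by have [] := rP _ (Bx i s sh).
  - have [_ [_ /= /(_ i) hs]] := rP _ (Bx i s sh).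
    by have [] := dist_lt_le hs.
have pt : dt psi p <= dt psi p0 + e'.
  by have [_ [/= hs _]] := rP _ Pp; have [] := dist_lt_le hs.
have px i : dx i (dx i psi) p <= dx i (dx i psi) p0 + e'.
  by have [_ [_ /= /(_ i) hs]] := rP _ Pp; have [] := dist_lt_le hs.
have lp : lap psi p <= lap psi p0 + N%:R * e'.
  rewrite /lap mulr_natl -[X in _ *+ X]card_ord -sumr_const -big_split/=.
  by apply: ler_sum => i _; exact: px.
have lq : lap psi p0 - N%:R * e' <= \sum_(i < N)
    (psi (h *: ex R i + p) - 2 * psi p + psi (- h *: ex R i + p)) / h ^+ 2.
  rewrite /lap mulr_natl -[X in _ *+ X]card_ord -sumr_const -sumrB.
  by apply: ler_sum => i _; exact: xge.
have ee : e' + N%:R * e' = e / 2.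
  by rewrite -[X in X + _]mul1r -mulrDl addrC natr1 /e' mulrC divfK.
rewrite /heatop /dquot; move: tge pt lp lq ee e0.
move: (dt psi p) (dt psi p0) (lap psi p) (lap psi p0) (N%:R * e') (_ / h) (\sum_(i < N) _).
move=> *; lra.
Unshelve. all: by end_near. Qed.

End local_estimate.

(** * Truncation of psi and its mass *)

Section truncation.
Context {R : realType} (N : nat).
Local Notation V := ('rV[R]_N * R)%type.
Variables (O : set 'rV[R]_N) (T : R) (psi : V -> R).
Hypotheses (oO : open O) (bO : bounded_set O) (T0 : 0 < T).
Hypothesis Cpsi : C21_l0 O T psi.

Definition clip (t : R) : R := Num.min (Num.max t 0) T.

Lemma clip_itv t : 0 <= clip t <= T.
Proof.
rewrite /clip ge_min lexx orbT andbT.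
by rewrite le_min le_max lexx orbT/= ltW.
Qed.

Lemma clip_id t : 0 <= t <= T -> clip t = t.
Proof. by move=> /andP[t0 tT]; rewrite /clip max_l// min_l. Qed.

Lemma continuous_clip : continuous clip.
Proof.
apply: min_fun_continuous; last exact: cst_continuous.
by apply: max_fun_continuous => t; [exact: cvg_id|exact: cvg_cst].
Qed.

(* (psi - eta)^+ vanishes near the lateral boundary, hence its extension by 0 is
   continuous; [clip] makes it constant in time outside [0, T]. *)
Definition trunc (eta : R) (p : V) : R :=
  \1_O p.1 * Num.max (psi (p.1, clip p.2) - eta) 0.

Lemma trunc_ge0 eta p : 0 <= trunc eta p.
Proof. by rewrite mulr_ge0// le_max lexx orbT. Qed.

Lemma truncE eta x t : O x -> 0 <= t <= T ->
  trunc eta (x, t) = Num.max (psi (x, t) - eta) 0.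
Proof. by move=> Ox tT; rewrite /trunc indicE mem_set// mul1r/= clip_id. Qed.

Lemma trunc_out eta p : ~ O p.1 -> trunc eta p = 0.
Proof. by move=> nO; rewrite /trunc indicE memNset// mul0r. Qed.

Lemma continuous_trunc eta : 0 < eta -> continuous (trunc eta).
Proof.
move=> eta0 p0.
have [[cpsi _] [psi0 _]] := Cpsi.
have [clp0|nclp0] := pselect (closure O p0.1); last first.
  rewrite /prop_for/continuous_at trunc_out; last by move/subset_closure.
  have : \forall p \near p0, (~` closure O) p.1.
    have : nbhs p0.1 (~` closure O).
      apply: open_nbhs_nbhs; split => //.
      exact: closed_openC (@closed_closure _ O).
    exact: cvg_fst.
  move=> h; apply: cvg_near_cst; apply: filterS h => p np.
  by rewrite trunc_out// => /subset_closure.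
pose f (p : V) := Num.max (psi (p.1, clip p.2) - eta) 0.
have fE p : closure O p.1 -> trunc eta p = f p.
  move=> clp; have [Op|nOp] := pselect (O p.1).
    by rewrite /trunc indicE mem_set// mul1r.
  rewrite trunc_out// /f psi0//; last exact: clip_itv.
  by rewrite sub0r max_r// oppr_le0 ltW.
apply/cvgrPdist_lt => e e0.
pose c (p : V) : V := (p.1, clip p.2).
have cc : c @ p0 --> c p0.
  have h1 : (fun p : V => p.1) @ p0 --> p0.1 by exact: cvg_fst.
  have h2 : (fun p : V => clip p.2) @ p0 --> clip p0.2.
    by apply: (@continuous_comp _ _ _ snd clip); [exact: cvg_snd|exact: continuous_clip].
  exact: cvg_pair h1 h2.
have Qc : QTbar O T (c p0) by split => //; exact: clip_itv.
have := (subspace_continuousP _ _).1 cpsi _ Qc.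
move=> /cvgrPdist_lt/(_ e e0) nf.
have nf' : \forall p \near p0, QTbar O T (c p) -> `|psi (c p0) - psi (c p)| < e.
  exact: cc nf.
have fdist p : `|psi (c p0) - psi (c p)| < e -> `|f p0 - f p| < e.
  rewrite /f !ltr_norml => /andP[h1 h2].
  have [a|a] := leP (psi (p0.1, clip p0.2) - eta) 0;
  have [b|b] := leP (psi (p.1, clip p.2) - eta) 0;
  by apply/andP; split; rewrite /c in h1 h2; lra.
have [Op0|nOp0] := pselect (O p0.1).
  have nO : \forall p \near p0, O p.1.
    have : nbhs p0.1 O by exact: open_nbhs_nbhs.
    exact: cvg_fst.
  apply: filterS (filterI nf' nO) => p [hp Op].
  rewrite fE// fE//; last exact: subset_closure.
  by apply: fdist; apply: hp; split; [exact: subset_closure|exact: clip_itv].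
(* At a boundary point neighbours in the closure are handled by f; at exterior ones both values are
   0. *)
apply: filterS nf' => p hp.
have [clp|nclp] := pselect (closure O p.1).
  rewrite fE// fE//.
  by apply: fdist; apply: hp; split => //; exact: clip_itv.
by rewrite !trunc_out// ?subrr ?normr0// => /subset_closure.
Qed.

End truncation.

Lemma continuous_measurable_rV (R : realType) n (g : 'rV[R]_n -> R) :
  continuous g -> measurable_fun [set: 'rV[R]_n] g.
Proof.
move=> /continuousP cg; apply: (measurability _ (RGenOpens.measurableE R)).
move=> _ [_ [a [b ->] <-]]; rewrite setTI; apply: open_measurable_rV.
by apply: cg; exact: interval_open.
Qed.

Section mass.
Context {R : realType} (N : nat).
Local Notation V := ('rV[R]_N * R)%type.
Variables (O : set 'rV[R]_N) (T : R) (psi : V -> R).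
Hypotheses (oO : open O) (bO : bounded_set O) (T0 : 0 < T).
Hypothesis Cpsi : C21_l0 O T psi.
Variable eta : R.
Hypothesis eta0 : 0 < eta.
Local Notation w := (trunc O T psi eta).

Let cw : continuous w. Proof. exact: continuous_trunc. Qed.
Let mO : measurable O. Proof. exact: open_measurable_rV. Qed.
Let L : R := fine (leb N O).
Let Ofin : leb N O \is a fin_num. Proof. exact: leb_bounded_fin. Qed.

Lemma measurable_trunc_slice t :
  measurable_fun [set: 'rV[R]_N] (fun x => w (x, t)).
Proof.
apply: continuous_measurable_rV => x.
have h1 : (fun x : 'rV[R]_N => x) @ x --> x by exact: cvg_id.
have h2 : (fun x : 'rV[R]_N => t) @ x --> t by exact: (@cst_continuous _ _ t x).
have h3 : (fun x : 'rV[R]_N => (x, t)) @ x --> (x, t) by exact: cvg_pair h1 h2.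
by apply: (@continuous_comp _ _ _ (fun x : 'rV[R]_N => (x, t)) w); [exact: h3|exact: cw].
Qed.

Let mwE t : measurable_fun [set: 'rV[R]_N] (fun x => (w (x, t))%:E).
Proof. by apply/measurable_EFinP; exact: measurable_trunc_slice. Qed.

Definition mass (t : R) : \bar R := (\int[leb N]_x (w (x, t))%:E)%E.

Lemma mass_ge0 t : (0 <= mass t)%E.
Proof. by apply: integral_ge0 => x _; rewrite lee_fin trunc_ge0. Qed.

(** Available because the truncation is extended by 0 to all of R^N. *)
Lemma mass_shift v t : (\int[leb N]_x (w (v + x, t))%:E)%E = mass t.
Proof.
have w0 x : (0 <= (w (x, t))%:E)%E by rewrite lee_fin trunc_ge0.
have := integral_leb_affine v (oner_neq0 R) (mwE t) w0.
rewrite normr1 expr1n invr1 mul1e /mass => <-.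
by apply: eq_integral => x _; rewrite scale1r addrC.
Qed.

Let compactQ : compact (closure O `*` `[0, T]%classic).
Proof. by apply: compact_setX; [exact: compact_closure_rV|exact: segment_compact]. Qed.

Lemma trunc_bounded : exists2 B, 0 <= B & forall p, w p <= B * \1_O p.1.
Proof.
have [M [_ hM]] := compact_bounded (continuous_compact (continuous_subspaceT cw) compactQ).
exists (`|M| + 1); first by rewrite addr_ge0.
move=> p; rewrite indicE; have [Op|nOp] := boolP (p.1 \in O); last first.
  by rewrite mulr0 trunc_out//; move: nOp; rewrite notin_setE.
rewrite mulr1; have -> : w p = w (p.1, clip T p.2).
  by rewrite /trunc/= (clip_id (clip_itv T0 _)).
apply: le_trans (ler_norm _) _; apply: hM; first by rewrite (le_lt_trans (ler_norm _))// ltrDl.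
exists (p.1, clip T p.2) => //; split => /=; last by rewrite in_itv/= clip_itv.
by apply: subset_closure; rewrite inE in Op.
Qed.

Lemma mass_bounded : exists B : R, forall t, (mass t <= B%:E)%E.
Proof.
have [B B0 wB] := trunc_bounded; exists (B * L) => t.
rewrite EFinM fineK// -leb_indic// -ge0_integralZl_EFin//; last first.
  by apply/measurable_EFinP; exact: measurable_indic.
apply: le_integral_nonmeas => x _; first by rewrite lee_fin trunc_ge0.
by rewrite -EFinM lee_fin (wB (x, t)).
Qed.

Lemma mass_fin t : mass t \is a fin_num.
Proof.
have [B /(_ t) tB] := mass_bounded.
by rewrite ge0_fin_numE ?mass_ge0// (le_lt_trans tB)// ltry.
Qed.

(** Uniform continuity from compactness of the closed cylinder, in a form that lets t' leave
    [0, T]. *)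
Lemma trunc_unif_time (e : R) : 0 < e ->
  exists2 d, 0 < d & forall x t t', 0 <= t <= T -> `|t - t'| < d ->
    `|w (x, t) - w (x, t')| < e.
Proof.
move=> e0; have e20 : 0 < e / 2 by rewrite divr_gt0.
have : \forall d \near (0 : R)^'+, closure O `*` `[0, T]%classic `<=`
    [set p | forall t', `|p.2 - t'| < d -> `|w p - w (p.1, t')| < e].
  apply: ((compact_near_coveringP _).1 compactQ) => p0 _.
  have : nbhs p0 [set q | `|w p0 - w q| < e / 2].
    have wp0 : w @ p0 --> w p0 by exact: cw.
    by move/cvgrPdist_lt : wp0 => /(_ _ e20).
  move=> /nbhs_ballP[r /= r0 rP]; have r20 : 0 < r / 2 by rewrite divr_gt0.
  exists (ball p0 (r / 2), [set d : R | d < r / 2]) => /=.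
    by split; [exact: nbhsx_ballx|exact: nbhs_right_lt].
  move=> [p d] [/= [b1 b2] dr] t' pt.
  have Pp : ball p0 r p by split; [apply: le_ball b1|apply: le_ball b2]; lra.
  have Pp' : ball p0 r (p.1, t').
    split => /=; first by apply: le_ball b1; lra.
    rewrite [r]splitr; apply: ball_triangle b2 _.
    by rewrite /ball/= (lt_trans pt).
  have := rP _ Pp; have := rP _ Pp'; rewrite /= !ltr_norml.
  by move=> /andP[? ?] /andP[? ?]; apply/andP; split; lra.
move=> h; have [d [d0 dP]] : exists d, 0 < d /\
    closure O `*` `[0, T]%classic `<=`
    [set p | forall t', `|p.2 - t'| < d -> `|w p - w (p.1, t')| < e].
  by apply: (@filter_ex _ ((0 : R)^'+)); apply: filterI h; exact: nbhs_right_gt.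
exists d => // x t t' tT tt'.
have [Ox|nOx] := pselect (O x); last by rewrite !trunc_out// subrr normr0.
by apply: (dP (x, t)) => //; split => /=; [exact: subset_closure|rewrite in_itv].
Qed.

Lemma mass_unif (e : R) : 0 < e ->
  exists2 d, 0 < d & forall t t', 0 <= t <= T -> `|t - t'| < d ->
    fine (mass t) <= fine (mass t') + e * L.
Proof.
move=> e0; have [d d0 dP] := trunc_unif_time e0; exists d => // t t' tT tt'.
rewrite -lee_fin EFinD EFinM !fineK ?mass_fin//.
rewrite -leb_indic// -ge0_integralZl_EFin//; last 2 first.
- by apply/measurable_EFinP; exact: measurable_indic.
- exact: ltW.
have mI : measurable_fun [set: 'rV[R]_N] (fun x => e%:E * (\1_O x)%:E)%E.
  by apply/measurable_EFinP; apply: measurable_funM => //; exact: measurable_indic.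
rewrite -ge0_integralD//; [|by move=> x _; rewrite lee_fin trunc_ge0
  |by move=> x _; rewrite -EFinM lee_fin mulr_ge0// ltW].
apply: le_integral_nonmeas => x _; first by rewrite lee_fin trunc_ge0.
rewrite -EFinM -EFinD lee_fin indicE; have [Ox|nOx] := boolP (x \in O).
  by have := dP x t t' tT tt'; rewrite ltr_norml mulr1 => /andP[? ?]; lra.
have nO : ~ O x by move: nOx; rewrite notin_setE.
by rewrite (trunc_out _ _ _ (p := (x, t)) nO) (trunc_out _ _ _ (p := (x, t')) nO) mulr0 addr0.
Qed.

Lemma mass_end : mass T = 0%E.
Proof.
have [_ [_ psiT]] := Cpsi; apply: integral0_eq => x _.
have [Ox|nOx] := pselect (O x); last by rewrite trunc_out.
rewrite truncE//; last by rewrite lexx ltW.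
by rewrite psiT ?sub0r ?max_r// ?oppr_le0 ?ltW//; exact: subset_closure.
Qed.

Lemma mass_start (K : set 'rV[R]_N) : measurable K -> K `<=` O ->
  (forall x, K x -> 1 <= psi (x, 0)) -> eta <= 1 ->
  ((1 - eta)%:E * leb N K <= mass 0)%E.
Proof.
move=> mK KO psi1 eta1; rewrite -leb_indic// -ge0_integralZl_EFin//; last 2 first.
- by apply/measurable_EFinP; exact: measurable_indic.
- by rewrite subr_ge0.
apply: le_integral_nonmeas => x _.
  by rewrite -EFinM lee_fin mulr_ge0// subr_ge0.
rewrite -EFinM lee_fin indicE; have [Kx|nKx] := boolP (x \in K); last first.
  by rewrite mulr0 trunc_ge0.
rewrite inE in Kx; rewrite mulr1.
have -> : w (x, 0) = Num.max (psi (x, 0) - eta) 0.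
  by apply: truncE; [exact: KO|rewrite lexx ltW].
by rewrite le_max lerB// psi1.
Qed.

Definition density (t : R) : \bar R :=
  iter_int (fun x : 'rV[R]_N => (\1_O x * `|dt psi (x, t) + lap psi (x, t)|)%:E).

Local Notation dlt i := (delta_mx ord0 i : 'rV[R]_N).

Lemma trunc_ge_psi q : QT O T q -> psi q - eta <= w q.
Proof.
case: q => x t [/= Ox /andP[t0 tT]].
by rewrite truncE ?le_max ?lexx// (ltW t0) ltW.
Qed.

(* Discrete Kato inequality: where trunc > 0 it equals psi - eta, and elsewhere it is
   at least psi - eta, so its difference quotients dominate those of psi. *)
Lemma trunc_difference (a b e : R) : 0 < a -> b < T -> 0 < e ->
  \forall h \near (0 : R)^'+, forall x t, a <= t <= b ->
    w (x, t) / h + \sum_(i < N) 2 * w (x, t) / h ^+ 2 <=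
    w (x, h + t) / h +
    \sum_(i < N) (w (h *: dlt i + x, t) + w (- h *: dlt i + x, t)) / h ^+ 2 +
    \1_O x * (`|dt psi (x, t) + lap psi (x, t)| + e).
Proof.
move=> a0 bT e0; have eta20 : 0 < eta / 2 by rewrite divr_gt0.
(* The condition w2 >= eta/2 means psi >= eta, so S contains every point with t in [a, b] where the
   truncation is positive. It is closed because w2 is continuous everywhere, and lies inside Omega
   because w2 vanishes elsewhere. *)
pose w2 := trunc O T psi (eta / 2).
have cw2 : continuous w2 by exact: continuous_trunc.
pose S : set V := (closure O `*` `[a, b]%classic) `&` [set p | eta / 2 <= w2 p].
have cS : compact S.
  apply: (@subclosed_compact _ _ (closure O `*` `[a, b]%classic)) => //.
  - apply: closedI.
      have -> : closure O `*` `[a, b]%classic =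
          (fst @^-1` closure O) `&` (snd @^-1` `[a, b]%classic) by [].
      apply: closedI.
        apply: preimage_closed; last exact: closed_closure.
        by move=> p _; exact: cvg_fst.
      apply: preimage_closed; last exact: interval_closed.
      by move=> p _; exact: cvg_snd.
    apply: (@preimage_closed _ _ w2 [set r | eta / 2 <= r]).
      by move=> p _; exact: cw2.
    exact: closed_ge.
  - by apply: compact_setX; [exact: compact_closure_rV|exact: segment_compact].
  - by move=> p [].
have SQ : S `<=` QT O T.
  move=> [x t] [[/= clx]]; rewrite in_itv/= => /andP[ta tb] wx; split => /=.
    by apply: contrapT => nOx; move: wx; rewrite /w2 trunc_out// leNgt eta20.
  by rewrite (lt_le_trans a0 ta) (le_lt_trans tb bT).
have [Cp _] := Cpsi.
have : \forall h \near (0 : R)^'+, S `<=` [set p | [/\ QT O T (h *: et R N + p),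
       forall i, QT O T (h *: ex R i + p) /\ QT O T (- h *: ex R i + p)
     & heatop psi p - e <= dquot psi h p]].
  by apply: ((compact_near_coveringP S).1 cS) => p /SQ Qp; exact: dquot_ge Cp Qp e0.
move=> nS; near=> h => x t tab.
have h0 : 0 < h by near: h; exact: nbhs_right_gt.
have hS : S `<=` [set p | [/\ QT O T (h *: et R N + p),
       forall i, QT O T (h *: ex R i + p) /\ QT O T (- h *: ex R i + p)
     & heatop psi p - e <= dquot psi h p]] by near: h.
have rhs0 : 0 <= w (x, h + t) / h +
    \sum_(i < N) (w (h *: dlt i + x, t) + w (- h *: dlt i + x, t)) / h ^+ 2 +
    \1_O x * (`|dt psi (x, t) + lap psi (x, t)| + e).
  rewrite addr_ge0 ?addr_ge0//.
  - by rewrite divr_ge0 ?trunc_ge0// ltW.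
  - apply: sumr_ge0 => i _; rewrite divr_ge0 ?addr_ge0 ?trunc_ge0//.
    by rewrite exprn_ge0// ltW.
  - by rewrite mulr_ge0// addr_ge0// ltW.
have [w0|w0] := leP (w (x, t)) 0.
  have -> : w (x, t) = 0 by apply/eqP; rewrite eq_le w0 trunc_ge0.
  rewrite mul0r add0r big1// => i _; by rewrite mulr0 mul0r.
have Ox : O x.
  by apply: contrapT => nOx; move: w0; rewrite trunc_out// ltxx.
have tT : 0 <= t <= T.
  have /andP[ta tb] := tab.
  by rewrite (le_trans (ltW a0) ta) (le_trans tb (ltW bT)).
have psi_eta : w (x, t) = psi (x, t) - eta.
  rewrite truncE//; move: w0; rewrite truncE// lt_max ltxx orbF => h1.
  by rewrite max_l// ltW.
have Sxt : S (x, t).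
  split; first by split => /=; [exact: subset_closure|rewrite in_itv].
  rewrite /= /w2 truncE// le_max; apply/orP; left.
  by rewrite psi_eta in w0; lra.
have [Qt Qx dq] := hS _ Sxt.
have Et : h *: et R N + (x, t) = (x, h + t).
  by congr pair; rewrite /= ?scaler0 ?add0r// [h *: 1]mulr1.
have Ex k i : k *: ex R i + (x, t) = (k *: dlt i + x, t).
  by congr pair; rewrite /= [k *: 0]mulr0 add0r.
move: dq; rewrite /dquot /heatop Et.
have wt : psi (x, h + t) - eta <= w (x, h + t).
  by apply: trunc_ge_psi; rewrite -Et.
move=> dq; rewrite indicE mem_set// mul1r psi_eta.
have sumle : \sum_(i < N) (psi (h *: ex R i + (x, t)) - 2 * psi (x, t) +
      psi (- h *: ex R i + (x, t))) / h ^+ 2 <=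
    \sum_(i < N) (w (h *: dlt i + x, t) + w (- h *: dlt i + x, t)) / h ^+ 2 -
    \sum_(i < N) 2 * (psi (x, t) - eta) / h ^+ 2.
  rewrite -sumrB; apply: ler_sum => i _; rewrite -mulrBl ler_wpM2r ?invr_ge0 ?exprn_ge0 ?(ltW h0)//.
  have [/trunc_ge_psi w1 /trunc_ge_psi w2'] := Qx i.
  by rewrite !Ex in w1 w2' *; lra.
have tle : (psi (x, h + t) - psi (x, t)) / h <=
    w (x, h + t) / h - (psi (x, t) - eta) / h.
  by rewrite -mulrBl ler_wpM2r ?invr_ge0 ?(ltW h0)//; lra.
have hn := ler_norm (- (dt psi (x, t) + lap psi (x, t))); rewrite normrN in hn.
have arith (A S1 W S2 f P S0 d : R) : d - e <= P + S0 -> S0 <= S2 - S1 ->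
    P <= W - A -> - d <= f -> A + S1 <= W + S2 + (f + e) by lra.
exact: arith dq sumle tle hn.
Unshelve. all: by end_near. Qed.

End mass.

Section nonneg_real_integral.
Context d (X : measurableType d) (R : realType).
Variable mu : {measure set X -> \bar R}.
Local Open Scope ereal_scope.

Lemma ge0_integral_EFinD (f g : X -> R) :
  measurable_fun [set: X] f -> measurable_fun [set: X] g ->
  (forall x, 0 <= f x)%R -> (forall x, 0 <= g x)%R ->
  \int[mu]_x (f x + g x)%:E = \int[mu]_x (f x)%:E + \int[mu]_x (g x)%:E.
Proof.
move=> mf mg f0 g0; rewrite -ge0_integralD//.
- by move=> x _; rewrite lee_fin.
- exact/measurable_EFinP.
- by move=> x _; rewrite lee_fin.
- exact/measurable_EFinP.
Qed.

Lemma ge0_integral_EFinZ (f : X -> R) (c : R) :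
  measurable_fun [set: X] f -> (forall x, 0 <= f x)%R -> (0 <= c)%R ->
  \int[mu]_x (f x * c)%:E = \int[mu]_x (f x)%:E * c%:E.
Proof.
move=> mf f0 c0; under eq_integral do rewrite mulrC EFinM.
rewrite ge0_integralZl_EFin//; first by rewrite muleC.
  by move=> x _; rewrite lee_fin.
exact/measurable_EFinP.
Qed.

Lemma ge0_integral_EFin_sum (I : Type) (s : seq I) (f : I -> X -> R) :
  (forall i, measurable_fun [set: X] (f i)) -> (forall i x, 0 <= f i x)%R ->
  \int[mu]_x (\sum_(i <- s) f i x)%:E = \sum_(i <- s) \int[mu]_x (f i x)%:E.
Proof.
move=> mf f0; elim: s => [|i s ih].
  by rewrite big_nil; apply: integral0_eq => x _; rewrite big_nil.
rewrite big_cons -ih -ge0_integral_EFinD//.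
- by apply: eq_integral => x _; rewrite big_cons.
- exact: measurable_sum.
- by move=> x; exact: sumr_ge0.
Qed.

End nonneg_real_integral.

(** * Decay of the mass bounded by the energy density *)

Section mass_decay.
Context {R : realType} (N : nat).
Local Notation V := ('rV[R]_N * R)%type.
Variables (O : set 'rV[R]_N) (T : R) (psi : V -> R).
Hypotheses (oO : open O) (bO : bounded_set O) (T0 : 0 < T).
Hypothesis Cpsi : C21_l0 O T psi.
Variable eta : R.
Hypothesis eta0 : 0 < eta.
Local Notation w := (trunc O T psi eta).
Let L : R := fine (leb N O).
Let m (t : R) : R := fine (mass O T psi eta t).
Local Notation dlt i := (delta_mx ord0 i : 'rV[R]_N).

Let mE t : mass O T psi eta t = (m t)%:E.
Proof. by rewrite fineK// mass_fin. Qed.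

Let m0 t : 0 <= m t.
Proof. by rewrite fine_ge0// mass_ge0. Qed.

Let mO : measurable O. Proof. exact: open_measurable_rV. Qed.
Let Ofin : leb N O \is a fin_num. Proof. exact: leb_bounded_fin. Qed.

Let mw t : measurable_fun [set: 'rV[R]_N] (fun x => w (x, t)).
Proof. exact: measurable_trunc_slice. Qed.

Let mws v t : measurable_fun [set: 'rV[R]_N] (fun x => w (v + x, t)).
Proof.
have h := @measurable_affine_rV R N 1 v.
rewrite (_ : (fun x => _) = (fun x => w (x, t)) \o (fun x => 1 *: x + v)).
  exact: measurableT_comp (mw t) h.
by apply/funext => x /=; rewrite scale1r addrC.
Qed.

(* Integrating trunc_difference over x: translation invariance cancels the second
   differences in space, so no integration by parts is needed. *)
Lemma density_ge (a b e : R) : 0 < a -> b < T -> 0 < e ->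
  \forall h \near (0 : R)^'+, forall t, a <= t <= b ->
    (((m t - m (h + t)) / h - e * L)%:E <= density O psi t)%E.
Proof.
move=> a0 bT e0; have nh := trunc_difference oO bO T0 Cpsi eta0 a0 bT e0.
near=> h => t tab.
have h0 : 0 < h by near: h; exact: nbhs_right_gt.
have hP : forall x t, a <= t <= b ->
    w (x, t) / h + \sum_(i < N) 2 * w (x, t) / h ^+ 2 <=
    w (x, h + t) / h +
    \sum_(i < N) (w (h *: dlt i + x, t) + w (- h *: dlt i + x, t)) / h ^+ 2 +
    \1_O x * (`|dt psi (x, t) + lap psi (x, t)| + e) by near: h.
have w0 p : 0 <= w p by exact: trunc_ge0.
have h20 : 0 <= (h ^+ 2)^-1 by rewrite invr_ge0 exprn_ge0// ltW.
have h10 : 0 <= h^-1 by rewrite invr_ge0 ltW.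
pose c := h^-1 + N%:R * (2 * (h ^+ 2)^-1).
have c0 : 0 <= c by rewrite addr_ge0// mulr_ge0// mulr_ge0.
pose A x := w (x, t) * c.
pose B1 x := w (x, h + t) * h^-1.
pose B2 x := \sum_(i < N) (w (h *: dlt i + x, t) + w (- h *: dlt i + x, t)) * (h ^+ 2)^-1.
pose B3 x : R := \1_O x * e.
(* A measurable nonnegative minorant of the integrand of [density]: for it the iterated integral is
   an integral against [leb]. *)
pose k x := Num.max (A x - (B1 x + B2 x + B3 x)) 0.
have mI : measurable_fun [set: 'rV[R]_N] (\1_O : 'rV[R]_N -> R).
  exact: measurable_indic.
have mA : measurable_fun [set: 'rV[R]_N] A by exact: measurable_funM.
have mB1 : measurable_fun [set: 'rV[R]_N] B1 by exact: measurable_funM.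
have mB2 : measurable_fun [set: 'rV[R]_N] B2.
  apply: measurable_sum => i; apply: measurable_funM => //.
  exact: measurable_funD.
have mB3 : measurable_fun [set: 'rV[R]_N] B3 by exact: measurable_funM.
have mB : measurable_fun [set: 'rV[R]_N] (fun x => B1 x + B2 x + B3 x).
  by apply: measurable_funD => //; exact: measurable_funD.
have mk : measurable_fun [set: 'rV[R]_N] k.
  by apply: measurable_maxr => //; exact: measurable_funB.
have A0 x : 0 <= A x by exact: mulr_ge0.
have B10 x : 0 <= B1 x by exact: mulr_ge0.
have B20 x : 0 <= B2 x.
  by apply: sumr_ge0 => i _; rewrite mulr_ge0// addr_ge0.
have B30 x : 0 <= B3 x by rewrite mulr_ge0// ltW.
have k0 x : 0 <= k x by rewrite le_max lexx orbT.
have kle : (\int[leb N]_x (k x)%:E <= density O psi t)%E.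
  rewrite -iter_int_leb; [|exact/measurable_EFinP|by move=> x; rewrite lee_fin].
  apply: le_iter_int => x; first by rewrite lee_fin.
  rewrite lee_fin ge_max; apply/andP; split; last by rewrite mulr_ge0.
  have := hP x t tab; rewrite sumr_const card_ord -[_ *+ N]mulr_natl => hx.
  have -> : A x = w (x, t) / h + N%:R * (2 * w (x, t) / h ^+ 2).
    by rewrite /A /c; ring.
  have -> : \1_O x * `|dt psi (x, t) + lap psi (x, t)| =
     \1_O x * (`|dt psi (x, t) + lap psi (x, t)| + e) - B3 x by rewrite /B3; ring.
  have arith (p q r z s : R) : p <= q + r + z -> p - (q + r + s) <= z - s by lra.
  exact: arith hx.
apply: le_trans kle.
have iA : (\int[leb N]_x (A x)%:E = (m t * c)%:E)%E.
  by rewrite ge0_integral_EFinZ// -/(mass O T psi eta t) mE.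
have iB1 : (\int[leb N]_x (B1 x)%:E = (m (h + t) * h^-1)%:E)%E.
  by rewrite ge0_integral_EFinZ// -/(mass O T psi eta (h + t)) mE.
have mws2 i : measurable_fun [set: 'rV[R]_N]
    (fun x => w (h *: dlt i + x, t) + w (- h *: dlt i + x, t)).
  exact: measurable_funD.
have ws20 i x : 0 <= w (h *: dlt i + x, t) + w (- h *: dlt i + x, t).
  exact: addr_ge0.
have iB2 : (\int[leb N]_x (B2 x)%:E = (N%:R * (m t * 2 * (h ^+ 2)^-1))%:E)%E.
  rewrite ge0_integral_EFin_sum; last 2 first.
  - by move=> i; apply: measurable_funM => //; exact: measurable_funD.
  - by move=> i x; rewrite mulr_ge0// addr_ge0.
  rewrite (eq_bigr (fun=> (m t * 2 * (h ^+ 2)^-1)%:E)); last first.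
    move=> i _; rewrite (ge0_integral_EFinZ _ (mws2 i))//.
    rewrite (ge0_integral_EFinD _ (mws _ t) (mws _ t))// !(mass_shift oO T0 Cpsi eta0) !mE.
    by rewrite -EFinD -EFinM [m t * 2]mulr_natr mulr2n.
  by rewrite sumEFin sumr_const card_ord mulr_natl.
have iB3 : (\int[leb N]_x (B3 x)%:E = (L * e)%:E)%E.
  rewrite (ge0_integral_EFinZ _ mI) ?ltW//.
  by rewrite leb_indic// EFinM /L fineK.
(* Written as a sum of nonnegative functions, so that the integral splits without integrability;
   subtraction waits until the values are real. *)
have : (\int[leb N]_x (A x)%:E <=
    \int[leb N]_x (B1 x + B2 x + B3 x + k x)%:E)%E.
  apply: le_integral_nonmeas => x _; rewrite lee_fin; first exact: A0.
  by rewrite -lerBlDl le_max lexx.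
have B120 x : 0 <= B1 x + B2 x by exact: addr_ge0.
have B0 x : 0 <= B1 x + B2 x + B3 x by exact: addr_ge0.
have mB12 : measurable_fun [set: 'rV[R]_N] (fun x => B1 x + B2 x) by exact: measurable_funD.
rewrite ge0_integral_EFinD// (ge0_integral_EFinD _ mB12)// (ge0_integral_EFinD _ mB1)//.
rewrite iA iB1 iB2 iB3.
have : (0 <= \int[leb N]_x (k x)%:E)%E by apply: integral_ge0 => x _; rewrite lee_fin.
case: (\int[leb N]_x (k x)%:E)%E => [r _|_ _|//]; last by rewrite leey.
rewrite -!EFinD !lee_fin /c.
have -> : (m t - m (h + t)) / h = m t * h^-1 - m (h + t) * h^-1 by ring.
have arith (x y g n q : R) : x * (g + n * (2 * q)) <= y * g + n * (x * 2 * q) + L * e + r ->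
    x * g - y * g - e * L <= r by move=> H; lra.
exact: arith.
Unshelve. all: by end_near. Qed.

End mass_decay.

(** Telescoping with indicators, where x = m(t), y = m(0) and u bounds the oscillation of m near
    both ends. Sliding [a, b] by h gains ]b, b + h], where m <= u, and loses [a, a + h[, where m >=
    m(0) - u; the half-open ends avoid counting a point twice. *)
Lemma window_shift (R : realDomainType) (a b h t x y u : R) :
  0 <= h -> a + h <= b -> 0 <= x -> 0 <= u ->
  (a <= t -> t < a + h -> y <= x + u) -> (b < t -> t <= b + h -> x <= u) ->
  (a + h <= t <= b + h)%R%:R * x + (a <= t < a + h)%R%:R * y <=
  (a <= t <= b)%R%:R * x + ((a <= t < a + h)%R%:R + (b < t <= b + h)%R%:R) * u.
Proof.
move=> h0 abh x0 u0.
case: (ltP t a) => ta; case: (ltP t (a + h)) => tah; case: (leP t b) => tb;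
  case: (leP t (b + h)) => tbh /=; rewrite ?mul0r ?mul1r ?mul0r ?add0r ?addr0//.
- lra.
all: move=> near0 nearT; try lra.
Qed.

(** Here x and y are the integrals of m over the window and over its shift, z that of the minorant
    of the density, v = m(0). In T + 2 the T bounds b - a and the 2 counts the end windows. *)
Lemma window_estimate (R : realDomainType) (a b T h x y z u v : R) :
  0 <= h -> b - a <= T -> 0 <= u ->
  x <= y + z * h + (b - a) * (h * u) -> y + h * v <= x + (h + h) * u ->
  h * v <= h * z + h * (u * (T + 2)).
Proof.
move=> h0 baT u0 xle yle.
have : (b - a) * (h * u) <= T * (h * u) by rewrite ler_wpM2r// mulr_ge0.
lra.
Qed.

Lemma integral_indic_itv (R : realType) (p q : bool) (x y : R) : x <= y ->
  (\int[@lebesgue_measure R]_t (\1_[set` Interval (BSide p x) (BSide q y)] t)%:E = (y - x)%:E)%E.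
Proof.
move=> xy; rewrite integral_indic//= setIT lebesgue_measure_itv/= lte_fin.
by case: ltgtP xy => // -> _; rewrite subrr.
Qed.

Section mass_initial.
Context {R : realType} (N : nat).
Local Notation V := ('rV[R]_N * R)%type.
Variables (O : set 'rV[R]_N) (T : R) (psi : V -> R).
Hypotheses (oO : open O) (bO : bounded_set O) (T0 : 0 < T).
Hypothesis Cpsi : C21_l0 O T psi.
Variable eta : R.
Hypothesis eta0 : 0 < eta.
Let L : R := fine (leb N O).
Let m (t : R) : R := fine (mass O T psi eta t).
Local Notation mu := (@lebesgue_measure R).

Let mE t : mass O T psi eta t = (m t)%:E.
Proof. by rewrite fineK// mass_fin. Qed.

Let m_ge0 t : 0 <= m t.
Proof. by rewrite fine_ge0// mass_ge0. Qed.

Let L0 : 0 <= L.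
Proof. by rewrite fine_ge0. Qed.

Lemma continuous_mass : continuous m.
Proof.
(* The truncation sees time only through [clip], so estimates on [0, T] suffice. *)
have mclip t : m t = m (clip T t).
  congr fine; apply: eq_integral => x _.
  by rewrite /trunc/= (clip_id (clip_itv T0 _)).
move=> t0; apply/cvgrPdist_lt => e e0.
have L10 : 0 < L + 1 by rewrite ltr_wpDl.
have [d d0 dP] := mass_unif oO bO T0 Cpsi eta0 (divr_gt0 e0 L10).
have eL : e / (L + 1) * L < e.
  by rewrite mulrAC ltr_pdivrMr// ltr_pM2l// ltrDl.
have /cvgrPdist_lt/(_ _ d0) : clip T @ t0 --> clip T t0 by exact: continuous_clip.
apply: filterS => t tt0; rewrite (mclip t0) (mclip t).
have h1 : m (clip T t0) <= m (clip T t) + e / (L + 1) * L by exact: dP (clip_itv T0 t0) tt0.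
rewrite distrC in tt0.
have h2 : m (clip T t) <= m (clip T t0) + e / (L + 1) * L by exact: dP (clip_itv T0 t) tt0.
by rewrite ltr_norml; apply/andP; split; lra.
Qed.

Let mm : measurable_fun [set: R] m.
Proof. exact: continuous_measurable_fun continuous_mass. Qed.

(** For one fixed h, the integral of (m(t) - m(t + h)) / h over [a, b] is the mean of m just after a
    minus its mean just after b, hence close to m(0) - m(T) = m(0). *)
Lemma mass_initial_le : (mass O T psi eta 0 <= cap_energy O T psi)%E.
Proof.
apply/lee_addgt0Pr => e' e'0.
have LT0 : 0 < L * (T + 2) + 1 by rewrite ltr_wpDl// mulr_ge0// addr_ge0// ltW.
(* The total error in [window_estimate] is e L (T + 2). *)
pose e := e' / (L * (T + 2) + 1).
have e0 : 0 < e by rewrite divr_gt0.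
have eLT : e * L * (T + 2) <= e'.
  by rewrite -mulrA /e mulrAC ler_pdivrMr// ler_pM2l// lerDl.
have [d d0 dP] := mass_unif oO bO T0 Cpsi eta0 e0.
(* As h < a, the bound 4a <= d keeps the end windows within d of 0 and of T, where m varies by at
   most e L, and 4a <= T gives a + h <= b. *)
pose a := Num.min d T / 4; pose b := T - a.
have mn0 : 0 < Num.min d T by rewrite lt_min d0.
have a0 : 0 < a by rewrite divr_gt0.
have [ad aT] : 4 * a <= d /\ 4 * a <= T.
  by rewrite /a [4 * _]mulrC divfK// !ge_min !lexx orbT.
have bT : b < T by rewrite ltrBlDr ltrDl.
have [h [[h0 ha] hP]] : exists h : R, (0 < h /\ h < a) /\ forall t, a <= t <= b ->
    (((m t - m (h + t)) / h - e * L)%:E <= density O psi t)%E.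
  apply: (@filter_ex _ ((0 : R)^'+)).
  apply: filterI; last exact: (density_ge oO bO T0 Cpsi eta0 a0 bT e0).
  by apply: filterI; [exact: nbhs_right_gt|exact: nbhs_right_lt].
pose I := \1_(`[a, b]%classic) : R -> R.
pose J1 := \1_(`[a, a + h[%classic) : R -> R.
pose J2 := \1_(`]b, b + h]%classic) : R -> R.
pose F t := I t * m t.
pose G t := I t * m (h + t).
pose g t := \1_(`[a + h, b + h]%classic) t * m t.
pose k t := I t * Num.max ((m t - m (h + t)) / h - e * L) 0.
have bE : b = T - a by [].
have [abh b0 bhT ahd ab] : [/\ a + h <= b, 0 <= b, b + h <= T, a + h <= d & a <= b].
  by rewrite bE; split; lra.
have [Tbd bleT] : T - d < b /\ b - a <= T by rewrite bE; split; lra.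
have [B mB] := mass_bounded oO bO T0 Cpsi eta0.
have mle t : m t <= B by rewrite -lee_fin -mE.
have mshift : measurable_fun [set: R] (fun t => m (h + t)).
  by apply: measurableT_comp mm _; exact: measurable_funD.
have mI : measurable_fun [set: R] I by exact: measurable_indic.
have mJ1 : measurable_fun [set: R] J1 by exact: measurable_indic.
have mJ2 : measurable_fun [set: R] J2 by exact: measurable_indic.
have mF : measurable_fun [set: R] F by exact: measurable_funM.
have mG : measurable_fun [set: R] G by exact: measurable_funM.
have mg : measurable_fun [set: R] g.
  by apply: measurable_funM => //; exact: measurable_indic.
have mk : measurable_fun [set: R] k.
  apply: measurable_funM => //; apply: measurable_maxr => //.
  apply: measurable_funB => //; apply: measurable_funM => //.
  exact: measurable_funB.
have I0 t : 0 <= I t by [].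
have J10 t : 0 <= J1 t by [].
have J20 t : 0 <= J2 t by [].
have F0 t : 0 <= F t by exact: mulr_ge0.
have G0 t : 0 <= G t by exact: mulr_ge0.
have g0 t : 0 <= g t by exact: mulr_ge0.
have k0 t : 0 <= k t by rewrite mulr_ge0// le_max lexx orbT.
have eL0 : 0 <= e * L by rewrite mulr_ge0// ltW.
have kE : (\int[mu]_t (k t)%:E <= cap_energy O T psi)%E.
  rewrite /cap_energy [leRHS]integral_mkcond; apply: le_integral_nonmeas => t _.
    by rewrite lee_fin.
  rewrite /k /I indicE patchE; have [tab|ntab] := boolP (t \in `[a, b]%classic); last first.
    rewrite mul0r; case: ifP => // _; apply: iter_int_ge0 => x.
    by rewrite lee_fin mulr_ge0.
  move: tab; rewrite inE/= in_itv/= => tab.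
  have /andP[ta tb] := tab.
  rewrite mem_set; last by rewrite /QT_itv/= (lt_le_trans a0 ta) (le_lt_trans tb bT).
  rewrite mul1r EFin_max ge_max (hP _ tab)/=; apply: iter_int_ge0 => x.
  by rewrite lee_fin mulr_ge0.
have step1 : (\int[mu]_t (F t)%:E <=
    \int[mu]_t (G t)%:E + \int[mu]_t (k t)%:E * h%:E + \int[mu]_t (I t)%:E * (h * (e * L))%:E)%E.
  have hw := ltW h0; have heL0 : 0 <= h * (e * L) by exact: mulr_ge0.
  have kh0 t : 0 <= k t * h by exact: mulr_ge0.
  have IL0 t : 0 <= I t * (h * (e * L)) by exact: mulr_ge0.
  have Gk0 t : 0 <= G t + k t * h by exact: addr_ge0.
  have mkh : measurable_fun [set: R] (fun t => k t * h) by exact: measurable_funM.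
  have mIL : measurable_fun [set: R] (fun t => I t * (h * (e * L))) by exact: measurable_funM.
  have mGk : measurable_fun [set: R] (fun t => G t + k t * h) by exact: measurable_funD.
  rewrite -(ge0_integral_EFinZ mu mk)// -(ge0_integral_EFinZ mu mI)//.
  rewrite -(ge0_integral_EFinD mu mG mkh)// -(ge0_integral_EFinD mu mGk mIL)//.
  apply: le_integral_nonmeas => t _; rewrite lee_fin//.
  have -> : G t + k t * h + I t * (h * (e * L)) =
     I t * (m (h + t) + (Num.max ((m t - m (h + t)) / h - e * L) 0 + e * L) * h).
    by rewrite /G /k; ring.
  rewrite ler_wpM2l// -lerBlDl -ler_pdivrMr// -lerBlDr.
  by rewrite le_max lexx.
have step2 : (\int[mu]_t (g t)%:E + \int[mu]_t (J1 t)%:E * (m 0)%:E <=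
    \int[mu]_t (F t)%:E + (\int[mu]_t (J1 t)%:E + \int[mu]_t (J2 t)%:E) * (e * L)%:E)%E.
  have mJ1m : measurable_fun [set: R] (fun t => J1 t * m 0) by exact: measurable_funM.
  have mJ : measurable_fun [set: R] (fun t => J1 t + J2 t) by exact: measurable_funD.
  have J0 t : 0 <= J1 t + J2 t by exact: addr_ge0.
  have mJL : measurable_fun [set: R] (fun t => (J1 t + J2 t) * (e * L)) by exact: measurable_funM.
  have JL0 t : 0 <= (J1 t + J2 t) * (e * L) by exact: mulr_ge0.
  have Jm0 t : 0 <= J1 t * m 0 by exact: mulr_ge0.
  rewrite -(ge0_integral_EFinZ mu mJ1)// -(ge0_integral_EFinD mu mg mJ1m)//.
  rewrite -(ge0_integral_EFinD mu mJ1 mJ2)// -(ge0_integral_EFinZ mu mJ)//.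
  rewrite -(ge0_integral_EFinD mu mF mJL)//.
  apply: le_integral_nonmeas => t _; rewrite lee_fin ?addr_ge0//.
  rewrite /g /F /I /J1 /J2 !indicE !mem_setE !in_itv/=.
  have near0 : a <= t -> t < a + h -> m 0 <= m t + e * L.
    move=> ta tah; apply: dP; first by rewrite lexx ltW.
    by rewrite sub0r normrN ger0_norm; [exact: lt_le_trans tah ahd|exact: le_trans (ltW a0) ta].
  have nearT : b < t -> t <= b + h -> m t <= e * L.
    have mT : m T = 0 by rewrite /m mass_end.
    move=> bt tbh; rewrite -[leRHS]add0r -mT; apply: dP.
      by rewrite (le_trans b0 (ltW bt)) (le_trans tbh bhT).
    by rewrite ler0_norm ?subr_le0 ?(le_trans tbh bhT)// opprB ltrBlDr addrC -ltrBlDr (lt_trans Tbd).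
  exact: window_shift (ltW h0) abh (m_ge0 t) eL0 near0 nearT.
have GgE : (\int[mu]_t (G t)%:E = \int[mu]_t (g t)%:E)%E.
  have mgE : measurable_fun [set: R] (EFin \o g) by exact/measurable_EFinP.
  have g0E t : (0 <= (EFin \o g) t)%E by rewrite lee_fin.
  have := integral_lebesgue_affine h (oner_neq0 R) mgE g0E.
  rewrite normr1 invr1 mul1e => <-; apply: eq_integral => t _.
  rewrite /G /g /I /= mul1r [t + h]addrC !indicE !mem_setE !in_itv/=.
  by rewrite ![_ + h]addrC !lerD2l.
have IE : (\int[mu]_t (I t)%:E = (b - a)%:E)%E.
  exact: integral_indic_itv.
have ahE p q c : (\int[mu]_t (\1_[set` Interval (BSide p c) (BSide q (c + h))] t)%:E = h%:E)%E.
  rewrite integral_indic_itv; last by rewrite lerDl; exact: ltW.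
  rewrite addrAC subrr add0r; reflexivity.
have J1E : (\int[mu]_t (J1 t)%:E = h%:E)%E.
  exact: ahE.
have J2E : (\int[mu]_t (J2 t)%:E = h%:E)%E.
  exact: ahE.
(* Finiteness is what allows this integral to be cancelled between [step1] and [step2]. *)
have Ffin : (\int[mu]_t (F t)%:E < +oo)%E.
  apply: (@le_lt_trans _ _ (\int[mu]_t (I t * B)%:E)%E).
    apply: le_integral_nonmeas => t _; rewrite lee_fin; [exact: F0|exact: ler_wpM2l].
  rewrite (ge0_integral_EFinZ mu mI I0 (le_trans (m_ge0 0) (mle 0))) IE -EFinM; exact: ltry.
rewrite mE; move: step1 step2; rewrite -GgE J1E J2E IE.
have : (0 <= \int[mu]_t (G t)%:E)%E by apply: integral_ge0 => t _; rewrite lee_fin.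
have : (0 <= \int[mu]_t (F t)%:E)%E by apply: integral_ge0 => t _; rewrite lee_fin.
have : (0 <= \int[mu]_t (k t)%:E)%E by apply: integral_ge0 => t _; rewrite lee_fin.
move: Ffin kE.
case: (\int[mu]_t (F t)%:E)%E => [x _|//|_ _ _]; last by rewrite leeNy_eq.
case: (\int[mu]_t (k t)%:E)%E => [z|+ _|_]; last by rewrite leeNy_eq.
  2: by rewrite leye_eq => /eqP -> *; exact: leey.
move=> zE _ _; case: (\int[mu]_t (G t)%:E)%E => [y _|_ _|]; last by rewrite leeNy_eq.
  2: by rewrite -EFinM addye// leye_eq.
rewrite -!EFinM -!EFinD !lee_fin => h1 h2.
apply: (@le_trans _ _ (z%:E + e'%:E)%E); last by rewrite leeD2r.
rewrite -EFinD lee_fin -(ler_pM2l h0).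
have h3 : h * (e * L * (T + 2)) <= h * e' by rewrite ler_pM2l.
have zu := window_estimate (ltW h0) bleT eL0 h1 h2.
rewrite [h * (z + _)]mulrDr; apply: le_trans zu _; rewrite lerD2l; exact: h3.
Qed.
End mass_initial.

Lemma leb_le_cap_energy (R : realType) N (O : set 'rV[R]_N) T K psi :
  open O -> bounded_set O -> 0 < T -> compact K -> K `<=` O ->
  admissible O T K psi -> (leb N K <= cap_energy O T psi)%E.
Proof.
move=> oO bO T0 cK KO [Cpsi [U [_ [KU psiU]]]].
have mK : measurable K by exact: compact_measurable_rV.
have Kfin : leb N K \is a fin_num.
  exact: leb_bounded_fin (compact_bounded cK) mK.
have K0 : 0 <= fine (leb N K) by rewrite fine_ge0.
apply/lee_addgt0Pr => e e0.
have L0 : 0 < fine (leb N K) + 1 by rewrite ltr_wpDl.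
(* The truncation loses eta |K| <= e of the initial mass. *)
pose eta := Num.min (e / (fine (leb N K) + 1)) 1.
have eta0 : 0 < eta by rewrite lt_min divr_gt0/=.
have eta1 : eta <= 1 by rewrite ge_min lexx orbT.
have psi1 x : K x -> 1 <= psi (x, 0) by move=> Kx; apply: psiU; [exact: KU|exact: KO].
have hs := mass_start T0 mK KO psi1 eta1.
have := le_trans hs (mass_initial_le oO bO T0 Cpsi eta0).
move=> /(leeD2r e%:E); apply: le_trans.
rewrite -(fineK Kfin) -EFinM -EFinD lee_fin mulrBl mul1r -addrA lerDl addrC subr_ge0.
have le_eta : eta <= e / (fine (leb N K) + 1) by rewrite ge_min lexx.
apply: (le_trans (ler_wpM2r K0 le_eta)).
by rewrite mulrAC ler_pdivrMr// ler_pM2l// lerDl.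
Qed.

Theorem theorem2p22 (R : realType) (N : nat) (Omega : set 'rV[R]_N) (T : R)
  (K : set 'rV[R]_N) :
  (1 <= N)%N -> bounded_domain Omega -> 0 < T ->
  compact K -> K `<=` Omega ->
  hausdorff_measure K = capacity Omega T K.
Proof.
move=> N1 dO T0 cK KO; have [oO [_ [_ bO]]] := dO.
rewrite (hausdorff_leb N1 cK); apply/eqP; rewrite eq_le; apply/andP; split.
  by apply: le_ereal_inf_tmp => _ [psi adm <-]; exact: leb_le_cap_energy adm.
by apply/lee_addgt0Pr => e e0; exact: capacity_le.
Qed.
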